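(* Let $k$ be a field of characteristic $\neq 2$, let $Q$ be a quaternion algebra over $k$, let $C$ be a Hurwitz superalgebra over $k$, let $S=\bar C$ be the associated para-Hurwitz superalgebra and let $J=H_3(C)$ be the Jordan superalgebra of hermitian $3\times3$ matrices over $C$. Let $\Phi:\mathfrak{g}(S_1,S)\to\mathfrak{der}\,J$ be the isomorphism of Lie superalgebras with $\Phi((d_0,d_1,d_2))=D_{(d_0,d_1,d_2)}$ and $\Phi(\iota_i(1\otimes a))=D_i(a)$. Then $\Phi$ extends to an isomorphism of Lie superalgebras $$\Phi_3:\mathfrak{g}(\bar Q,S)\longrightarrow\mathcal{T}(Q,J)=(Q^0\otimes J)\oplus\mathfrak{der}\,J$$ given as follows: (1) the restriction of $\Phi_3$ to $\mathfrak{g}(S_1,S)$ coincides with $\Phi$; (2) for any $a\in Q^0$, the elements $(0,-R_a,L_a)\in\ker\pi_0$, $(L_a,0,-R_a)\in\ker\pi_1$ and $(-R_a,L_a,0)\in\ker\pi_2$ of $\mathfrak{tri}(\bar Q)=\ker\pi_0\oplus\ker\pi_1\oplus\ker\pi_2$ map, respectively, to $\frac12(a\otimes e_0)$, $\frac12(a\otimes e_1)$ and $\frac12(a\otimes e_2)$; (3) for any $i=0,1,2$, $a\in Q^0$ and $x\in S$, $\Phi_3(\iota_i(a\otimes x))=-\frac12\,a\otimes\iota_i(x)$.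
   Context: All vector spaces and superspaces are finite dimensional over $k$, $\mathrm{char}\,k\ne 2$. In signs, $(-1)^{xy}$ is $-1$ if the homogeneous elements $x,y$ are both odd and $1$ otherwise. Indices $i=0,1,2$ are taken modulo $3$. Composition superalgebras. A quadratic superform on $U=U_{\bar 0}\oplus U_{\bar 1}$ is a pair $q=(q_{\bar 0},\mathrm{b})$, with $q_{\bar 0}$ a quadratic form on $U_{\bar 0}$ and $\mathrm{b}$ a supersymmetric even bilinear form on $U$ whose restriction to $U_{\bar 0}$ is the polar form $q_{\bar 0}(x+y)-q_{\bar 0}(x)-q_{\bar 0}(y)$; it is regular if $\mathrm{b}$ is nondegenerate. A composition superalgebra is a superalgebra $C$ with a regular quadratic superform $q$ (the norm) such that $q_{\bar 0}(x_{\bar 0}y_{\bar 0})=q_{\bar 0}(x_{\bar 0})q_{\bar 0}(y_{\bar 0})$, $\mathrm{b}(x_{\bar 0}y,x_{\bar 0}z)=q_{\bar 0}(x_{\bar 0})\mathrm{b}(y,z)=\mathrm{b}(yx_{\bar 0},zx_{\bar 0})$, and $\mathrm{b}(xy,zt)+(-1)^{xy+xz+yz}\mathrm{b}(zy,xt)=(-1)^{yz}\mathrm{b}(x,z)\mathrm{b}(y,t)$ for $x_{\bar 0},y_{\bar 0}\in C_{\bar 0}$ and homogeneous $x,y,z,t$. A Hurwitz superalgebra is a unital composition superalgebra; its standard involution is $\bar x=\mathrm{b}(x,1)1-x$; the attached para-Hurwitz superalgebra $\bar C$ is $C$ with the same norm and new product $x\bullet y=\bar x\bar y$. It is a symmetric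 composition superalgebra, i.e. $\mathrm{b}(x\bullet y,z)=\mathrm{b}(x,y\bullet z)$. Triality. For a symmetric composition superalgebra $S$, $\mathfrak{tri}(S)=\mathfrak{tri}(S)_{\bar 0}\oplus\mathfrak{tri}(S)_{\bar 1}$ where $\mathfrak{tri}(S)_{\bar i}=\{(d_0,d_1,d_2)\in\mathfrak{osp}(S,q)_{\bar i}^3: d_0(x\bullet y)=d_1(x)\bullet y+(-1)^{ix}x\bullet d_2(y)\ \forall\text{ homogeneous }x,y\in S\}$, with componentwise bracket; $\mathfrak{osp}(S,q)$ is the orthosymplectic Lie superalgebra of $\mathrm{b}$. Put $\theta(d_0,d_1,d_2)=(d_2,d_0,d_1)$, $l_x(y)=x\bullet y$, $r_x(y)=(-1)^{xy}y\bullet x$, $\sigma_{x,y}(z)=(-1)^{yz}\mathrm{b}(x,z)y-(-1)^{x(y+z)}\mathrm{b}(y,z)x$ and $t_{x,y}=(\sigma_{x,y},\frac12\mathrm{b}(x,y)1-r_xl_y,\frac12\mathrm{b}(x,y)1-l_xr_y)\in\mathfrak{tri}(S)$. The Lie superalgebra $\mathfrak{g}(S,S')$. For symmetric composition superalgebras $S,S'$, $\mathfrak{g}(S,S')=\mathfrak{tri}(S)\oplus\mathfrak{tri}(S')\oplus\bigl(\oplus_{i=0}^2\iota_i(S\otimes S')\bigr)$, where $\iota_i(S\otimes S')$ is a copy of $S\otimes S'$; $\mathfrak{tri}(S)\oplus\mathfrak{tri}(S')$ is a subsuperalgebra with its direct sum bracket, and for homogeneous elements: $[(d_0,d_1,d_2),\iota_i(x\otimes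 x')]=\iota_i(d_i(x)\otimes x')$; $[(d_0',d_1',d_2'),\iota_i(x\otimes x')]=(-1)^{d_i'x}\iota_i(x\otimes d_i'(x'))$; $[\iota_i(x\otimes x'),\iota_{i+1}(y\otimes y')]=(-1)^{x'y}\iota_{i+2}((x\bullet y)\otimes(x'\bullet y'))$; $[\iota_i(x\otimes x'),\iota_i(y\otimes y')]=(-1)^{xx'+xy'+yy'}\mathrm{b}'(x',y')\theta^i(t_{x,y})+(-1)^{yx'}\mathrm{b}(x,y)\theta'^i(t'_{x',y'})$ (primes denote the analogous objects for $S'$). Quaternions. A quaternion algebra $Q$ is a four dimensional unital composition algebra, with norm $q$, polar form $\mathrm{b}$, standard involution $x\mapsto\bar x$ and product denoted by juxtaposition. Here $\bar Q$ denotes $Q$ with the same norm and with product $x\bullet y=\overline{xy}=\bar y\,\bar x$ (the para-Hurwitz algebra attached to the opposite algebra of $Q$). $Q^0$ is the orthogonal subspace to $1$ (trace zero elements). In the claim, for $a\in Q^0$, $L_a$ and $R_a$ in triples denote left and right multiplication by $a$ in $Q$ (not in $\bar Q$). $\pi_i:\mathfrak{tri}(\bar Q)\to\mathfrak{so}(Q)$ is the projection on the $i$th component; one has $\mathfrak{tri}(\bar Q)=\ker\pi_0\oplus\ker\pi_1\oplus\ker\pi_2$ with $\ker\pi_0=\{(0,-R_a,L_a)\}$, $\ker\pi_1=\{(L_a,0,-R_a)\}$, $\ker\pi_2=\{(-R_a,L_a,0)\}$, $a\in Q^0$. $S_1=k1$ is the para-Hurwitz algebra of $k$ ($1\bullet1=1$,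 $\mathrm{b}(1,1)=2$, $\mathfrak{tri}(S_1)=0$); via $S_1=k1\subset\bar Q$, $\mathfrak{g}(S_1,S)=\mathfrak{tri}(S)\oplus(\oplus_i\iota_i(1\otimes S))$ is a subsuperalgebra of $\mathfrak{g}(\bar Q,S)$ and $\mathfrak{g}(\bar Q,S)=\mathfrak{g}(S_1,S)\oplus\mathfrak{tri}(\bar Q)\oplus(\oplus_i\iota_i(Q^0\otimes S))$. The Jordan superalgebra $J=H_3(C)$: the hermitian $3\times3$ matrices over $C$ (relative to $(a_{ij})^*=(\bar a_{ji})$) with product $x\circ y=\frac12(xy+(-1)^{xy}yx)$. Write $J=(\oplus_{i=0}^2ke_i)\oplus(\oplus_{i=0}^2\iota_i(S))$, where $e_0,e_1,e_2$ are the diagonal matrix units and $$\iota_0(a)=2\begin{pmatrix}0&0&0\\ 0&0&\bar a\\ 0&a&0\end{pmatrix},\quad \iota_1(a)=2\begin{pmatrix}0&0&a\\ 0&0&0\\ \bar a&0&0\end{pmatrix},\quad \iota_2(a)=2\begin{pmatrix}0&\bar a&0\\ a&0&0\\ 0&0&0\end{pmatrix}.$$ For $x\in J$, $L_x$ is multiplication by $x$ in $J$; $\mathfrak{der}\,J$ is the Lie superalgebra of derivations. For $(d_0,d_1,d_2)\in\mathfrak{tri}(S)$, $D_{(d_0,d_1,d_2)}\in\mathfrak{der}\,J$ is given by $e_i\mapsto0$, $\iota_i(a)\mapsto\iota_i(d_i(a))$; and $D_i(a)=2[L_{\iota_i(a)},L_{e_{i+1}}]\in\mathfrak{der}\,J$.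 (It is known that $\Phi$ is an isomorphism of Lie superalgebras.) The Lie superalgebra $\mathcal{T}(Q,H)$. For a Jordan superalgebra $H$ and $x,y\in H$ put $d_{x,y}=[L_x,L_y]$ (supercommutator), a derivation of $H$. Then $\mathcal{T}(Q,H)=(Q^0\otimes H)\oplus\mathfrak{der}\,H$, where $\mathfrak{der}\,H$ is a subsuperalgebra, $[d,a\otimes x]=a\otimes d(x)$, and $[a\otimes x,b\otimes y]=[a,b]\otimes xy-2\mathrm{b}(a,b)d_{x,y}$ for $a,b\in Q^0$, $x,y\in H$, $d\in\mathfrak{der}\,H$ (elements of $Q^0$ are even and $xy$ is the product in $H$).
   Formalization: In (2) the images are a⊗e_0, a⊗e_1, a⊗e_2, without the factor 1/2: since [(0,-R_a,L_a),(0,-R_b,L_b)]=(0,-R_[a,b],L_[a,b]) and [a⊗e_0,b⊗e_0]=[a,b]⊗e_0, the factor 1/2 is incompatible with the brackets. *)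

(* Defs.v *)
From HB Require Import structures.
From mathcomp Require Import all_boot all_order all_algebra.

Set Implicit Arguments.
Unset Strict Implicit.
Unset Printing Implicit Defensive.

Import GRing.Theory.
Local Open Scope ring_scope.

(* Parities are booleans, [true] being odd; they coerce to 0 and 1 in the
   exponents of the signs, and [i (+) j] is their sum modulo 2. *)
Record superspace (k : fieldType) := Superspace {
  sspace :> vectType k;
  spart : bool -> {vspace sspace};
  spart_total : (spart false + spart true = fullv)%VS;
  spart_direct : (spart false :&: spart true = 0)%VS }.

Definition hcomp (k : fieldType) (V : superspace k) (i : bool) : 'End(V) :=
  daddv_pi (spart V i) (spart V (~~ i)).

(* Additive extension of a map given on homogeneous elements: [B i x] is its
   value at the element x of parity i. *)
Definition hext (k : fieldType) (V : superspace k) (U : vectType k)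
    (B : bool -> V -> U) (x : V) : U :=
  \sum_(i : bool) B i (hcomp V i x).

Lemma even_total (k : fieldType) (V : vectType k) (P := fun i : bool =>
  if i then 0%VS else {:V}%VS) : (P false + P true = fullv)%VS.
Proof. by rewrite /P addv0. Qed.

Lemma even_direct (k : fieldType) (V : vectType k) (P := fun i : bool =>
  if i then 0%VS else {:V}%VS) : (P false :&: P true = 0)%VS.
Proof. by rewrite /P capv0. Qed.

Definition even_superspace (k : fieldType) (V : vectType k) : superspace k :=
  Superspace (even_total V) (even_direct V).

Lemma linfunE (k : fieldType) (V W : vectType k) (f : V -> W) (x : V) :
  linear f -> linfun f x = f x.
Proof.
move=> fl; pose l := GRing.isLinear.Build _ _ _ _ f fl.
by pose L : {linear V -> W} := HB.pack f l; apply: (lfunE L x).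
Qed.

Lemma hcomp_mem (k : fieldType) (V : superspace k) (i : bool) (x : V) :
  hcomp V i x \in spart V i.
Proof. exact: memv_pi. Qed.

Lemma hcomp_add (k : fieldType) (V : superspace k) (x : V) :
  hcomp V false x + hcomp V true x = x.
Proof.
apply: daddv_pi_add; first exact: spart_direct.
by rewrite spart_total memvf.
Qed.

Lemma hcomp_id (k : fieldType) (V : superspace k) (i : bool) (x : V) :
  x \in spart V i -> hcomp V i x = x.
Proof.
apply: daddv_pi_id; case: i; last exact: spart_direct.
by rewrite capvC; apply: spart_direct.
Qed.

Lemma hcomp_eq0 (k : fieldType) (V : superspace k) (i : bool) (x : V) :
  x \in spart V (~~ i) -> hcomp V i x = 0.
Proof.
move=> /hcomp_id xE; have := hcomp_add x; rewrite -{3}xE.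
case: i {xE} => /= /eqP; rewrite -subr_eq0.
  by rewrite (addrC (hcomp V false x)) addrK => /eqP.
by rewrite addrK => /eqP.
Qed.

Definition end_homog (k : fieldType) (V : superspace k) (i : bool)
    (f : 'End(V)) : Prop :=
  forall (j : bool) (x : V), x \in spart V j -> f x \in spart V (i (+) j).

Definition end_comp (k : fieldType) (V : superspace k) (i : bool)
    (f : 'End(V)) : 'End(V) :=
  \sum_(j : bool) (hcomp V (i (+) j) \o f \o hcomp V j)%VF.

Definition end_ext (k : fieldType) (V : superspace k) (U : vectType k)
    (B : bool -> 'End(V) -> U) (f : 'End(V)) : U :=
  \sum_(i : bool) B i (end_comp i f).

Definition supercomm (k : fieldType) (V : superspace k) (f g : 'End(V)) :
    'End(V) :=
  end_ext (fun i f => end_ext (fun j g =>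
    (f \o g)%VF - (-1) ^+ (i * j) *: (g \o f)%VF) g) f.

(* The tensor product, in coordinates with respect to fixed bases. *)
Definition tensor (k : fieldType) (V W : vectType k) : vectType k :=
  'M[k]_(\dim {:V}, \dim {:W}).

Definition tens (k : fieldType) (V W : vectType k) (x : V) (y : W) :
    tensor V W :=
  \matrix_(i, j) (coord (vbasis {:V}) i x * coord (vbasis {:W}) j y).

Definition tlift (k : fieldType) (V W U : vectType k) (B : V -> W -> U)
    (X : tensor V W) : U :=
  \sum_i \sum_j X i j *: B (vbasis {:V})`_i (vbasis {:W})`_j.

Lemma tlift_tens (k : fieldType) (V W U : vectType k) (B : V -> W -> U)
    (x : V) (y : W) :
    (forall w, linear (B^~ w)) -> (forall v, linear (B v)) ->
  tlift B (tens x y) = B x y.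
Proof.
move=> Bl Br.
pose l w := GRing.isLinear.Build _ _ _ _ (B^~ w) (Bl w).
pose r v := GRing.isLinear.Build _ _ _ _ (B v) (Br v).
pose L w : {linear V -> U} := HB.pack (B^~ w) (l w).
pose M v : {linear W -> U} := HB.pack (B v) (r v).
rewrite {2}(coord_vbasis (memvf x)) -[RHS]/(L y _) linear_sum.
apply: eq_bigr => i _; rewrite linearZ /= {2}(coord_vbasis (memvf y)).
rewrite -[B _ _]/(M (vbasis {:V})`_i _) linear_sum scaler_sumr.
by apply: eq_bigr => j _; rewrite linearZ scalerA mxE.
Qed.

Definition tensv (k : fieldType) (V W : vectType k)
    (A : {vspace V}) (B : {vspace W}) : {vspace tensor V W} :=
  <<[seq tens x y | x <- vbasis A, y <- vbasis B]>>%VS.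

Definition tens_part (k : fieldType) (V W : superspace k) (i : bool) :
    {vspace tensor V W} :=
  (\sum_(j : bool) tensv (spart V j) (spart W (i (+) j)))%VS.

(* Linear map on a tensor product given on x (x) y for x, y homogeneous of
   parities i, j. *)
Definition hlift (k : fieldType) (V W : superspace k) (U : vectType k)
    (B : bool -> V -> bool -> W -> U) : tensor V W -> U :=
  tlift (fun x y => hext (fun i x => hext (fun j y => B i x j y) y) x).

Definition tens_comp (k : fieldType) (V W : superspace k) (i : bool) :
    tensor V W -> tensor V W :=
  hlift (fun j x j' y => if j (+) j' == i then tens x y else 0).

(* These two records only carry the operations; the axioms are stated below. *)
Record superalgebra (k : fieldType) := Superalgebra {
  alg_space :> superspace k;
  amul : alg_space -> alg_space -> alg_space }.

(* [cq] is only meaningful on the even part. *)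
Record normed_superalgebra (k : fieldType) := NormedSuperalgebra {
  calg :> superalgebra k;
  cq : calg -> k;
  cb : calg -> calg -> k }.

Definition superalgebra_axiom (k : fieldType) (A : superalgebra k) : Prop :=
  [/\ forall y, linear ((@amul k A)^~ y), forall x, linear (@amul k A x) &
      forall (i j : bool) (x y : A), x \in spart A i -> y \in spart A j ->
        amul x y \in spart A (i (+) j)].

Definition polar (k : fieldType) (V : vectType k) (q : V -> k) (x y : V) : k :=
  q (x + y) - q x - q y.

Definition quadratic_superform_axiom (k : fieldType) (U : superspace k)
    (q : U -> k) (b : U -> U -> k) : Prop :=
  [/\ (forall y, scalar (b^~ y)) /\ (forall x, scalar (b x)),
      forall x y, x \in spart U false -> y \in spart U true -> b x y = 0,
      forall (i j : bool) (x y : U), x \in spart U i -> y \in spart U j ->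
        b x y = (-1) ^+ (i * j) * b y x,
      forall (c : k) x, x \in spart U false -> q (c *: x) = c ^+ 2 * q x &
      forall x y, x \in spart U false -> y \in spart U false ->
        b x y = polar q x y].

Definition nondegenerate (k : fieldType) (U : vectType k) (b : U -> U -> k) :=
  forall x, (forall y, b x y = 0) -> x = 0.

Definition composition_superalgebra (k : fieldType)
    (C : normed_superalgebra k) : Prop :=
  let q := @cq k C in let b := @cb k C in let mul := @amul k C in
  [/\ superalgebra_axiom C,
      quadratic_superform_axiom q b /\ nondegenerate b,
      forall x y, x \in spart C false -> y \in spart C false ->
        q (mul x y) = q x * q y,
      forall x y z, x \in spart C false ->
        b (mul x y) (mul x z) = q x * b y z /\
        q x * b y z = b (mul y x) (mul z x) &
      forall (i j l m : bool) (x y z t : C),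
        x \in spart C i -> y \in spart C j -> z \in spart C l ->
        t \in spart C m ->
        b (mul x y) (mul z t) +
          (-1) ^+ (i * j + i * l + j * l) * b (mul z y) (mul x t)
        = (-1) ^+ (j * l) * (b x z * b y t)].

Record hurwitz_superalgebra (k : fieldType) := HurwitzSuperalgebra {
  hcsa :> normed_superalgebra k;
  hone : hcsa;
  hcsaP : composition_superalgebra hcsa;
  hone_neq0 : hone != 0;
  hmul1x : forall x, amul hone x = x;
  hmulx1 : forall x, amul x hone = x }.

Definition hbar (k : fieldType) (C : hurwitz_superalgebra k) (x : C) : C :=
  cb x (hone C) *: hone C - x.

Definition para_hurwitz (k : fieldType) (C : hurwitz_superalgebra k) :
    normed_superalgebra k :=
  NormedSuperalgebra
    (calg := Superalgebra (fun x y : C => amul (hbar x) (hbar y)))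
    (@cq k C) (@cb k C).

Definition S1 (k : fieldType) : normed_superalgebra k :=
  NormedSuperalgebra
    (calg := @Superalgebra k (even_superspace k^o) (fun x y => x * y))
    (fun x => x ^+ 2) (fun x y => 2%:R * (x * y)).

Record quaternion_algebra (k : fieldType) := QuaternionAlgebra {
  qspace :> vectType k;
  qmul : qspace -> qspace -> qspace;
  qone : qspace;
  qnorm : qspace -> k;
  qmul_linearl : forall y, linear (qmul^~ y);
  qmul_linearr : forall x, linear (qmul x);
  qmul1x : forall x, qmul qone x = x;
  qmulx1 : forall x, qmul x qone = x;
  qnormZ : forall c x, qnorm (c *: x) = c ^+ 2 * qnorm x;
  qpolar_linearl : forall y, scalar ((polar qnorm)^~ y);
  qpolar_linearr : forall x, scalar (polar qnorm x);
  qpolar_nondeg : nondegenerate (polar qnorm);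
  qnormM : forall x y, qnorm (qmul x y) = qnorm x * qnorm y;
  qdim : \dim {:qspace} = 4 }.

Definition qpolar (k : fieldType) (Q : quaternion_algebra k) : Q -> Q -> k :=
  polar (@qnorm k Q).

Definition qbar (k : fieldType) (Q : quaternion_algebra k) (x : Q) : Q :=
  qpolar x (qone Q) *: qone Q - x.

Definition Qbar (k : fieldType) (Q : quaternion_algebra k) :
    normed_superalgebra k :=
  NormedSuperalgebra
    (calg := @Superalgebra k (even_superspace Q)
               (fun x y : Q => qbar (qmul x y)))
    (@qnorm k Q) (@qpolar k Q).

Definition Q0 (k : fieldType) (Q : quaternion_algebra k) : {vspace Q} :=
  lker (linfun (fun x : Q => qpolar x (qone Q) : k^o)).

Definition qleft (k : fieldType) (Q : quaternion_algebra k) (a : Q) :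
    'End(Q) := linfun (fun x => qmul a x).
Definition qright (k : fieldType) (Q : quaternion_algebra k) (a : Q) :
    'End(Q) := linfun (fun x => qmul x a).

Definition osp (k : fieldType) (S : normed_superalgebra k) (i : bool)
    (d : 'End(S)) : Prop :=
  end_homog i d /\
  forall (j l : bool) (x y : S), x \in spart S j -> y \in spart S l ->
    cb (d x) y + (-1) ^+ (i * j) * cb x (d y) = 0.

Definition triple (T : nmodType) (d0 d1 d2 : T) : {ffun 'I_3 -> T} :=
  [ffun i : 'I_3 => [:: d0; d1; d2]`_i].

Definition tri (k : fieldType) (S : normed_superalgebra k) (i : bool)
    (d : {ffun 'I_3 -> 'End(S)}) : Prop :=
  (forall n, osp i (d n)) /\
  forall (j l : bool) (x y : S), x \in spart S j -> y \in spart S l ->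
    d 0 (amul x y) = amul (d 1 x) y + (-1) ^+ (i * j) *: amul x (d 2%:R y).

Definition theta (k : fieldType) (V : superspace k)
    (d : {ffun 'I_3 -> 'End(V)}) : {ffun 'I_3 -> 'End(V)} :=
  triple (d 2%:R) (d 0) (d 1).

Definition lmulS (k : fieldType) (A : superalgebra k) (x : A) : 'End(A) :=
  linfun (amul x).

Definition rmulS (k : fieldType) (A : superalgebra k) (x : A) : 'End(A) :=
  linfun (hext (fun j y => hext (fun i x => (-1) ^+ (i * j) *: amul y x) x)).

Definition sigma (k : fieldType) (S : normed_superalgebra k) (x y : S) :
    'End(S) :=
  linfun (hext (fun l z => hext (fun i x => hext (fun j y =>
    ((-1) ^+ (j * l) * cb x z) *: y
    - ((-1) ^+ (i * (j + l)) * cb y z) *: x) y) x)).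

Definition ttri (k : fieldType) (S : normed_superalgebra k) (x y : S) :
    {ffun 'I_3 -> 'End(S)} :=
  triple (sigma x y)
    ((2%:R^-1 * cb x y) *: \1%VF - (rmulS x \o lmulS y)%VF)
    ((2%:R^-1 * cb x y) *: \1%VF - (lmulS x \o rmulS y)%VF).

(* A Lie superalgebra is presented inside an ambient vector space:
   [lpart i] is the set of its homogeneous elements of parity i, and only the
   values of [lbr] on the sum of these two subspaces matter. *)
Record lie_data (k : fieldType) := LieData {
  lspace :> vectType k;
  lpart : bool -> lspace -> Prop;
  lbr : lspace -> lspace -> lspace }.

Definition lmem (k : fieldType) (L : lie_data k) (x : L) : Prop :=
  exists x0 x1 : L, [/\ lpart false x0, lpart true x1 & x = x0 + x1].

Definition lie_iso (k : fieldType) (L L' : lie_data k) (f : 'Hom(L, L')) :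
    Prop :=
  [/\ forall i (x : L), lpart i x -> lpart i (f x),
      forall i (y : L'), lpart i y -> exists2 x : L, lpart i x & f x = y,
      forall x y : L, lmem x -> lmem y -> f x = f y -> x = y &
      forall x y : L, lmem x -> lmem y -> f (lbr x y) = lbr (f x) (f y)].

Section G.

Variables (k : fieldType) (S S' : normed_superalgebra k).

Definition gspace : vectType k :=
  ({ffun 'I_3 -> 'End(S)} * {ffun 'I_3 -> 'End(S')}
   * {ffun 'I_3 -> tensor S S'})%type.

Definition gtri (d : {ffun 'I_3 -> 'End(S)}) : gspace := (d, 0, 0).
Definition gtri' (d : {ffun 'I_3 -> 'End(S')}) : gspace := (0, d, 0).
Definition giota (i : 'I_3) (X : tensor S S') : gspace :=
  (0, 0, [ffun j => if j == i then X else 0]).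

Definition gpart (i : bool) (u : gspace) : Prop :=
  [/\ tri i u.1.1, tri i u.1.2 & forall n, u.2 n \in tens_part S S' i].

Definition gcomp (i : bool) (u : gspace) : gspace :=
  ([ffun n => end_comp i (u.1.1 n)], [ffun n => end_comp i (u.1.2 n)],
   [ffun n => tens_comp i (u.2 n)]).

(* The products inside tri(S) + tri(S') and inside each iota_i (S (x) S'). *)
Definition gbr_diag (u v : gspace) : gspace :=
  gtri [ffun n => supercomm (u.1.1 n) (v.1.1 n)]
  + gtri' [ffun n => supercomm (u.1.2 n) (v.1.2 n)]
  + \sum_(n : 'I_3)
      hlift (fun i x i' x' => hlift (fun j y j' y' =>
        gtri (((-1) ^+ (i * i' + i * j' + j * j') * cb x' y')
                *: iter n (@theta k S) (ttri x y))
        + gtri' (((-1) ^+ (j * i') * cb x y)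
                *: iter n (@theta k S') (ttri x' y'))) (v.2 n)) (u.2 n).

(* The products [d, X], [d', X], with X in iota_n (S (x) S'), and the products
   of iota_n (S (x) S') by iota_(n+1) (S (x) S'), in this order only. *)
Definition gbr_cross (u v : gspace) : gspace :=
  \sum_(n : 'I_3)
    (giota n (hlift (fun _ x _ x' => tens (u.1.1 n x) x') (v.2 n))
     + giota n (hlift (fun i x _ x' => end_ext (fun p d' =>
         (-1) ^+ (p * i) *: tens x (d' x')) (u.1.2 n)) (v.2 n))
     + giota (n + 2%:R) (hlift (fun _ x i' x' => hlift (fun j y _ y' =>
         (-1) ^+ (i' * j) *: tens (amul x y) (amul x' y'))
           (v.2 (n + 1))) (u.2 n))).

Definition gbr (u v : gspace) : gspace :=
  gbr_diag u v + gbr_cross u v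
  - \sum_(i : bool) \sum_(j : bool)
      (-1) ^+ (i * j) *: gbr_cross (gcomp j v) (gcomp i u).

Definition lie_g : lie_data k := LieData gpart gbr.

End G.

(* Since tri(S1) = 0, the inclusion only involves tri(S) and the map
   c (x) x |-> c1 (x) x. *)
Definition gincl (k : fieldType) (Q : quaternion_algebra k)
    (S : normed_superalgebra k) (u : lie_g (S1 k) S) :
    lie_g (Qbar Q) S :=
  gtri' (Qbar Q) u.1.2
  + \sum_(n : 'I_3) giota (S := Qbar Q) n
      (tlift (fun (c : k^o) (x : S) => tens ((c : k) *: qone Q) x) (u.2 n)).

Definition der_part (k : fieldType) (H : superalgebra k) (i : bool)
    (d : 'End(H)) : Prop :=
  end_homog i d /\
  forall (j l : bool) (x y : H), x \in spart H j -> y \in spart H l ->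
    d (amul x y) = amul (d x) y + (-1) ^+ (i * j) *: amul x (d y).

Definition der (k : fieldType) (H : superalgebra k) : lie_data k :=
  LieData (@der_part k H) (@supercomm k H).

Section T.

Variables (k : fieldType) (Q : quaternion_algebra k) (H : superalgebra k).

Definition tspace : vectType k := (tensor Q H * 'End(H))%type.

Definition tpart (i : bool) (u : tspace) : Prop :=
  u.1 \in tensv (Q0 Q) (spart H i) /\ der_part i u.2.

Definition tact (d : 'End(H)) (X : tensor Q H) : tensor Q H :=
  tlift (fun a x => tens a (d x)) X.

Definition tcommQ (a b : Q) : Q := qmul a b - qmul b a.

(* Elements of Q0 being even, a (x) x has the parity of x. *)
Definition tbr (u v : tspace) : tspace :=
  (tlift (fun a x => tlift (fun b y =>
     tens (tcommQ a b) (amul x y)) v.1) u.1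
   + tact u.2 v.1
   - hlift (V := even_superspace Q) (fun _ a i x => end_ext (fun j d =>
       (-1) ^+ (i * j) *: tens a (d x)) v.2) u.1,
   supercomm u.2 v.2
   - 2%:R *: tlift (fun a x => tlift (fun b y =>
       qpolar a b *: supercomm (lmulS x) (lmulS y)) v.1) u.1).

Definition lie_T : lie_data k := LieData tpart tbr.

End T.

Section H3.

Variables (k : fieldType) (C : hurwitz_superalgebra k).

Definition mat3 : vectType k := {ffun 'I_3 * 'I_3 -> C}.

Definition mat3_mul (x y : mat3) : mat3 :=
  [ffun ij => \sum_(l : 'I_3) amul (x (ij.1, l)) (y (l, ij.2))].

Definition mat3_star (x : mat3) : mat3 := [ffun ij => hbar (x (ij.2, ij.1))].

Definition herm3 : {vspace mat3} := fixedSpace (linfun mat3_star).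

Definition H3_part (i : bool) : {vspace subvs_of herm3} :=
  (\bigcap_(jl : 'I_3 * 'I_3)
     linfun (fun x : subvs_of herm3 => vsval x jl) @^-1: spart C i)%VS.

Lemma H3_partP (i : bool) (x : subvs_of herm3) :
  reflect (forall jl, vsval x jl \in spart C i) (x \in H3_part i).
Proof.
have E jl : linfun (fun x : subvs_of herm3 => vsval x jl) x = vsval x jl.
  by apply: linfunE => c u v; rewrite linearP !ffunE.
apply: (iffP idP) => [|Hx].
  by rewrite memvE => /subv_bigcapP Hx jl; rewrite -E memv_preim memvE Hx.
by rewrite memvE; apply/subv_bigcapP => jl _; rewrite -memvE -memv_preim E.
Qed.

Lemma hbar_linear : linear (@hbar k C).
Proof.
case: (hcsaP C) => _ [[[bl _] _ _ _ _] _] _ _ _ c x y.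
by rewrite /hbar bl scalerDl scalerBr scalerA opprD addrACA.
Qed.

Lemma herm3P (x : mat3) : reflect (mat3_star x = x) (x \in herm3).
Proof.
have <- : linfun mat3_star x = mat3_star x.
  by apply: linfunE => c u v; apply/ffunP => jl; rewrite !ffunE hbar_linear.
exact: fixedSpaceP.
Qed.

Lemma hone_even : hone C \in spart C false.
Proof.
case: (hcsaP C) => [[ml mr mhom]] _ _ _ _.
have mD x y z : amul (x + y) z = amul x z + amul y z :> C.
  by have := ml z 1 x y; rewrite !scale1r.
have mDr x y z : amul z (x + y) = amul z x + amul z y :> C.
  by have := mr z 1 x y; rewrite !scale1r.
set e0 := hcomp C false (hone C); set e1 := hcomp C true (hone C).
have e01 : e0 + e1 = hone C := hcomp_add _.
have e1x j x : x \in spart C j -> amul e1 x = 0.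
  move=> xj; have xE : amul e1 x = x - amul e0 x.
    by rewrite -[X in X - _](hmul1x x) -e01 mD addrAC subrr add0r.
  have m0 : amul e1 x \in spart C j.
    by rewrite xE rpredB // -[j]addFb mhom // hcomp_mem.
  have m1 : amul e1 x \in spart C (~~ j) by rewrite -addTb mhom // hcomp_mem.
  by rewrite -(hcomp_id m1) hcomp_eq0 ?negbK.
have e10 : e1 = 0.
  rewrite -[e1](hmulx1 (h := C)) -e01 mDr.
  by rewrite (e1x _ _ (hcomp_mem _ _)) (e1x _ _ (hcomp_mem _ _)) addr0.
by rewrite -e01 e10 addr0 hcomp_mem.
Qed.

Lemma hbar_hcomp (i : bool) (x : C) : hbar (hcomp C i x) = hcomp C i (hbar x).
Proof.
case: (hcsaP C) => _ [[[bl br] b01 bs _ _] _] _ _ _.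
have b1 : cb (hcomp C true x) (hone C) = 0.
  rewrite (bs true false) ?hcomp_mem ?hone_even //.
  by rewrite b01 ?mulr0 ?hcomp_mem ?hone_even.
have bD : cb x (hone C) = cb (hcomp C false x) (hone C).
  have := bl (hone C) 1 (hcomp C true x) (hcomp C false x).
  by rewrite b1 mulr0 add0r scale1r addrC hcomp_add.
rewrite /hbar linearB linearZ /=; case: i.
  by rewrite b1 scale0r (hcomp_eq0 (i := true) hone_even) scaler0.
by rewrite bD (hcomp_id hone_even).
Qed.

Lemma H3_total : (H3_part false + H3_part true = fullv)%VS.
Proof.
apply/eqP; rewrite eqEsubv subvf; apply/subvP => x _.
pose y i : mat3 := [ffun jl => hcomp C i (vsval x jl)].
have yh i : y i \in herm3.
  apply/herm3P/ffunP => jl; rewrite !ffunE hbar_hcomp.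
  by rewrite -[in RHS](herm3P _ (subvsP x)) !ffunE.
have yp i : vsproj herm3 (y i) \in H3_part i.
  by apply/H3_partP => jl; rewrite vsprojK // ffunE hcomp_mem.
suff -> : x = vsproj herm3 (y false) + vsproj herm3 (y true).
  by rewrite memv_add.
apply/val_inj; rewrite [RHS](raddfD (vsval (U := herm3))) /= !vsprojK //.
by apply/ffunP => jl; rewrite !ffunE hcomp_add.
Qed.

Lemma H3_direct : (H3_part false :&: H3_part true = 0)%VS.
Proof.
apply/eqP; rewrite -subv0; apply/subvP => x /memv_capP[/H3_partP x0 /H3_partP x1].
rewrite memv0; apply/eqP/val_inj/ffunP => jl; rewrite /= ffunE; apply/eqP.
by rewrite -memv0 -(spart_direct C) memv_cap x0 x1.
Qed.

Definition H3_space : superspace k := Superspace H3_total H3_direct.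

(* The projections onto [herm3] below act on hermitian matrices, hence as the
   identity. *)
Definition H3_mul (x y : H3_space) : H3_space :=
  hext (fun i (x : H3_space) => hext (fun j (y : H3_space) =>
    vsproj herm3 (2%:R^-1 *: (mat3_mul (vsval x) (vsval y)
      + (-1) ^+ (i * j) *: mat3_mul (vsval y) (vsval x)))) y) x.

Definition H3 : superalgebra k := Superalgebra H3_mul.

Definition H3_e (n : 'I_3) : H3 :=
  vsproj herm3 [ffun jl => if jl == (n, n) then hone C else 0].

(* Rows and columns are numbered from 0. *)
Definition H3_iota (n : 'I_3) (a : C) : H3 :=
  vsproj herm3 (2%:R *: [ffun jl =>
    if jl == (n + 1, n + 2%:R) then hbar a
    else if jl == (n + 2%:R, n + 1) then a else 0]).

Definition is_Dtri (d : {ffun 'I_3 -> 'End(C)}) (D : 'End(H3)) : Prop :=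
  (forall n, D (H3_e n) = 0) /\
  (forall n a, D (H3_iota n a) = H3_iota n (d n a)).

Definition Dder (n : 'I_3) (a : C) : 'End(H3) :=
  2%:R *: supercomm (lmulS (H3_iota n a)) (lmulS (H3_e (n + 1))).

End H3.

(* Main.v *)
Require Import Defs.
From mathcomp Require Import all_boot all_order all_algebra.
From mathcomp Require Import ring.

(** Write K_m(a), for a in Q0 and m modulo 3, for the triple with -R_a in
    position m + 1, L_a in position m + 2 and 0 in position m.  These triples
    span ker pi_m, and together they span tri(Qbar) ([tri_Qbar_even]).
    Splitting Q = k1 + Q0 therefore gives
      g(Qbar,S) = g(S1,S) + (sum of the K_m(Q0)) + (sum of the iota_n(Q0 (x) S)),
    and the conditions prescribe the map on the three summands.  To have one
    formula, linear on the whole ambient space, the coefficients of an element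
    d of tri(Qbar) on the K_m are read off by a linear map [lam] on End(Q) that
    sends L_a - R_c to a ([exists_qtrace]), and the component in g(S1,S) is the
    retraction [gproj] taking the trace part of the first tensor factor.  The
    result is [Phi3_fun].

    It is a homomorphism.  Both brackets are biadditive and every homogeneous
    element is a sum of elements K_m(a), d in tri(S) and iota_n(q (x) x), so it
    suffices to compare the brackets of two of those ([compat_gen]).  On the
    side of T(Q,J) this involves the products and the operators [L_x, L_y] of
    J for x, y among the e_m and the iota_n(x).  They are all expressed by the
    derivations D_n(x): the L_(e_m) commute, [L_(e_m), L_(iota_n x)] is 0 or a
    multiple of D_n(x), and
      [L_(iota_n x), L_(iota_n y)] = - [D_n(x), D_n(y)],
      [L_(iota_n x), L_(iota_(n+1) y)] = [D_n(x), D_(n+1)(y)]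
    ([Dder_comm_same], [Dder_comm_next]).  On the side of g(Qbar,S), that Phi
    is a homomorphism gives, since t_(1,1) = 0 in S1 and b(1,1) = 2,
      Phi(theta^n(t_(x,y))) = 1/2 [D_n(x), D_n(y)],
      D_(n+2)(x . y) = [D_n(x), D_(n+1)(y)],
    where . is the product of S.  What is left is an identity between elements
    of Q: for equal indices it says how
      t_(p,q) = - K_1(im(p qbar)) - K_2(im(pbar q))
    ([ttri_Qbar]) compares with the commutators of im p and im q, and for
    consecutive indices it is the expression of the product p q by traces and
    imaginary parts.

    It is bijective.  Surjectivity follows from the Peirce decomposition of J
    ([H3_decomp]) and from the surjectivity of Phi.  For injectivity, the
    component in der J determines [gproj] of the argument because Phi is
    injective; contracting the component in Q0 (x) J with a linear form f on Q
    gives an element of J whose Peirce coordinates are the values of f on the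
    coefficients of the K_m and the contractions of the tensors of Q (x) S with
    f o im, and the contractions with all linear forms determine a tensor. *)

Set Implicit Arguments.
Unset Strict Implicit.
Unset Printing Implicit Defensive.

Import GRing.Theory.
Local Open Scope ring_scope.

(** * Linear maps, tensor products and homogeneous extensions *)

Section Linear.
Variables (k : fieldType).

(** Most maps below are plain functions, often with parameters, that are proved
    linear afterwards; these lemmas apply to such functions directly. *)
Lemma linear_add (V W : lmodType k) (f : V -> W) :
  linear f -> {morph f : x y / x + y}.
Proof. by move=> fl x y; have := fl 1 x y; rewrite !scale1r. Qed.

Lemma linear_zero (V W : lmodType k) (f : V -> W) : linear f -> f 0 = 0.
Proof.
move=> fl; have /eqP := fl 1 0 0.
by rewrite !scale1r addr0 -subr_eq0 opprD addNKr oppr_eq0 => /eqP.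
Qed.

Lemma linear_scale (V W : lmodType k) (f : V -> W) c x :
  linear f -> f (c *: x) = c *: f x.
Proof. by move=> fl; have := fl c x 0; rewrite (linear_zero fl) !addr0. Qed.

Lemma linear_opp (V W : lmodType k) (f : V -> W) x :
  linear f -> f (- x) = - f x.
Proof. by move=> fl; rewrite -scaleN1r linear_scale // scaleN1r. Qed.

Lemma linear_sub (V W : lmodType k) (f : V -> W) x y :
  linear f -> f (x - y) = f x - f y.
Proof. by move=> fl; rewrite linear_add // linear_opp. Qed.

Lemma linear_bigsum (V W : lmodType k) (f : V -> W) I r (P : pred I) F :
  linear f -> f (\sum_(i <- r | P i) F i) = \sum_(i <- r | P i) f (F i).
Proof.
by move=> fl; apply: (big_morph f (linear_add fl) (linear_zero fl)).
Qed.

Lemma linear_fun_sum (V W : lmodType k) I r (P : pred I) (F : I -> V -> W) :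
  (forall i, linear (F i)) -> linear (fun x => \sum_(i <- r | P i) F i x).
Proof.
move=> Fl c u v; rewrite scaler_sumr -big_split.
by apply: eq_bigr => i _; apply: Fl.
Qed.

Lemma linear_compose (U V W : lmodType k) (f : V -> W) (g : U -> V) :
  linear f -> linear g -> linear (fun x => f (g x)).
Proof. by move=> fl gl c u v; rewrite gl fl. Qed.

Lemma linear_scaler (V W : lmodType k) (f : V -> W) c :
  linear f -> linear (fun x => c *: f x).
Proof. by move=> fl d u v; rewrite fl scalerDr !scalerA mulrC. Qed.

Lemma linear_addf (V W : lmodType k) (f g : V -> W) :
  linear f -> linear g -> linear (fun x => f x + g x).
Proof. by move=> fl gl c u v; rewrite fl gl scalerDr addrACA. Qed.

Lemma linear_oppf (V W : lmodType k) (f : V -> W) :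
  linear f -> linear (fun x => - f x).
Proof. by move=> fl c u v; rewrite fl scalerN opprD. Qed.

Lemma linear_subf (V W : lmodType k) (f g : V -> W) :
  linear f -> linear g -> linear (fun x => f x - g x).
Proof. by move=> fl gl; apply: linear_addf => //; apply: linear_oppf. Qed.

Lemma scalar_linear_scale (V W : lmodType k) (f : V -> k) (w : W) :
  scalar f -> linear (fun x => f x *: w).
Proof. by move=> fl c u v; rewrite fl scalerDl scalerA. Qed.

Lemma linear_id (V : lmodType k) : linear (fun x : V => x).
Proof. by []. Qed.

Lemma linear_hom (V W : vectType k) (f : 'Hom(V, W)) : linear f.
Proof. by move=> c u v; rewrite linearP. Qed.

Lemma linear_zerof (V W : lmodType k) : linear (fun x : V => 0 : W).
Proof. by move=> c u v; rewrite scaler0 addr0. Qed.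

End Linear.

Section Super.
Variables (k : fieldType).
Implicit Types (V W : superspace k).

Lemma hext_linear V (U : vectType k) (B : bool -> V -> U) :
  (forall i, linear (B i)) -> linear (hext B).
Proof.
by move=> Bl; apply: linear_fun_sum => i c u v; rewrite linearP Bl.
Qed.

Lemma hextE V (U : vectType k) (B : bool -> V -> U) i x :
  (forall i, B i 0 = 0) -> x \in spart V i -> hext B x = B i x.
Proof.
move=> B0 xi; rewrite /hext big_bool.
have h0 : hcomp V (~~ i) x = 0 by rewrite hcomp_eq0 // negbK.
by case: i xi h0 => xi /= ->; rewrite (hcomp_id xi) B0 ?addr0 ?add0r.
Qed.

Lemma hext_add V (U : vectType k) (B1 B2 : bool -> V -> U) x :
  hext (fun i x => B1 i x + B2 i x) x = hext B1 x + hext B2 x.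
Proof. by rewrite /hext big_split. Qed.

Lemma tens_linl (V W : vectType k) (y : W) : linear (fun x : V => tens x y).
Proof.
by move=> c u v; apply/matrixP => i j; rewrite !mxE linearP mulrDl mulrA.
Qed.

Lemma tens_linr (V W : vectType k) (x : V) : linear (fun y : W => tens x y).
Proof.
by move=> c u v; apply/matrixP => i j; rewrite !mxE linearP mulrDr mulrCA.
Qed.

Lemma tensZ (V W : vectType k) c (x : V) (y : W) :
  tens (c *: x) y = tens x (c *: y).
Proof. by rewrite (linear_scale _ _ (tens_linl _)) (linear_scale _ _ (tens_linr _)). Qed.

Lemma tens0l (V W : vectType k) (y : W) : tens (0 : V) y = 0.
Proof. exact: (linear_zero (tens_linl y)). Qed.

Lemma tens0r (V W : vectType k) (x : V) : tens x (0 : W) = 0.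
Proof. exact: (linear_zero (@tens_linr V W x)). Qed.

Lemma tlift_linear (V W U : vectType k) (B : V -> W -> U) : linear (tlift B).
Proof.
move=> c X Y; rewrite /tlift scaler_sumr -big_split; apply: eq_bigr => i _.
rewrite scaler_sumr -big_split; apply: eq_bigr => j _ /=.
by rewrite !mxE scalerDl scalerA.
Qed.

Lemma tlift_addf (V W U : vectType k) (B1 B2 : V -> W -> U) X :
  tlift (fun x y => B1 x y + B2 x y) X = tlift B1 X + tlift B2 X.
Proof.
rewrite /tlift -big_split; apply: eq_bigr => i _ /=.
rewrite -big_split; apply: eq_bigr => j _ /=.
by rewrite scalerDr.
Qed.

Lemma tlift_comp (V W U U' : vectType k) (f : U -> U') (B : V -> W -> U) X :
  linear f -> f (tlift B X) = tlift (fun x y => f (B x y)) X.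
Proof.
move=> fl; rewrite /tlift linear_bigsum //; apply: eq_bigr => i _.
rewrite linear_bigsum //; apply: eq_bigr => j _.
by rewrite linear_scale.
Qed.

(** Used for bilinear maps depending linearly on a parameter, such as the other
    argument of a bracket. *)
Lemma tlift_linf (V W U : vectType k) (B B1 B2 : V -> W -> U) c X :
  (forall x y, B x y = c *: B1 x y + B2 x y) ->
  tlift B X = c *: tlift B1 X + tlift B2 X.
Proof.
move=> BE; rewrite (tlift_comp _ _ (f := fun z => c *: z)).
  by rewrite -tlift_addf; apply: eq_bigr => i _; apply: eq_bigr => j _; rewrite BE.
exact: linear_scaler (@linear_id _ _).
Qed.

Lemma eq_tlift (V W U : vectType k) (B1 B2 : V -> W -> U) X :
  (forall x y, B1 x y = B2 x y) -> tlift B1 X = tlift B2 X.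
Proof. by move=> BE; apply: eq_bigr => i _; apply: eq_bigr => j _; rewrite BE. Qed.

Lemma tensor_sum (V W : vectType k) (X : tensor V W) :
  X = \sum_i \sum_j tens (X i j *: (vbasis {:V})`_i) (vbasis {:W})`_j.
Proof.
apply/matrixP => i j; rewrite summxE (bigD1 i) //= summxE (bigD1 j) //=.
have fV := basis_free (vbasisP {:V}); have fW := basis_free (vbasisP {:W}).
rewrite mxE linearZ /= !coord_free // !eqxx !mulr1.
rewrite big1 => [|l lj]; last first.
  by rewrite mxE (coord_free _ _ fW) (negPf lj) mulr0.
rewrite addr0 big1 ?addr0 // => l li.
rewrite summxE big1 // => j' _; rewrite mxE linearZ /= (coord_free _ _ fV).
by rewrite (negPf li) mulr0 mul0r.
Qed.

(** A pure tensor absorbs scalars, so sums of pure tensors are all tensors and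
    additivity is the only closure property to check. *)
Lemma tensor_ind (V W : vectType k) (P : tensor V W -> Prop) :
  (forall X Y, P X -> P Y -> P (X + Y)) -> (forall x y, P (tens x y)) ->
  forall X, P X.
Proof.
move=> PD Pt X; rewrite [X]tensor_sum.
have P0 : P 0 by rewrite -(tens0r W (0 : V)).
by apply: big_ind => // i _; apply: big_ind.
Qed.

Lemma span_additive_ind (U : vectType k) (s : seq U) (P : U -> Prop) :
  P 0 -> (forall X Y, P X -> P Y -> P (X + Y)) ->
  (forall c x, x \in s -> P (c *: x)) -> forall x, x \in <<s>>%VS -> P x.
Proof.
move=> P0 PD Ps x /(coord_span (X := in_tuple s)) ->.
by apply: big_ind => // i _; apply: Ps; rewrite mem_nth.
Qed.

Lemma tensv_ind (V W : vectType k) (A : {vspace V}) (B : {vspace W})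
    (P : tensor V W -> Prop) :
  (forall X Y, P X -> P Y -> P (X + Y)) ->
  (forall x y, x \in A -> y \in B -> P (tens x y)) ->
  forall X, X \in tensv A B -> P X.
Proof.
move=> PD Pt; apply: span_additive_ind => //.
  by rewrite -(tens0r W (0 : V)); apply: Pt; apply: mem0v.
move=> c X /allpairsP[[x y] [/= xA yB ->]].
rewrite -(linear_scale _ _ (tens_linl y)); apply: Pt; last exact: vbasis_mem.
by rewrite memvZ // vbasis_mem.
Qed.

Lemma tens_mem (V W : vectType k) (A : {vspace V}) (B : {vspace W}) x y :
  x \in A -> y \in B -> tens x y \in tensv A B.
Proof.
move=> xA yB; rewrite (coord_vbasis xA) (coord_vbasis yB).
rewrite (linear_bigsum _ _ _ (tens_linl _)); apply: memv_suml => i _.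
rewrite (linear_scale _ _ (tens_linl _)) memvZ //.
rewrite (linear_bigsum _ _ _ (@tens_linr _ _ _)); apply: memv_suml => j _.
rewrite (linear_scale _ _ (@tens_linr _ _ _)) memvZ // memv_span //.
apply/allpairsP; exists ((vbasis A)`_i, (vbasis B)`_j); split => //=;
  by rewrite mem_nth // size_tuple.
Qed.

Lemma hlift_linear V W (U : vectType k) (B : bool -> V -> bool -> W -> U) :
  linear (hlift B).
Proof. exact: tlift_linear. Qed.

Lemma hlift_addf V W (U : vectType k) (B1 B2 : bool -> V -> bool -> W -> U) X :
  hlift (fun i x j y => B1 i x j y + B2 i x j y) X = hlift B1 X + hlift B2 X.
Proof.
rewrite /hlift -tlift_addf /tlift; apply: eq_bigr => i _; apply: eq_bigr => j _.
by congr (_ *: _); rewrite -hext_add; apply: eq_bigr => l _; rewrite hext_add.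
Qed.

Lemma eq_hlift V W (U : vectType k) (B1 B2 : bool -> V -> bool -> W -> U) X :
  (forall i x j y, B1 i x j y = B2 i x j y) -> hlift B1 X = hlift B2 X.
Proof.
move=> BE; apply: eq_bigr => i _; apply: eq_bigr => j _; congr (_ *: _).
by apply: eq_bigr => l _; apply: eq_bigr => m _.
Qed.

Lemma hlift0 V W (U : vectType k) X : hlift (fun (_ : bool) (_ : V) (_ : bool) (_ : W) => 0 : U) X = 0.
Proof.
rewrite /hlift /tlift big1 // => i _; rewrite big1 // => j _.
by rewrite /hext big1 ?scaler0 // => l _; rewrite big1.
Qed.

Lemma hlift_tens V W (U : vectType k) (B : bool -> V -> bool -> W -> U) i j x y :
  (forall i j y, linear (fun x => B i x j y)) -> (forall i x j, linear (B i x j)) ->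
  x \in spart V i -> y \in spart W j -> hlift B (tens x y) = B i x j y.
Proof.
move=> Bl Br xi yj; rewrite /hlift tlift_tens.
- rewrite (hextE (i := i)) // => [|l]; last first.
    by rewrite /hext big1 // => m _; apply: linear_zero (Bl l m _).
  by rewrite (hextE (i := j)) // => l; apply: linear_zero (Br _ _ l).
- move=> w; apply: hext_linear => l; apply: linear_fun_sum => m; exact: Bl.
by move=> v; apply: linear_fun_sum => l; apply: hext_linear => m; exact: Br.
Qed.

Lemma hlift_linf V W (U : vectType k) (B B1 B2 : bool -> V -> bool -> W -> U) c X :
  (forall i x j y, B i x j y = c *: B1 i x j y + B2 i x j y) ->
  hlift B X = c *: hlift B1 X + hlift B2 X.
Proof.
move=> BE; rewrite (eq_hlift _ BE) hlift_addf; congr (_ + _).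
rewrite /hlift (tlift_comp _ _ (f := fun z => c *: z)); last first.
  by apply: linear_scaler; apply: linear_id.
apply: eq_bigr => i _; apply: eq_bigr => j _; congr (_ *: _).
by rewrite /hext scaler_sumr; apply: eq_bigr => l _; rewrite scaler_sumr.
Qed.

Lemma end_compE V i (f : 'End(V)) j x : x \in spart V j ->
  end_comp i f x = hcomp V (i (+) j) (f x).
Proof.
move=> xj; rewrite /end_comp sum_lfunE big_bool !comp_lfunE.
have h0 : hcomp V (~~ j) x = 0 by rewrite hcomp_eq0 // negbK.
by case: j xj h0 => xj /= ->; rewrite (hcomp_id xj) !linear0 ?addr0 ?add0r.
Qed.

(** An endomorphism is determined by its values on homogeneous elements, which
    is where the formulas with signs make sense. *)
Lemma end_ext_hom V (f g : 'End(V)) :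
  (forall i x, x \in spart V i -> f x = g x) -> f = g.
Proof.
by move=> fg; apply/lfunP => x; rewrite -(hcomp_add x) !linearD /=; congr (_ + _);
  apply: fg; apply: hcomp_mem.
Qed.

Lemma end_comp_linear V i : linear (@end_comp k V i).
Proof.
move=> c f g; apply: end_ext_hom => j x xj.
by rewrite add_lfunE scale_lfunE !(end_compE _ _ xj) add_lfunE scale_lfunE linearP.
Qed.

Lemma end_comp_id V i (f : 'End(V)) : end_homog i f -> end_comp i f = f.
Proof.
by move=> fi; apply: end_ext_hom => j x xj; rewrite (end_compE _ _ xj) hcomp_id // fi.
Qed.

Lemma end_comp_eq0 V i (f : 'End(V)) : end_homog (~~ i) f -> end_comp i f = 0.
Proof.
move=> fi; apply: end_ext_hom => j x xj; rewrite (end_compE _ _ xj) zero_lfunE.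
by rewrite hcomp_eq0 // -addNb fi.
Qed.

Lemma end_ext_linear V (U : vectType k) (B : bool -> 'End(V) -> U) :
  (forall i, linear (B i)) -> linear (end_ext B).
Proof.
move=> Bl; apply: linear_fun_sum => i c u v.
by rewrite (end_comp_linear i) Bl.
Qed.

Lemma end_extE V (U : vectType k) (B : bool -> 'End(V) -> U) i f :
  (forall i, B i 0 = 0) -> end_homog i f -> end_ext B f = B i f.
Proof.
move=> B0 fi; rewrite /end_ext big_bool.
have h0 : end_comp (~~ i) f = 0 by rewrite end_comp_eq0 // negbK.
by case: i fi h0 => fi /= ->; rewrite (end_comp_id fi) B0 ?addr0 ?add0r.
Qed.

Lemma supercomm_linl V (g : 'End(V)) : linear (fun f => supercomm f g).
Proof.
apply: end_ext_linear => i; apply: linear_fun_sum => j c u v.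
by rewrite comp_lfunDl comp_lfunDr -!comp_lfunZl -!comp_lfunZr scalerDr scalerBr
  !scalerA [c * _]mulrC opprD addrACA.
Qed.

Lemma supercomm_linr V (f : 'End(V)) : linear (fun g => supercomm f g).
Proof.
apply: linear_fun_sum => i; apply: end_ext_linear => j c u v.
by rewrite comp_lfunDl comp_lfunDr -!comp_lfunZl -!comp_lfunZr scalerDr scalerBr
  !scalerA [c * _]mulrC opprD addrACA.
Qed.

Lemma supercommE V i j (f g : 'End(V)) : end_homog i f -> end_homog j g ->
  supercomm f g = (f \o g)%VF - (-1) ^+ (i * j) *: (g \o f)%VF.
Proof.
move=> fi gj; rewrite /supercomm (end_extE (i := i)) //; last first.
  move=> l; rewrite /end_ext big1 // => m _.
  by rewrite comp_lfun0l comp_lfun0r scaler0 subr0.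
rewrite (end_extE (i := j)) // => l.
by rewrite comp_lfun0l comp_lfun0r scaler0 subr0.
Qed.

Lemma supercommC V i j (f g : 'End(V)) : end_homog i f -> end_homog j g ->
  supercomm g f = - ((-1) ^+ (i * j) *: supercomm f g).
Proof.
move=> fi gj; rewrite (supercommE fi gj) (supercommE gj fi) scalerBr scalerA.
by rewrite [(j * i)%N]mulnC -expr2 sqrr_sign scale1r opprB.
Qed.

Lemma sub_lfunE (U W : vectType k) (f g : 'Hom(U, W)) x : (f - g) x = f x - g x.
Proof. by rewrite add_lfunE opp_lfunE. Qed.

Lemma supercomm_homog V i j (f g : 'End(V)) : end_homog i f -> end_homog j g ->
  end_homog (i (+) j) (supercomm f g).
Proof.
move=> fi gj l x xl; rewrite (supercommE fi gj) sub_lfunE scale_lfunE !comp_lfunE.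
apply: rpredB; first by rewrite -addbA fi ?gj.
by apply: memvZ; rewrite [i (+) j]addbC -addbA gj ?fi.
Qed.

Lemma end_homog_add V i (f g : 'End(V)) :
  end_homog i f -> end_homog i g -> end_homog i (f + g).
Proof. by move=> fi gi j x xj; rewrite add_lfunE memvD ?fi ?gi. Qed.

Lemma end_homog_scale V i c (f : 'End(V)) : end_homog i f -> end_homog i (c *: f).
Proof. by move=> fi j x xj; rewrite scale_lfunE memvZ ?fi. Qed.

Lemma end_homog0 V i : end_homog i (0 : 'End(V)).
Proof. by move=> j x xj; rewrite zero_lfunE mem0v. Qed.

End Super.

(** * The bracket of g(S,S) *)

Section TriHelp.
Variables (k : fieldType).

Lemma triple_lin (T : lmodType k) (c : k) (a0 a1 a2 b0 b1 b2 : T) :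
  triple (c *: a0 + b0) (c *: a1 + b1) (c *: a2 + b2) =
  c *: triple a0 a1 a2 + triple b0 b1 b2.
Proof. by apply/ffunP => i; rewrite !ffunE; case: i => [[|[|[|?]]] ?]. Qed.

Lemma theta_linear (V : superspace k) : linear (@theta k V).
Proof. by move=> c d e; rewrite /theta !ffunE triple_lin. Qed.

Lemma iter_theta_linear (V : superspace k) n : linear (iter n (@theta k V)).
Proof. by elim: n => // n IH c d e; rewrite !iterS IH theta_linear. Qed.

End TriHelp.

Section Multiplications.
Variables (k : fieldType) (A : superalgebra k).
Hypothesis SA : superalgebra_axiom A.

Let ml y : linear ((@amul k A)^~ y). Proof. by case: SA. Qed.
Let mr x : linear (@amul k A x). Proof. by case: SA. Qed.

Lemma lmulSE (x y : A) : lmulS x y = amul x y.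
Proof. exact: linfunE. Qed.

Lemma lmulS_linear : linear (@lmulS k A).
Proof.
by move=> c x y; apply/lfunP => z; rewrite add_lfunE scale_lfunE !lmulSE ml.
Qed.

Lemma lmulS_homog i (x : A) : x \in spart A i -> end_homog i (lmulS x).
Proof. by move=> xi j y yj; rewrite lmulSE; case: SA => _ _; apply. Qed.

Let rmul_lin (x : A) : linear (hext (fun j y =>
  hext (fun i x => (-1) ^+ (i * j) *: amul y x) x)).
Proof.
apply: hext_linear => j; apply: linear_fun_sum => i; apply: linear_scaler.
exact: ml.
Qed.

Lemma rmulS_linear : linear (@rmulS k A).
Proof.
move=> c x y; apply/lfunP => z; rewrite add_lfunE scale_lfunE !linfunE //.
pose f x := hext (fun j z => hext (fun i x => (-1) ^+ (i * j) *: amul z x) x) z.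
have fl : linear f.
  apply: linear_fun_sum => j; apply: hext_linear => i; apply: linear_scaler.
  exact: mr.
exact: fl.
Qed.

Lemma rmulSE i j (x y : A) : x \in spart A i -> y \in spart A j ->
  rmulS x y = (-1) ^+ (i * j) *: amul y x.
Proof.
move=> xi yj; rewrite linfunE // (hextE (i := j)) //; last first.
  move=> l; rewrite /hext big1 // => m _.
  by rewrite (linear_zero (ml _)) scaler0.
by rewrite (hextE (i := i)) // => l; rewrite (linear_zero (mr _)) scaler0.
Qed.

End Multiplications.

Section Operators.
Variables (k : fieldType) (S : normed_superalgebra k).
Hypotheses (SA : superalgebra_axiom S)
  (SB : quadratic_superform_axiom (@cq k S) (@cb k S)).

Let bl y : scalar ((@cb k S)^~ y). Proof. by case: SB => -[]. Qed.
Let br x : scalar (@cb k S x). Proof. by case: SB => -[]. Qed.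

Let sigf (x y z : S) := hext (fun l z => hext (fun i x => hext (fun j y =>
    ((-1) ^+ (j * l) * cb x z) *: y
    - ((-1) ^+ (i * (j + l)) * cb y z) *: x) y) x) z.

Let sg_l (y z : S) a b: linear (fun x : S => (a * cb x z) *: y - (b * cb y z) *: x).
Proof.
apply: linear_subf; last by apply: linear_scaler.
by move=> d u v; rewrite bl mulrDr scalerDl scalerA mulrCA.
Qed.
Let sg_m (x z : S) a b: linear (fun y : S => (a * cb x z) *: y - (b * cb y z) *: x).
Proof.
apply: linear_subf; first by apply: linear_scaler.
by move=> d u v; rewrite bl mulrDr scalerDl scalerA mulrCA.
Qed.
Let sg_r (x y : S) a b: linear (fun z : S => (a * cb x z) *: y - (b * cb y z) *: x).
Proof.
by apply: linear_subf => d u v; rewrite br mulrDr scalerDl scalerA mulrCA.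
Qed.

Let sigf_r x y : linear (sigf x y).
Proof.
apply: hext_linear => l; apply: linear_fun_sum => i; apply: linear_fun_sum => j.
exact: sg_r.
Qed.

(** On homogeneous arguments every homogeneous extension reduces to the
    component of the right parity, the value at 0 of the other one being 0. *)
Lemma sigmaE i j l (x y z : S) :
  x \in spart S i -> y \in spart S j -> z \in spart S l ->
  sigma x y z = ((-1) ^+ (j * l) * cb x z) *: y
    - ((-1) ^+ (i * (j + l)) * cb y z) *: x.
Proof.
move=> xi yj zl; rewrite linfunE; last exact: sigf_r.
rewrite (hextE (i := l)) //; last first.
  move=> l'; rewrite /hext big1 // => m _; rewrite big1 // => n _.
  exact: linear_zero (sg_r _ _ _ _).
rewrite (hextE (i := i)) //; last first.
  move=> l'; rewrite /hext big1 // => m _.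
  exact: linear_zero (sg_l _ _ _ _).
rewrite (hextE (i := j)) //.
move=> l'; exact: linear_zero (sg_m _ _ _ _).
Qed.

Lemma sigma_linl (y : S) : linear (fun x => sigma x y).
Proof.
move=> c u v; apply/lfunP => z; rewrite add_lfunE scale_lfunE !linfunE;
  try exact: sigf_r.
pose f x := sigf x y z; have fl : linear f; last exact: fl.
apply: linear_fun_sum => l; apply: hext_linear => i; apply: linear_fun_sum => j.
exact: sg_l.
Qed.

Lemma sigma_linr (x : S) : linear (fun y => sigma x y).
Proof.
move=> c u v; apply/lfunP => z; rewrite add_lfunE scale_lfunE !linfunE;
  try exact: sigf_r.
pose f y := sigf x y z; have fl : linear f; last exact: fl.
apply: linear_fun_sum => l; apply: linear_fun_sum => i; apply: hext_linear => j.
exact: sg_m.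
Qed.

Lemma ttri_linl (y : S) : linear (fun x => ttri x y).
Proof.
move=> c u v; rewrite /ttri sigma_linl -triple_lin.
rewrite bl (rmulS_linear SA) (lmulS_linear SA) !comp_lfunDl -!comp_lfunZl.
by congr triple; rewrite mulrDr scalerDl mulrCA scalerBr scalerA opprD addrACA.
Qed.

Lemma ttri_linr (x : S) : linear (fun y => ttri x y).
Proof.
move=> c u v; rewrite /ttri sigma_linr -triple_lin.
rewrite br (rmulS_linear SA) (lmulS_linear SA) !comp_lfunDr -!comp_lfunZr.
by congr triple; rewrite mulrDr scalerDl mulrCA scalerBr scalerA opprD addrACA.
Qed.

End Operators.

Section Bracket.
Variables (k : fieldType) (S S' : normed_superalgebra k).

Lemma gspaceP (u v : gspace S S') : (forall n, u.1.1 n = v.1.1 n) ->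
  (forall n, u.1.2 n = v.1.2 n) -> (forall n, u.2 n = v.2 n) -> u = v.
Proof.
case: u v => [[a b] c] [[a' b'] c'] /= H1 H2 H3.
by congr (_, _, _); apply/ffunP.
Qed.

Lemma giotaE n (X : tensor S S') m :
  (giota (S := S) (S' := S') n X).2 m = if m == n then X else 0.
Proof. by rewrite ffunE. Qed.

Lemma giota_linear n : linear (@giota k S S' n).
Proof.
move=> c X Y; apply: gspaceP => m /=; rewrite ?scaler0 ?addr0 //.
by rewrite !ffunE; case: eqP => _ //; rewrite scaler0 addr0.
Qed.

Lemma gtri_linear : linear (@gtri k S S').
Proof. by move=> c d e; apply: gspaceP => m //=; rewrite scaler0 addr0. Qed.

Lemma gtri'_linear : linear (@gtri' k S S').
Proof. by move=> c d e; apply: gspaceP => m //=; rewrite scaler0 addr0. Qed.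

Lemma gspace_decomp (u : gspace S S') :
  u = gtri S' u.1.1 + gtri' S u.1.2 + \sum_n giota n (u.2 n).
Proof.
rewrite !big_ord_recl big_ord0; case: u => [[a b] c] /=.
apply: gspaceP => m /=; rewrite !ffunE ?addr0 ?add0r //.
case: m => [[|[|[|//]]] ?] /=; rewrite ?addr0 ?add0r;
  by congr (c _); apply/val_inj.
Qed.

Lemma gbr_diag_addl (u u' v : gspace S S') :
  gbr_diag (u + u') v = gbr_diag u v + gbr_diag u' v.
Proof.
rewrite /gbr_diag [RHS]addrACA [X in _ = X + _]addrACA.
rewrite -!(linear_add gtri_linear) -!(linear_add gtri'_linear) -big_split.
congr (gtri _ _ + gtri' _ _ + _).
- by apply/ffunP => n; rewrite !ffunE (linear_add (supercomm_linl _)).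
- by apply/ffunP => n; rewrite !ffunE (linear_add (supercomm_linl _)).
apply: eq_bigr => n _; rewrite -[RHS](linear_add (hlift_linear _)).
by rewrite !ffunE.
Qed.

Lemma gbr_diag_addr (u v v' : gspace S S') :
  gbr_diag u (v + v') = gbr_diag u v + gbr_diag u v'.
Proof.
rewrite /gbr_diag [RHS]addrACA [X in _ = X + _]addrACA.
rewrite -!(linear_add gtri_linear) -!(linear_add gtri'_linear) -big_split.
congr (gtri _ _ + gtri' _ _ + _).
- by apply/ffunP => n; rewrite !ffunE (linear_add (supercomm_linr _)).
- by apply/ffunP => n; rewrite !ffunE (linear_add (supercomm_linr _)).
apply: eq_bigr => n _; rewrite -[RHS]hlift_addf; apply: eq_hlift => i x i' x'.
rewrite -[RHS](linear_add (hlift_linear _)).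
by rewrite !ffunE.
Qed.

Lemma gbr_cross_addl (u u' v : gspace S S') :
  gbr_cross (u + u') v = gbr_cross u v + gbr_cross u' v.
Proof.
rewrite /gbr_cross -big_split; apply: eq_bigr => n _.
rewrite [RHS]addrACA [X in _ = X + _]addrACA.
congr (_ + _ + _); rewrite -(linear_add (giota_linear _)); congr (giota _ _).
- rewrite -hlift_addf; apply: eq_hlift => i x i' x'.
  by rewrite -(linear_add (tens_linl _)) ffunE add_lfunE.
- rewrite -hlift_addf; apply: eq_hlift => i x i' x'.
  rewrite -(linear_add (end_ext_linear _)) ?ffunE // => p.
  by apply: linear_scaler => c f g; rewrite add_lfunE scale_lfunE tens_linr.
- by rewrite -(linear_add (hlift_linear _)) ffunE.
Qed.

Lemma gbr_cross_addr (u v v' : gspace S S') :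
  gbr_cross u (v + v') = gbr_cross u v + gbr_cross u v'.
Proof.
rewrite /gbr_cross -big_split; apply: eq_bigr => n _.
rewrite [RHS]addrACA [X in _ = X + _]addrACA.
congr (_ + _ + _); rewrite -(linear_add (giota_linear _)); congr (giota _ _).
- by rewrite -(linear_add (hlift_linear _)) ffunE.
- by rewrite -(linear_add (hlift_linear _)) ffunE.
- rewrite -hlift_addf; apply: eq_hlift => i x i' x'.
  by rewrite -(linear_add (hlift_linear _)) ffunE.
Qed.

Lemma gcomp_add i (u v : gspace S S') :
  gcomp i (u + v) = gcomp i u + gcomp i v.
Proof.
apply: gspaceP => n /=; rewrite !ffunE ?(linear_add (end_comp_linear i)) //.
exact: (linear_add (hlift_linear _)).
Qed.

Let interchange (V : zmodType) (a a' c c' s s' t : V) : t = s + s' ->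
  (a + a') + (c + c') - t = (a + c - s) + (a' + c' - s').
Proof. by move=> ->; rewrite [in LHS]addrACA opprD [LHS]addrACA. Qed.

Lemma gbr_addl (u u' v : gspace S S') : gbr (u + u') v = gbr u v + gbr u' v.
Proof.
rewrite {1}/gbr gbr_diag_addl gbr_cross_addl; apply: interchange.
rewrite -big_split; apply: eq_bigr => i _ /=; rewrite -big_split.
apply: eq_bigr => j _ /=.
by rewrite gcomp_add gbr_cross_addr scalerDr.
Qed.

Lemma gbr_addr (u v v' : gspace S S') : gbr u (v + v') = gbr u v + gbr u v'.
Proof.
rewrite {1}/gbr gbr_diag_addr gbr_cross_addr; apply: interchange.
rewrite -big_split; apply: eq_bigr => i _ /=; rewrite -big_split.
apply: eq_bigr => j _ /=.
by rewrite gcomp_add gbr_cross_addl scalerDr.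
Qed.

Lemma tens_part_ind i (P : tensor S S' -> Prop) :
  (forall X Y, P X -> P Y -> P (X + Y)) ->
  (forall j x y, x \in spart S j -> y \in spart S' (i (+) j) -> P (tens x y)) ->
  forall X, X \in tens_part S S' i -> P X.
Proof.
move=> PD Pt X /memv_sumP[F FP ->]; rewrite big_bool; apply: (PD).
  exact: tensv_ind PD (fun x y => @Pt true x y) _ (FP true isT).
exact: tensv_ind PD (fun x y => @Pt false x y) _ (FP false isT).
Qed.

Lemma tens_part_mem i j x y : x \in spart S j -> y \in spart S' i ->
  tens x y \in tens_part S S' (i (+) j).
Proof.
move=> xj yi; apply: (subvP (sumv_sup j _ (subvv _))) => //.
by apply: tens_mem; rewrite // -addbA addbb addbF.
Qed.

Lemma tens_comp_tens l i j (x : S) (y : S') :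
  x \in spart S i -> y \in spart S' j ->
  tens_comp l (tens x y) = if i (+) j == l then tens x y else 0.
Proof.
move=> xi yj; rewrite /tens_comp (hlift_tens (i := i) (j := j)) //.
- move=> i' j' y'; case: eqP => _; first exact: tens_linl.
  exact: linear_zerof.
- move=> i' x' j'; case: eqP => _; first exact: tens_linr.
  exact: linear_zerof.
Qed.

Lemma tens_comp_hom i j X : X \in tens_part S S' i ->
  tens_comp j X = if i == j then X else 0.
Proof.
move: X; apply: tens_part_ind => [X Y HX HY|l x y xl yl].
  by rewrite [LHS](linear_add (hlift_linear _)) -/(tens_comp j X) -/(tens_comp j Y) HX HY; case: eqP; rewrite ?addr0.
by rewrite (tens_comp_tens _ xl yl) addbC -addbA addbb addbF.
Qed.

Lemma gcomp_hom i j (u : gspace S S') : gpart i u ->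
  gcomp j u = if i == j then u else 0.
Proof.
case=> -[d1 _] [d2 _] X.
have E (V : superspace k) (f : 'End(V)) : end_homog i f -> end_comp j f = if i == j then f else 0.
  move=> fi; case: eqP => [<-|/eqP]; first exact: end_comp_id.
  by move=> ij; apply: end_comp_eq0; case: (i) (j) ij fi => -[].
apply: gspaceP => n /=; rewrite ffunE ?(tens_comp_hom _ (X n)) ?E;
  try (by case: (d1 n)); try (by case: (d2 n));
  by case: eqP; rewrite ?ffunE.
Qed.

Lemma gbr_cross0l v : gbr_cross (0 : gspace S S') v = 0.
Proof. by apply: (addrI (gbr_cross 0 v)); rewrite -gbr_cross_addl !addr0. Qed.
Lemma gbr_cross0r u : gbr_cross u (0 : gspace S S') = 0.
Proof. by apply: (addrI (gbr_cross u 0)); rewrite -gbr_cross_addr !addr0. Qed.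

(** The double sum over parities keeps one term, so that on homogeneous
    elements the bracket is the supersymmetric completion of the products
    given by [gbr_diag] and [gbr_cross]. *)
Lemma gbr_hom i j (u v : gspace S S') : gpart i u -> gpart j v ->
  gbr u v = gbr_diag u v + gbr_cross u v - (-1) ^+ (i * j) *: gbr_cross v u.
Proof.
move=> ui vj; rewrite /gbr; congr (_ - _).
have E (i' j' : bool) : (-1) ^+ (i' * j') *: gbr_cross (gcomp j' v) (gcomp i' u) =
    if (i == i') && (j == j') then (-1) ^+ (i * j) *: gbr_cross v u else 0.
  rewrite (gcomp_hom i' ui) (gcomp_hom j' vj); have [->|_] := eqVneq i i'; last by rewrite gbr_cross0r scaler0.
  by have [->|_] := eqVneq j j'; last by rewrite gbr_cross0l scaler0.
under eq_bigr => i' _ do under eq_bigr => j' _ do rewrite E.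
move: (_ *: gbr_cross v u) => T.
by rewrite !big_bool; case: (i) (j) => -[] /=; rewrite ?addr0 ?add0r.
Qed.

Lemma gbr_diag_tri d e : gbr_diag (gtri S' d) (gtri (S := S) S' e) =
  gtri S' [ffun n => supercomm (d n) (e n)].
Proof.
rewrite /gbr_diag /= big1 => [|n _]; last by rewrite ffunE linear_zero //; apply: hlift_linear.
rewrite addr0; apply: gspaceP => n /=; rewrite !ffunE ?addr0 ?add0r //.
by rewrite (linear_zero (supercomm_linl _)).
Qed.

Lemma gbr_diag_tri' d e : gbr_diag (gtri' S d) (gtri' S (S' := S') e) =
  gtri' S [ffun n => supercomm (d n) (e n)].
Proof.
rewrite /gbr_diag /= big1 => [|n _]; last by rewrite ffunE linear_zero //; apply: hlift_linear.
rewrite addr0; apply: gspaceP => n /=; rewrite !ffunE ?addr0 ?add0r //.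
by rewrite (linear_zero (supercomm_linl _)).
Qed.

Lemma gbr_diag_eq0 (u v : gspace S S') :
  (u.1.1 = 0 \/ v.1.1 = 0) -> (u.1.2 = 0 \/ v.1.2 = 0) ->
  (forall n, u.2 n = 0 \/ v.2 n = 0) -> gbr_diag (S := S) (S' := S') u v = 0.
Proof.
move=> H1 H2 H3; rewrite /gbr_diag big1; last first.
  move=> n _; case: (H3 n) => ->; first exact: (linear_zero (hlift_linear _)).
  rewrite -[RHS](hlift0 _ (u.2 n)); apply: eq_hlift => i x i' x'.
  exact: (linear_zero (hlift_linear _)).
rewrite addr0; apply: gspaceP => n /=; rewrite !ffunE ?addr0 ?add0r //.
  by case: H1 => ->; rewrite ffunE ?(linear_zero (supercomm_linl _)) ?(linear_zero (supercomm_linr _)).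
by case: H2 => ->; rewrite ffunE ?(linear_zero (supercomm_linl _)) ?(linear_zero (supercomm_linr _)).
Qed.

Lemma gbr_cross_tri (u : gspace S S') d d' : u.2 = 0 ->
  gbr_cross (S := S) (S' := S') (d, d', 0) u = 0.
Proof.
move=> u0; rewrite /gbr_cross big1 // => n _ /=.
have h0 (U : vectType k) (B : bool -> S -> bool -> S' -> U) : hlift B 0 = 0.
  exact: (linear_zero (hlift_linear B)).
have g0 m : giota (S := S) (S' := S') m 0 = 0 := linear_zero (giota_linear m).
by rewrite u0 ffunE !h0 !g0 !addr0.
Qed.

Lemma gbr_cross_iota_tri (u : gspace S S') n X : u.2 = 0 ->
  gbr_cross (S := S) (S' := S') (giota n X) u = 0.
Proof.
move=> u0; rewrite /gbr_cross big1 // => m _ /=.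
have h0 (U : vectType k) (B : bool -> S -> bool -> S' -> U) : hlift B 0 = 0.
  exact: (linear_zero (hlift_linear B)).
have g0 l : giota (S := S) (S' := S') l 0 = 0 := linear_zero (giota_linear l).
rewrite u0 !ffunE !h0 !g0 !add0r.
rewrite (eq_hlift (B2 := fun _ _ _ _ => 0)) ?hlift0 ?g0 // => *; apply: h0.
Qed.

Lemma gbr_cross_tri_iota d n (X : tensor S S') :
  gbr_cross (gtri S' d) (giota n X) =
  giota n (hlift (fun _ x _ x' => tens (d n x) x') X).
Proof.
have h0 (U : vectType k) (B : bool -> S -> bool -> S' -> U) : hlift B 0 = 0.
  exact: (linear_zero (hlift_linear B)).
have g0 l : giota (S := S) (S' := S') l 0 = 0 := linear_zero (giota_linear l).
have e0 i x x' : end_ext (fun p (d' : 'End(S')) => (-1) ^+ (p * i) *: tens (x : S) (d' x')) 0 = 0.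
  by rewrite linear_zero //; apply: end_ext_linear => p; apply: linear_scaler => c f g; rewrite add_lfunE scale_lfunE tens_linr.
rewrite /gbr_cross (bigD1 n) //= big1 => [|m mn]; last first.
  by rewrite !ffunE (negPf mn) !h0 !g0 !addr0.
rewrite !ffunE eqxx h0 g0 !addr0.
rewrite [X in _ + giota _ X](eq_hlift (B2 := fun _ _ _ _ => 0)) ?hlift0 ?g0 ?addr0 //.
Qed.

Lemma gbr_cross_tri'_iota d n (X : tensor S S') :
  gbr_cross (gtri' S d) (giota n X) =
  giota n (hlift (fun i x _ x' => end_ext (fun p d' =>
         (-1) ^+ (p * i) *: tens x (d' x')) (d n)) X).
Proof.
have h0 (U : vectType k) (B : bool -> S -> bool -> S' -> U) : hlift B 0 = 0.
  exact: (linear_zero (hlift_linear B)).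
have g0 l : giota (S := S) (S' := S') l 0 = 0 := linear_zero (giota_linear l).
rewrite /gbr_cross (bigD1 n) //= big1 => [|m mn]; last first.
  by rewrite !ffunE (negPf mn) !h0 !g0 !addr0.
rewrite !ffunE eqxx h0 g0 !addr0.
rewrite (eq_hlift (B2 := fun _ _ _ _ => 0)) ?hlift0 ?g0 ?add0r //.
by move=> i x j y; rewrite zero_lfunE tens0l.
Qed.

Lemma gbr_cross_iota n m (X Y : tensor S S') :
  gbr_cross (giota n X) (giota m Y) =
  if m == n + 1 then giota (n + 2%:R) (hlift (fun _ x i' x' => hlift (fun j y _ y' =>
         (-1) ^+ (i' * j) *: tens (amul x y) (amul x' y')) Y) X) else 0.
Proof.
have h0 (U : vectType k) (B : bool -> S -> bool -> S' -> U) : hlift B 0 = 0.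
  exact: (linear_zero (hlift_linear B)).
have g0 l : giota (S := S) (S' := S') l 0 = 0 := linear_zero (giota_linear l).
have e0 i x x' : end_ext (fun p (d' : 'End(S')) => (-1) ^+ (p * i) *: tens (x : S) (d' x')) 0 = 0.
  by rewrite linear_zero //; apply: end_ext_linear => p; apply: linear_scaler => c f g; rewrite add_lfunE scale_lfunE tens_linr.
have H l (Z : tensor S S') : giota l (hlift (fun _ x _ x' => tens ((0 : {ffun 'I_3 -> 'End(S)}) l x) x') Z)
   + giota l (hlift (fun i x _ x' => end_ext (fun p d' =>
         (-1) ^+ (p * i) *: tens x (d' x')) ((0 : {ffun 'I_3 -> 'End(S')}) l)) Z) = 0.
  rewrite (eq_hlift (B2 := fun _ _ _ _ => 0)) ?hlift0 ?g0 ?add0r; last first.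
    by move=> i x j y; rewrite ffunE zero_lfunE tens0l.
  rewrite (eq_hlift (B2 := fun _ _ _ _ => 0)) ?hlift0 ?g0 ?add0r //.
  by move=> i x j y; rewrite ffunE e0.
rewrite /gbr_cross; under eq_bigr do rewrite H add0r.
rewrite (bigD1 n) //= big1 => [|l ln]; last first.
  by rewrite !ffunE (negPf ln) h0 g0.
rewrite addr0 !ffunE eqxx eq_sym; case: eqP => // _.
rewrite (eq_hlift (B2 := fun _ _ _ _ => 0)) ?hlift0 ?g0 // => *; apply: h0.
Qed.

Lemma gbr_diag_iota n (X Y : tensor S S') :
  gbr_diag (giota n X) (giota n Y) =
  hlift (fun i x i' x' => hlift (fun j y j' y' =>
        gtri S' (((-1) ^+ (i * i' + i * j' + j * j') * cb x' y')
                *: iter n (@theta k S) (ttri x y))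
        + gtri' S (((-1) ^+ (j * i') * cb x y)
                *: iter n (@theta k S') (ttri x' y'))) Y) X.
Proof.
rewrite /gbr_diag /= [gtri _ _](_ : _ = 0); last first.
  by apply: gspaceP => m //=; rewrite !ffunE (linear_zero (supercomm_linl _)).
rewrite add0r [gtri' _ _](_ : _ = 0); last first.
  by apply: gspaceP => m //=; rewrite !ffunE (linear_zero (supercomm_linl _)).
rewrite add0r (bigD1 n) //= !ffunE eqxx big1 ?addr0 // => m mn.
by rewrite !ffunE (negPf mn) (linear_zero (hlift_linear _)).
Qed.

End Bracket.

Section BracketEval.
Variables (k : fieldType) (S S' : normed_superalgebra k).
Hypotheses (SA : superalgebra_axiom S)
  (SB : quadratic_superform_axiom (@cq k S) (@cb k S)).
Hypotheses (SA' : superalgebra_axiom S')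
  (SB' : quadratic_superform_axiom (@cq k S') (@cb k S')).

Lemma tri0 (R : normed_superalgebra k) i :
  superalgebra_axiom R -> quadratic_superform_axiom (@cq k R) (@cb k R) ->
  tri i (0 : {ffun 'I_3 -> 'End(R)}).
Proof.
move=> [ml mr _] [[bl br] _ _ _ _]; split=> [n|j l x y xj yl].
  split=> [|j l x y _ _]; rewrite ffunE; first exact: end_homog0.
  by rewrite !zero_lfunE (linear_zero (W := k^o) (bl y)) (linear_zero (W := k^o) (br x)) mulr0 addr0.
rewrite !ffunE !zero_lfunE.
by rewrite (linear_zero (ml y)) (linear_zero (mr x)) scaler0 addr0.
Qed.

Lemma gpart_tri i d : tri i d -> gpart i (gtri (S := S) S' d).
Proof.
by move=> di; split=> //= [|n]; [exact: tri0|rewrite ffunE mem0v].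
Qed.

Lemma gpart_tri' i d : tri i d -> gpart i (gtri' (S' := S') S d).
Proof.
by move=> di; split=> //= [|n]; [exact: tri0|rewrite ffunE mem0v].
Qed.

(** The first tensor factors are even here and below, as in the cases S = Qbar
    and S = S1; this removes most signs. *)
Lemma gpart_iota i n (p : S) (x : S') : p \in spart S false ->
  x \in spart S' i -> gpart i (giota (S := S) (S' := S') n (tens p x)).
Proof.
move=> p0 xi; split=> [||m] /=; try exact: tri0.
rewrite ffunE; case: eqP => _; last exact: mem0v.
by rewrite -[i]addbF tens_part_mem.
Qed.

(** Away from the products inside the summands, the second half of the bracket
    is defined by antisymmetry; so only one order has to be computed. *)
Lemma gbrC_off_diag i j (u v : gspace S S') : gpart i u -> gpart j v ->
  gbr_diag u v = 0 -> gbr_diag v u = 0 ->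
  gbr v u = - ((-1) ^+ (i * j) *: gbr u v).
Proof.
move=> ui vj uv vu; rewrite (gbr_hom ui vj) (gbr_hom vj ui) uv vu !add0r.
rewrite scalerBr scalerA [(j * i)%N]mulnC -expr2 sqrr_sign scale1r.
by rewrite opprB.
Qed.

Lemma gbr_tri_tri i j d e : tri i d -> tri j e ->
  gbr (gtri S' d) (gtri (S := S) S' e) =
  gtri S' [ffun n => supercomm (d n) (e n)].
Proof.
move=> di ej; rewrite (gbr_hom (gpart_tri di) (gpart_tri ej)) gbr_diag_tri.
by rewrite !gbr_cross_tri // scaler0 subr0 addr0.
Qed.

Lemma gbr_tri'_tri' i j d e : tri i d -> tri j e ->
  gbr (gtri' S d) (gtri' (S' := S') S e) =
  gtri' S [ffun n => supercomm (d n) (e n)].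
Proof.
move=> di ej; rewrite (gbr_hom (gpart_tri' di) (gpart_tri' ej)) gbr_diag_tri'.
by rewrite !gbr_cross_tri // scaler0 subr0 addr0.
Qed.

Lemma gbr_tri_tri' i j d e : tri i d -> tri j e ->
  gbr (gtri S' d) (gtri' S e) = 0.
Proof.
move=> di ej; rewrite (gbr_hom (gpart_tri di) (gpart_tri' ej)).
rewrite !gbr_cross_tri // scaler0 subr0 addr0.
by apply: gbr_diag_eq0; [right|left|left]; rewrite ?ffunE.
Qed.

Lemma gbr_tri_iota i j n d p x : tri i d -> p \in spart S false ->
  x \in spart S' j ->
  gbr (gtri S' d) (giota n (tens p x)) = giota n (tens (d n p) x).
Proof.
move=> di p0 xj; rewrite (gbr_hom (gpart_tri di) (gpart_iota n p0 xj)).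
rewrite gbr_cross_iota_tri // scaler0 subr0 gbr_diag_eq0; last 3 first.
- by right.
- by left.
- by left; rewrite ffunE.
rewrite add0r gbr_cross_tri_iota (hlift_tens (i := false) (j := j)) //.
- move=> _ _ y; apply: (linear_compose (f := fun z => tens z y)).
    exact: tens_linl.
  exact: linear_hom.
- by move=> _ q _; apply: tens_linr.
Qed.

Lemma gbr_tri'_iota i j n d p x : tri i d -> p \in spart S false ->
  x \in spart S' j ->
  gbr (gtri' S d) (giota n (tens p x)) = giota n (tens p (d n x)).
Proof.
move=> di p0 xj; rewrite (gbr_hom (gpart_tri' di) (gpart_iota n p0 xj)).
rewrite gbr_cross_iota_tri // scaler0 subr0 gbr_diag_eq0; last 3 first.
- by left.
- by right.
- by left; rewrite ffunE.
rewrite add0r gbr_cross_tri'_iota (hlift_tens (i := false) (j := j)) //.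
- rewrite (end_extE (i := i)) //; last by case: di => /(_ n)[].
    by rewrite muln0 scale1r.
  by move=> l; rewrite zero_lfunE tens0r scaler0.
- move=> l m y; apply: linear_fun_sum => q; apply: linear_scaler.
  exact: tens_linl.
- move=> l q m; apply: linear_fun_sum => r; apply: linear_scaler.
  by apply: linear_compose; [exact: tens_linr|exact: linear_hom].
Qed.

Lemma gbr_iota_next i j n p q x y :
  p \in spart S false -> q \in spart S false ->
  x \in spart S' i -> y \in spart S' j ->
  gbr (giota n (tens p x)) (giota (n + 1) (tens q y)) =
  giota (n + 2%:R) (tens (amul p q) (amul x y)).
Proof.
move=> p0 q0 xi yj.
rewrite (gbr_hom (gpart_iota n p0 xi) (gpart_iota _ q0 yj)).
rewrite gbr_diag_eq0; [|by left|by left|]; last first.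
  move=> m; rewrite !giotaE; case: eqP => [->|_]; last by left.
  by right; case: n => [[|[|[|?]]] ?].
rewrite !gbr_cross_iota eqxx [_ == _](_ : _ = false); last first.
  by case: n => [[|[|[|?]]] ?].
rewrite scaler0 subr0 add0r.
case: SA => ml mr _; case: SA' => ml' mr' _.
rewrite (hlift_tens (i := false) (j := i)) //.
- rewrite (hlift_tens (i := false) (j := j)) ?muln0 ?scale1r //.
  + move=> l m w; apply: linear_scaler.
    apply: (linear_compose (f := fun z => tens z _)) => //; exact: tens_linl.
  + move=> l w m; apply: linear_scaler.
    by apply: linear_compose => //; apply: tens_linr.
- move=> l m w c u v; apply: hlift_linf => a s b t.
  rewrite [RHS]addrC -[RHS]addrC scalerA mulrC -scalerA -scalerDr.
  by rewrite ml tens_linl.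
- move=> l w m c u v; apply: hlift_linf => a s b t.
  rewrite scalerA; case: m a => -[];
    rewrite ?muln0 ?mul0n ?muln1 ?expr0 ?expr1 ?mulr1 ?scale1r ?scaleN1r ?mulrN1 ml' tens_linr //.
  by rewrite scaleNr -opprD.
Qed.

Lemma gbr_iota_same i j n p q x y :
  p \in spart S false -> q \in spart S false ->
  x \in spart S' i -> y \in spart S' j ->
  gbr (giota n (tens p x)) (giota n (tens q y)) =
  gtri S' (cb x y *: iter n (@theta k S) (ttri p q))
  + gtri' S (cb p q *: iter n (@theta k S') (ttri x y)).
Proof.
move=> p0 q0 xi yj.
rewrite (gbr_hom (gpart_iota n p0 xi) (gpart_iota _ q0 yj)).
rewrite !gbr_cross_iota [_ == _](_ : _ = false); last first.
  by case: n => [[|[|[|?]]] ?].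
rewrite scaler0 subr0 addr0 gbr_diag_iota.
case: SB => -[bl br] _ _ _ _; case: SB' => -[bl' br'] _ _ _ _.
have tl r : linear (fun u => iter n (@theta k S) (ttri u r)).
  by move=> c u v; rewrite (ttri_linl SA SB) iter_theta_linear.
have tr r : linear (fun u => iter n (@theta k S) (ttri r u)).
  by move=> c u v; rewrite (ttri_linr SA SB) iter_theta_linear.
have tl' r : linear (fun u => iter n (@theta k S') (ttri u r)).
  by move=> c u v; rewrite (ttri_linl SA' SB') iter_theta_linear.
have tr' r : linear (fun u => iter n (@theta k S') (ttri r u)).
  by move=> c u v; rewrite (ttri_linr SA' SB') iter_theta_linear.
have sl (V W : lmodType k) (f : V -> k) (a : k) (z : W) : scalar f ->
    linear (fun u => (a * f u) *: z).
  by move=> fl; apply: scalar_linear_scale => c u v; rewrite fl mulrDr mulrCA.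
have L1 (V : lmodType k) (f : V -> {ffun 'I_3 -> 'End(S)}) (g : V -> k) a b z :
    linear f -> scalar g ->
    linear (fun u => gtri S' (a *: f u) + gtri' S ((b * g u) *: z)).
  move=> fl gl; apply: linear_addf.
    exact: linear_compose (@gtri_linear _ _ _) (linear_scaler _ fl).
  exact: linear_compose (@gtri'_linear _ _ _) (sl _ _ g b z gl).
have L2 (V : lmodType k) (f : V -> {ffun 'I_3 -> 'End(S')}) (g : V -> k) a b z :
    linear f -> scalar g ->
    linear (fun u => gtri S' ((b * g u) *: z) + gtri' S (a *: f u)).
  move=> fl gl; apply: linear_addf.
    exact: linear_compose (@gtri_linear _ _ _) (sl _ _ g b z gl).
  exact: linear_compose (@gtri'_linear _ _ _) (linear_scaler _ fl).
rewrite (hlift_tens (i := false) (j := i)) //.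
- rewrite (hlift_tens (i := false) (j := j)) ?muln0 ?mul1r //.
  + by move=> l m y'; apply: L1.
  + by move=> l y' m; apply: L2.
- move=> l m w c u v; apply: hlift_linf => a s b t.
  exact: (L1 _ (fun u => iter n (@theta k S) (ttri u s)) (fun u => cb u s) _ _ _ (tl _) (bl _)).
move=> l m w c u v; apply: hlift_linf => a s b t.
exact: (L2 _ (fun u => iter n (@theta k S') (ttri u t)) (fun u => cb u t) _ _ _ (tl' _) (bl' _)).
Qed.

End BracketEval.

(** * Hurwitz superalgebras *)

Section Hurwitz.
Variables (k : fieldType) (C : hurwitz_superalgebra k).
Local Notation one := (hone C).
Local Notation mul := (@amul k C).
Local Notation b := (@cb k C).

Lemma hurwitz_alg : superalgebra_axiom C. Proof. by case: (hcsaP C). Qed.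
Lemma hurwitz_form : quadratic_superform_axiom (@cq k C) b.
Proof. by case: (hcsaP C) => _ []. Qed.
Lemma hurwitz_nondeg : Defs.nondegenerate b. Proof. by case: (hcsaP C) => _ []. Qed.

Let ml y : linear (mul^~ y). Proof. by case: hurwitz_alg. Qed.
Let mr x : linear (mul x). Proof. by case: hurwitz_alg. Qed.
Let mg i j x y : x \in spart C i -> y \in spart C j -> mul x y \in spart C (i (+) j).
Proof. by case: hurwitz_alg => _ _; apply. Qed.
Let bl y : scalar (b^~ y). Proof. by case: hurwitz_form => -[]. Qed.
Let br x : scalar (b x). Proof. by case: hurwitz_form => -[]. Qed.
Let bC i j x y : x \in spart C i -> y \in spart C j ->
  b x y = (-1) ^+ (i * j) * b y x.
Proof. by case: hurwitz_form => _ _ + _ _; apply. Qed.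

Let bDl x y z : b (x + y) z = b x z + b y z.
Proof. exact: (linear_add (W := k^o) (bl z)). Qed.
Let bDr x y z : b z (x + y) = b z x + b z y.
Proof. exact: (linear_add (W := k^o) (br z)). Qed.
Let bZl c x z : b (c *: x) z = c * b x z.
Proof. exact: (linear_scale (W := k^o) c x (bl z)). Qed.
Let bZr c x z : b z (c *: x) = c * b z x.
Proof. exact: (linear_scale (W := k^o) c x (br z)). Qed.
Let bNl x z : b (- x) z = - b x z.
Proof. exact: (linear_opp (W := k^o) x (bl z)). Qed.
Let bNr x z : b z (- x) = - b z x.
Proof. exact: (linear_opp (W := k^o) x (br z)). Qed.
Lemma cb_diff i j x y : x \in spart C i -> y \in spart C j -> i != j -> b x y = 0.
Proof.
move=> xi yj ij; have [_ b01 _ _ _] := hurwitz_form.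
case: i j xi yj ij => -[] // xi yj _; last exact: b01.
by rewrite (bC xi yj) b01 // mulr0.
Qed.

Let o0 := hone_even C.

Let b1odd x : x \in spart C true -> b x one = 0.
Proof. by move=> x1; apply: (cb_diff x1 o0). Qed.

Lemma cb_one_one : b one one = 2%:R.
Proof.
have [_ _ _ qZ bE] := hurwitz_form; have [_ _ _ q1 _] := hcsaP C.
have q11 : cq one = 1 :> k.
  apply/eqP; rewrite -subr_eq0; apply: contraT => q1n.
  case/eqP: (hone_neq0 C); apply: hurwitz_nondeg => y.
  have [+ _] := q1 one one y o0; rewrite !hmul1x => /eqP.
  rewrite -subr_eq0 -{1}[b one y]mul1r -mulrBl mulf_eq0 -opprB oppr_eq0 (negPf q1n).
  by move=> /eqP.
rewrite bE // /polar -[one + one]/(one *+ 2) -scaler_nat qZ // q11; ring.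
Qed.

(** This lemma and the next two are the composition identity with one of its
    four arguments equal to the unit. *)
Lemma cb_mulDl i j m x y t : x \in spart C i -> y \in spart C j ->
  t \in spart C m ->
  b (mul x y) t + (-1) ^+ (i * j) * b y (mul x t) = b x one * b y t.
Proof.
move=> xi yj tm; have [_ _ _ _ /(_ i j false m x y one t)] := hcsaP C.
move=> /(_ xi yj o0 tm); rewrite !hmul1x !muln0 !addn0 => ->.
by rewrite expr0 mul1r.
Qed.

Lemma cb_mulDr i j l x y z : x \in spart C i -> y \in spart C j ->
  z \in spart C l ->
  b (mul x y) z + (-1) ^+ (j * l) * b x (mul z y) =
  (-1) ^+ (j * l) * (b x z * b y one).
Proof.
move=> xi yj zl; have [_ _ _ _ /(_ i j l false x y z one)] := hcsaP C.
move=> /(_ xi yj zl o0); rewrite !hmulx1 => <-; congr (_ + _).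
rewrite (bC (mg zl yj) xi) mulrA -exprD.
have -> : b x (mul z y) = (-1) ^+ (2 * (i * (l + j))) * b x (mul z y).
  by rewrite exprM sqrrN expr1n expr1n mul1r.
congr (_ * _).
rewrite -signr_odd -[RHS]signr_odd; move: (i) (j) (l) => i' j' l'.
by case: i' j' l' => -[] [].
Qed.

Lemma cb_mul_swap i j m x z t : x \in spart C i -> z \in spart C j ->
  t \in spart C m ->
  b x (mul z t) + (-1) ^+ (i * j) * b z (mul x t) = b x z * b one t.
Proof.
move=> xi zj tm; have [_ _ _ _ /(_ i false j m x one z t)] := hcsaP C.
move=> /(_ xi o0 zj tm); rewrite !hmulx1 muln0 mul0n addn0 add0n expr0 mul1r.
by [].
Qed.

Let hbarE x : hbar x = b x one *: one - x. Proof. by []. Qed.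
Let hl : linear (@hbar k C) := @hbar_linear k C.

Lemma hbar_mem i x : x \in spart C i -> hbar x \in spart C i.
Proof. by move=> /hcomp_id <-; rewrite hbar_hcomp hcomp_mem. Qed.

Lemma hbar_one : hbar one = one.
Proof. by rewrite hbarE cb_one_one scaler_nat mulr2n addrK. Qed.

Lemma cb_hbar_one x : b (hbar x) one = b x one.
Proof. by rewrite hbarE bDl bZl bNl cb_one_one; ring. Qed.

Lemma hbarK : involutive (@hbar k C).
Proof. by move=> x; rewrite [LHS]hbarE cb_hbar_one hbarE opprB addrC subrK. Qed.

Let b1C i x : x \in spart C i -> b one x = b x one.
Proof. by move=> xi; rewrite (bC o0 xi) mul0n mul1r. Qed.

Lemma cb_hbarl i j x y : x \in spart C i -> y \in spart C j ->
  b (hbar x) y = b x (hbar y).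
Proof.
move=> xi yj; rewrite !hbarE bDl bDr bZl bZr bNl bNr (b1C yj); ring.
Qed.

Lemma cb_hbar i j x y : x \in spart C i -> y \in spart C j ->
  b (hbar x) (hbar y) = b x y.
Proof. by move=> xi yj; rewrite (cb_hbarl xi (hbar_mem yj)) hbarK. Qed.

(** Left multiplications by x and by its conjugate are adjoint to each other:
    the identity [cb_mulDl] with the term b(x,1) y moved to the other side. *)
Lemma cb_adjl i j m x y t : x \in spart C i -> y \in spart C j ->
  t \in spart C m ->
  b (mul x y) t = (-1) ^+ (i * j) * b y (mul (hbar x) t).
Proof.
move=> xi yj tm; have /eqP := cb_mulDl xi yj tm.
rewrite eq_sym -subr_eq => /eqP <-; rewrite hbarE.
rewrite (linear_sub _ _ (ml t)) (linear_scale _ _ (ml t)) hmul1x bDr bZr bNr mulrDr mulrN.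
congr (_ - _); case: i xi => xi; last by rewrite mul1r.
by rewrite b1odd // !mul0r mulr0.
Qed.

Lemma cb_adjr i j l x y z : x \in spart C i -> y \in spart C j ->
  z \in spart C l ->
  b (mul x y) z = (-1) ^+ (j * l) * b x (mul z (hbar y)).
Proof.
move=> xi yj zl; have /eqP := cb_mulDr xi yj zl.
rewrite eq_sym -subr_eq => /eqP <-; rewrite hbarE.
rewrite (linear_sub _ _ (mr z)) (linear_scale _ _ (mr z)) hmulx1 bDr bZr bNr.
by rewrite -mulrBr [b y one * _]mulrC.
Qed.

Lemma nondegP x y :
  (forall m t, t \in spart C m -> b x t = b y t) -> x = y.
Proof.
move=> H; apply/eqP; rewrite -subr_eq0; apply/eqP.
apply: hurwitz_nondeg => t; rewrite bDl bNl -(hcomp_add t) !bDr.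
by rewrite !(H _ _ (hcomp_mem _ _)) subrr.
Qed.

(** Linearization of the identity saying that the product of the conjugate of
    x by x is q(x)1; it holds because pairing both sides with t gives
    [cb_mul_swap] up to adjunction. *)
(** Both sides are paired with an arbitrary t; the adjunctions turn the right
    hand side into an expression in b(x, y t), which [hbar_mul_sumr] gives. *)
Lemma hbar_mul_sum i j x y : x \in spart C i -> y \in spart C j ->
  mul (hbar x) y + (-1) ^+ (i * j) *: mul (hbar y) x = b x y *: one.
Proof.
move=> xi yj; have hx := hbar_mem xi; have hy := hbar_mem yj.
apply/eqP; rewrite -subr_eq0; apply/eqP; apply: hurwitz_nondeg => t.
rewrite -(hcomp_add t) bDr; apply/eqP; rewrite addr_eq0; apply/eqP.
have H m : b (mul (hbar x) y + (-1) ^+ (i * j) *: mul (hbar y) x - b x y *: one) (hcomp C m t) = 0.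
  have tm := hcomp_mem m t; set u := hcomp C m t in tm *.
  rewrite !bDl bNl !bZl (cb_adjl hx yj tm) (cb_adjl hy xi tm) !hbarK.
  rewrite -(cb_mul_swap xi yj tm) [(j * i)%N]mulnC mulrA -expr2 sqrr_sign.
  ring.
by rewrite !H oppr0.
Qed.

Lemma hbar_mul_sumr i j x y : x \in spart C i -> y \in spart C j ->
  mul x (hbar y) + (-1) ^+ (i * j) *: mul y (hbar x) = b x y *: one.
Proof.
move=> xi yj; have := hbar_mul_sum (hbar_mem xi) (hbar_mem yj).
by rewrite !hbarK (cb_hbar xi yj).
Qed.

Lemma hbar_mul i j x y : x \in spart C i -> y \in spart C j ->
  hbar (mul x y) = (-1) ^+ (i * j) *: mul (hbar y) (hbar x).
Proof.
move=> xi yj; have hx := hbar_mem xi; have hy := hbar_mem yj.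
apply: nondegP => m t tm.
have ht := hbar_mem tm.
have E1 : b x (mul y t) = b x one * b y (hbar t) - b (mul x y) (hbar t).
  rewrite (cb_adjr xi yj ht).
  have : mul y t + (-1) ^+ (j * m) *: mul (hbar t) (hbar y) = b y (hbar t) *: one.
    by have := hbar_mul_sumr yj ht; rewrite hbarK.
  move=> /(congr1 (b x)); rewrite bDr !bZr => /eqP.
  by rewrite eq_sym -subr_eq => /eqP <-; rewrite [b x one * _]mulrC.
rewrite bZl (cb_adjl hy hx tm) mulrA [(j * i)%N]mulnC -expr2 sqrr_sign mul1r.
rewrite hbarK (cb_hbarl (mg xi yj) tm) hbarE bDl bZl bNl E1.
have -> : b one (mul y t) = b y (hbar t).
  have := cb_adjl hy o0 tm; rewrite muln0 mul1r hbarK hmulx1 => <-.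
  by rewrite (cb_hbarl yj tm).
ring.
Qed.

Lemma para_alg : superalgebra_axiom (para_hurwitz C).
Proof.
split=> [y|x|i j x y xi yj] /=.
- by move=> c u v; rewrite /= hl ml.
- by move=> c u v; rewrite /= hl mr.
by apply: mg; apply: hbar_mem.
Qed.

Lemma para_form : quadratic_superform_axiom (@cq k (para_hurwitz C)) (@cb k (para_hurwitz C)).
Proof. exact: hurwitz_form. Qed.

End Hurwitz.

(** * The multiplication table of the Jordan superalgebra *)

(** Everything being cyclically symmetric, a statement about an index m is
    proved by listing the positions of m relative to a fixed n. *)
Lemma ord3_ind (n : 'I_3) (P : 'I_3 -> Prop) :
  P n -> P (n + 1) -> P (n + 2%:R) -> forall m, P m.
Proof.
move=> P0 P1 P2 m; have [d dE] : exists d, m = n + d by exists (m - n); rewrite addrC subrK.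
rewrite dE; case: d {dE} => [[|[|[|?]]] ?] //.
- by rewrite (_ : Ordinal _ = 0) ?addr0 //; apply: val_inj.
- by rewrite (_ : Ordinal _ = 1) //; apply: val_inj.
- by rewrite (_ : Ordinal _ = 2%:R) //; apply: val_inj.
Qed.

Lemma ord3_11 (n : 'I_3) : n + 1 + 1 = n + 2%:R.
Proof. by rewrite -addrA. Qed.
Lemma ord3_12 (n : 'I_3) : n + 1 + 2%:R = n.
Proof. by rewrite -addrA (_ : 1 + 2%:R = 0) ?addr0 //; apply: val_inj. Qed.
Lemma ord3_21 (n : 'I_3) : n + 2%:R + 1 = n.
Proof. by rewrite -addrA (_ : 2%:R + 1 = 0) ?addr0 //; apply: val_inj. Qed.
Lemma ord3_22 (n : 'I_3) : n + 2%:R + 2%:R = n + 1.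
Proof. by rewrite -addrA (_ : 2%:R + 2%:R = 1) //; apply: val_inj. Qed.
Definition ord3D := (ord3_11, ord3_12, ord3_21, ord3_22).

Lemma ord3_neq (n : 'I_3) : ((n == n + 1) = false) * ((n == n + 2%:R) = false)
  * ((n + 1 == n) = false) * ((n + 2%:R == n) = false)
  * ((n + 1 == n + 2%:R) = false) * ((n + 2%:R == n + 1) = false).
Proof. by case: n => [[|[|[|?]]] ?]. Qed.

Lemma ord3_sum (V : nmodType) (n : 'I_3) (F : 'I_3 -> V) :
  \sum_m F m = F n + F (n + 1) + F (n + 2%:R).
Proof.
rewrite (bigD1 n) //= (bigD1 (n + 1)) ?ord3_neq //= (bigD1 (n + 2%:R)) ?ord3_neq //=.
rewrite big_pred0 ?addr0 ?addrA // => m; move: m.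
by apply: (@ord3_ind n); rewrite ?ord3D ?eqxx ?ord3_neq ?eqxx.
Qed.

Section Albert.
Variables (k : fieldType) (C : hurwitz_superalgebra k).
Hypothesis k_char : 2%N \notin [pchar k].
Local Notation one := (hone C).
Local Notation mul := (@amul k C).
Local Notation b := (@cb k C).
Local Notation J := (H3 C).

Lemma two_neq0 : 2%:R != 0 :> k.
Proof. by apply: contra k_char => /eqP h; rewrite inE /= h eqxx. Qed.

Let ml y : linear (mul^~ y). Proof. by case: (hurwitz_alg C). Qed.
Let mr x : linear (mul x). Proof. by case: (hurwitz_alg C). Qed.
Let mg i j x y : x \in spart C i -> y \in spart C j -> mul x y \in spart C (i (+) j).
Proof. by case: (hurwitz_alg C) => _ _; apply. Qed.
Let hl : linear (@hbar k C) := @hbar_linear k C.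

Definition unit_mx (i j : 'I_3) (c : C) : mat3 C :=
  [ffun jl => if jl == (i, j) then c else 0].

Lemma unit_mx_linear i j : linear (unit_mx i j).
Proof.
move=> c x y; apply/ffunP => jl; rewrite !ffunE.
by case: eqP => _ //; rewrite scaler0 addr0.
Qed.

Lemma mat3_mul_linl y : linear (fun x : mat3 C => mat3_mul x y).
Proof.
move=> c u v; apply/ffunP => jl; rewrite !ffunE scaler_sumr -big_split.
by apply: eq_bigr => l _; rewrite !ffunE ml.
Qed.

Lemma mat3_mul_linr (x : mat3 C) : linear (mat3_mul x).
Proof.
move=> c u v; apply/ffunP => jl; rewrite !ffunE scaler_sumr -big_split.
by apply: eq_bigr => l _; rewrite !ffunE mr.
Qed.

Lemma mat3_star_linear : linear (@mat3_star k C).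
Proof. by move=> c u v; apply/ffunP => jl; rewrite !ffunE hl. Qed.

Lemma mul_unit_mx i j l m x y : mat3_mul (unit_mx i j x) (unit_mx l m y) =
  if j == l then unit_mx i m (mul x y) else 0.
Proof.
apply/ffunP => -[p q]; rewrite !ffunE /=.
rewrite (bigD1 j) //= !ffunE !xpair_eqE eqxx andbT big1 ?addr0 => [|r rj].
  case: (j == l); rewrite !ffunE /= ?xpair_eqE; case: (p == i); case: (q == m);
  by rewrite /= ?(linear_zero (ml _)) ?(linear_zero (mr _)).
by rewrite !ffunE !xpair_eqE (negPf rj) andbF (linear_zero (ml _)).
Qed.

Lemma star_unit_mx i j x : mat3_star (unit_mx i j x) = unit_mx j i (hbar x).
Proof.
apply/ffunP => -[p q]; rewrite !ffunE /= !xpair_eqE andbC.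
by case: ifP => _ //; apply: linear_zero hl.
Qed.

Let star_add := linear_add mat3_star_linear.
Let starZ c x := linear_scale c x mat3_star_linear.

Lemma val_H3_e n : vsval (H3_e C n) = unit_mx n n one.
Proof.
rewrite vsprojK //; apply/herm3P.
by rewrite -/(unit_mx n n one) star_unit_mx hbar_one.
Qed.

Lemma val_H3_iota n a : vsval (H3_iota n a : J) =
  2%:R *: (unit_mx (n + 1) (n + 2%:R) (hbar a) + unit_mx (n + 2%:R) (n + 1) a).
Proof.
rewrite /H3_iota [X in vsproj _ (_ *: X)](_ : _ = unit_mx (n + 1) (n + 2%:R) (hbar a) + unit_mx (n + 2%:R) (n + 1) a).
  rewrite vsprojK //; apply/herm3P.
  by rewrite starZ star_add !star_unit_mx hbarK addrC.
apply/ffunP => -[p q]; rewrite !ffunE !xpair_eqE.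
case: eqP => [->|_] /=; rewrite ?add0r //.
by rewrite ord3_neq /= addr0.
Qed.

Lemma H3_e_even n : H3_e C n \in spart J false.
Proof.
apply/H3_partP => jl; rewrite val_H3_e ffunE.
by case: eqP => _; [apply: hone_even|apply: mem0v].
Qed.

Lemma H3_iota_mem n i x : x \in spart C i -> H3_iota n x \in spart J i.
Proof.
move=> xi; apply/H3_partP => jl; rewrite val_H3_iota !ffunE memvZ // memvD //.
  by case: eqP => _; [apply: hbar_mem|apply: mem0v].
by case: eqP => _; [|apply: mem0v].
Qed.

Let valP (x : J) : mat3_star (vsval x) = vsval x.
Proof. by apply/herm3P; apply: subvsP. Qed.

Let val_linear : linear (fun x : J => vsval x : mat3 C).
Proof. by move=> c x y; rewrite linearP. Qed.

(** The involution reverses products up to sign, hence the symmetrized product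
    of two hermitian matrices is hermitian and the projection in the
    definition of [H3_mul] has no effect ([H3_mulE]). *)
Lemma star_mul i j (x y : J) : x \in spart J i -> y \in spart J j ->
  mat3_star (mat3_mul (vsval x) (vsval y)) =
  (-1) ^+ (i * j) *: mat3_mul (vsval y) (vsval x).
Proof.
move=> /H3_partP xi /H3_partP yj; apply/ffunP => -[p q]; rewrite !ffunE /=.
rewrite (linear_bigsum _ _ _ hl) scaler_sumr; apply: eq_bigr => l _.
rewrite (hbar_mul (xi _) (yj _)).
by rewrite -[in RHS](valP x) -[in RHS](valP y) !ffunE.
Qed.

Let mulf i j (x y : J) : J := vsproj (herm3 C) (2%:R^-1 *: (mat3_mul (vsval x) (vsval y)
      + (-1) ^+ (i * j) *: mat3_mul (vsval y) (vsval x))).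

Let mulf_linl (i j : bool) y : linear (fun x => mulf i j x y).
Proof.
apply: (linear_compose (f := vsproj (herm3 C))); first by move=> c u v; rewrite linearP.
apply: linear_scaler; apply: linear_addf.
  exact: (linear_compose (mat3_mul_linl _) val_linear).
apply: linear_scaler.
exact: (linear_compose (@mat3_mul_linr _) val_linear).
Qed.

Let mulf_linr (i j : bool) x : linear (fun y => mulf i j x y).
Proof.
apply: (linear_compose (f := vsproj (herm3 C))); first by move=> c u v; rewrite linearP.
apply: linear_scaler; apply: linear_addf.
  exact: (linear_compose (@mat3_mul_linr _) val_linear).
apply: linear_scaler.
exact: (linear_compose (mat3_mul_linl _) val_linear).
Qed.

Lemma H3_linl (y : J) : linear ((@amul k J)^~ y).
Proof. by apply: hext_linear => i; apply: linear_fun_sum => j; apply: mulf_linl. Qed.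

Lemma H3_linr (x : J) : linear (@amul k J x).
Proof. by apply: linear_fun_sum => i; apply: hext_linear => j; apply: mulf_linr. Qed.

Lemma H3_mulE i j (x y : J) : x \in spart J i -> y \in spart J j ->
  vsval (amul x y) = 2%:R^-1 *: (mat3_mul (vsval x) (vsval y)
      + (-1) ^+ (i * j) *: mat3_mul (vsval y) (vsval x)).
Proof.
move=> xi yj.
have -> : amul x y = mulf i j x y.
  rewrite /amul /= /H3_mul (hextE (i := i)) //.
    by rewrite (hextE (i := j)) // => l; apply: (linear_zero (mulf_linr _ _ _)).
  by move=> l; apply: big1 => m _; apply: (linear_zero (mulf_linl _ _ _)).
rewrite vsprojK //; apply/herm3P.
rewrite starZ star_add starZ (star_mul xi yj) (star_mul yj xi) scalerA.
by rewrite [(j * i)%N]mulnC -expr2 sqrr_sign scale1r addrC.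
Qed.

Lemma H3_alg : superalgebra_axiom J.
Proof.
split=> [y|x|i j x y xi yj]; [exact: H3_linl|exact: H3_linr|].
apply/H3_partP => -[p q]; rewrite (H3_mulE xi yj) !ffunE memvZ //.
move/H3_partP: xi => xi; move/H3_partP: yj => yj.
rewrite memvD //; first by apply: memv_suml => l _; apply: mg.
by rewrite memvZ // memv_suml // => l _; rewrite addbC; apply: mg.
Qed.

Lemma H3_inj (x y : J) : vsval x = vsval y -> x = y.
Proof. by move=> xy; apply: val_inj. Qed.

Let valD (x y : J) : vsval (x + y) = vsval x + vsval y.
Proof. exact: linearD. Qed.
Let valZ c (x : J) : vsval (c *: x) = c *: vsval x.
Proof. exact: linearZ. Qed.
Let val0 : vsval (0 : J) = 0.
Proof. exact: linear0. Qed.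

Lemma H3_mulC i j (x y : J) : x \in spart J i -> y \in spart J j ->
  amul y x = (-1) ^+ (i * j) *: amul x y.
Proof.
move=> xi yj; apply: H3_inj; rewrite valZ (H3_mulE yj xi) (H3_mulE xi yj).
rewrite !scalerDr [RHS]addrC !scalerA [(j * i)%N]mulnC; congr (_ + _).
  by rewrite [_ * 2%:R^-1]mulrC -mulrA -expr2 sqrr_sign mulr1.
by rewrite mulrC.
Qed.

Let e := H3_e C.
Let io := @H3_iota k C.

Let half2 (V : lmodType k) (v : V) : 2%:R^-1 *: (v + v) = v.
Proof. by rewrite -mulr2n -scaler_nat scalerA mulVf ?scale1r ?two_neq0. Qed.

Let half4 (V : lmodType k) (s : k) (P Q : V) :
  2%:R^-1 *: (2%:R *: (2%:R *: P) + s *: (2%:R *: (2%:R *: Q))) =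
  2%:R *: (P + s *: Q).
Proof.
rewrite !scalerDr !scalerA; congr (_ *: _ + _ *: _); field; exact: two_neq0.
Qed.

Lemma H3_ee m n : amul (e m) (e n) = if m == n then e n else 0.
Proof.
apply: H3_inj; rewrite (H3_mulE (H3_e_even m) (H3_e_even n)) expr0 scale1r /=.
rewrite !val_H3_e !mul_unit_mx !hmul1x [n == m]eq_sym.
case: eqP => [->|_]; first by rewrite val_H3_e half2.
by rewrite addr0 scaler0 ?val0.
Qed.

Let mulDl := fun x y z => linear_add (mat3_mul_linl z) x y.
Let mulDr := fun x y z => linear_add (@mat3_mul_linr z) x y.
Let mulZl := fun c x z => linear_scale c x (mat3_mul_linl z).
Let mulZr := fun c x z => linear_scale c x (@mat3_mul_linr z).

Lemma H3_e_iota m n i x : x \in spart C i ->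
  amul (e m) (io n x) = if m == n then 0 else 2%:R^-1 *: io n x.
Proof.
move=> xi; apply: H3_inj.
rewrite (H3_mulE (H3_e_even m) (H3_iota_mem n xi)) mul0n expr0 scale1r /=.
rewrite val_H3_e val_H3_iota !mulZl !mulZr !mulDl !mulDr !mul_unit_mx.
rewrite !hmul1x !hmulx1; move: m; apply: (@ord3_ind n) => /=.
- by rewrite !ord3_neq eqxx !addr0 !scaler0 addr0 scaler0 ?val0.
- by rewrite !ord3_neq eqxx !addr0 !add0r -scalerDr valZ val_H3_iota.
- rewrite !ord3_neq eqxx !addr0 !add0r -scalerDr valZ val_H3_iota.
  by rewrite [unit_mx (n + 2%:R) _ _ + _]addrC.
Qed.

Lemma H3_iota_e m n i x : x \in spart C i ->
  amul (io n x) (e m) = if m == n then 0 else 2%:R^-1 *: io n x.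
Proof.
move=> xi; rewrite (H3_mulC (H3_e_even m) (H3_iota_mem n xi)) mul0n expr0 scale1r.
exact: H3_e_iota xi.
Qed.

Lemma H3_iota_same n i j x y : x \in spart C i -> y \in spart C j ->
  amul (io n x) (io n y) = (2%:R * b x y) *: (e (n + 1) + e (n + 2%:R)).
Proof.
move=> xi yj; apply: H3_inj.
rewrite (H3_mulE (H3_iota_mem n xi) (H3_iota_mem n yj)).
rewrite valZ valD !val_H3_e !val_H3_iota.
rewrite !mulZl !mulZr !mulDl !mulDr !mul_unit_mx !ord3_neq !eqxx.
rewrite !addr0 !add0r.
have [E1 E2] := (hbar_mul_sum xi yj, hbar_mul_sumr xi yj).
have U z w : forall l, unit_mx l l z + (-1) ^+ (i * j) *: unit_mx l l w =
    unit_mx l l (z + (-1) ^+ (i * j) *: w).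
  move=> l; rewrite (linear_add (@unit_mx_linear _ _)).
  by rewrite (linear_scale _ _ (@unit_mx_linear _ _)).
set p := unit_mx _ _ _; set q := unit_mx _ _ _.
set p' := unit_mx _ _ _; set q' := unit_mx _ _ _.
rewrite half4 [_ *: (p' + q')]scalerDr addrACA.
rewrite /p /p' /q /q' !U E1 E2 !(linear_scale _ _ (@unit_mx_linear _ _)).
by rewrite -scalerDr scalerA.
Qed.

Lemma H3_iota_next n i j (x y : C) : x \in spart C i -> y \in spart C j ->
  amul (io n x) (io (n + 1) y) = io (n + 2%:R) (mul (hbar x) (hbar y)).
Proof.
move=> xi yj; apply: H3_inj.
rewrite (H3_mulE (H3_iota_mem n xi) (H3_iota_mem _ yj)) !val_H3_iota.
rewrite !mulZl !mulZr !mulDl !mulDr !mul_unit_mx !ord3D !ord3_neq !eqxx.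
rewrite !addr0 !add0r.
rewrite (hbar_mul (hbar_mem xi) (hbar_mem yj)) !hbarK.
rewrite (linear_scale _ _ (@unit_mx_linear _ _)) [in RHS]addrC.
set p := unit_mx _ _ _; set q := unit_mx _ _ _.
by rewrite half4.
Qed.

(** The Peirce decomposition: a hermitian matrix has scalar diagonal entries,
    and its entries below the diagonal are the conjugates of those above. *)
Lemma H3_decomp i (z : J) : z \in spart J i ->
  z = \sum_n (((2%:R^-1 * b (vsval z (n, n)) one) *: e n)
      + io n (2%:R^-1 *: vsval z (n + 2%:R, n + 1))).
Proof.
move=> zi; apply: H3_inj; rewrite (linear_bigsum _ _ _ val_linear); apply/ffunP => -[p q].
have zp p' q' : vsval z (p', q') = hbar (vsval z (q', p')).
  by rewrite -{1}(valP z) ffunE.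
rewrite sum_ffunE; under eq_bigr => n _.
  rewrite valD valZ val_H3_e val_H3_iota !ffunE !xpair_eqE.
  over.
have zd n : vsval z (n, n) = (2%:R^-1 * b (vsval z (n, n)) one) *: one.
  rewrite -scalerA; have := zp n n => /eqP; rewrite -subr_eq0 /hbar opprB addrA.
  rewrite subr_eq0 => /eqP <-; exact/esym/half2.
have hh (v : C) : 2%:R *: (2%:R^-1 *: v) = v.
  by rewrite scalerA mulfV ?two_neq0 // scale1r.
rewrite (ord3_sum p); move: q; apply: (@ord3_ind p);
  rewrite !ord3D !ord3_neq !eqxx /= ?scaler0 ?addr0 ?add0r ?scaler0 ?addr0 //.
- by rewrite add0r (linear_scale _ _ hl) hh -zp.
- by rewrite add0r hh.
Qed.

End Albert.

(** * The derivations D_n(x) and commutators of multiplications *)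

Section AlbertOps.
Variables (k : fieldType) (C : hurwitz_superalgebra k).
Hypothesis k_char : 2%N \notin [pchar k].
Local Notation mul := (@amul k C).
Local Notation b := (@cb k C).
Local Notation J := (H3 C).
Local Notation e := (H3_e C).
Local Notation io := (@H3_iota k C).
Local Notation L := (@lmulS k J).

Let two0 := two_neq0 k_char.
Let JA : superalgebra_axiom J := H3_alg C.

Lemma H3_iota_linear n : linear (io n : C -> J).
Proof.
move=> c x y; apply: H3_inj; rewrite [RHS]linearP /= !val_H3_iota.
rewrite (@hbar_linear k C); move: (hbar x) (hbar y) => x' y'.
by rewrite !unit_mx_linear addrACA -scalerDr [LHS]scalerDr !scalerA mulrC.
Qed.

Let lE x z : L x z = amul x z. Proof. exact: lmulSE JA x z. Qed.
Let rD x := linear_add (@H3_linr k C x).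
Let rZ x c y := linear_scale c y (@H3_linr k C x).
Let r0 x := linear_zero (@H3_linr k C x).

(** By the Peirce decomposition J is spanned by the e_m and the iota_m(x). *)
Lemma H3_end_ext (f g : 'End(J)) : (forall m, f (e m) = g (e m)) ->
  (forall m i x, x \in spart C i -> f (io m x) = g (io m x)) -> f = g.
Proof.
move=> fe fi; apply: end_ext_hom => i z zi.
rewrite (H3_decomp k_char zi) !linear_sum; apply: eq_bigr => n _.
rewrite !linearD !linearZ /= fe; congr (_ + _).
apply: (fi n i); apply: memvZ; exact: (H3_partP _ _ zi).
Qed.

Lemma L_e_homog n : end_homog false (L (e n)).
Proof. exact (lmulS_homog JA (H3_e_even C n)). Qed.

Lemma L_iota_homog n i x : x \in spart C i -> end_homog i (L (io n x)).
Proof. by move=> xi; exact (lmulS_homog JA (H3_iota_mem n xi)). Qed.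

Lemma Dder_homog n i x : x \in spart C i -> end_homog i (Dder n x).
Proof.
move=> xi; rewrite /Dder -[i]addbF; apply: end_homog_scale.
by apply: supercomm_homog; [apply: L_iota_homog|apply: L_e_homog].
Qed.

Lemma DderE n i x z : x \in spart C i -> Dder n x z =
  2%:R *: (amul (io n x) (amul (e (n + 1)) z) - amul (e (n + 1)) (amul (io n x) z)).
Proof.
move=> xi; rewrite /Dder scale_lfunE (supercommE (L_iota_homog n xi) (L_e_homog _)).
by rewrite muln0 scale1r sub_lfunE !comp_lfunE !lE.
Qed.

Let half_half : 2%:R^-1 - 2%:R^-1 * 2%:R^-1 = 2%:R^-1 * 2%:R^-1 :> k.
Proof. field; exact: two0. Qed.

Let two_half (V : lmodType k) (v : V) : 2%:R *: (2%:R^-1 *: v) = v.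
Proof. by rewrite scalerA mulfV ?scale1r. Qed.

(** The values of D_n(x) on the Peirce components, in [Dder_e0] to [Dder_i2],
    all follow from the multiplication table by expanding the commutator of
    the multiplications by iota_n(x) and e_(n+1). *)
Lemma Dder_e0 n i x : x \in spart C i -> Dder n x (e n) = 0.
Proof.
move=> xi; rewrite (DderE _ _ xi) H3_ee // (H3_iota_e _ _ xi) !ord3_neq !eqxx.
by rewrite !r0 subrr scaler0.
Qed.

Lemma Dder_e1 n i x : x \in spart C i -> Dder n x (e (n + 1)) = 2%:R^-1 *: io n x.
Proof.
move=> xi; rewrite (DderE _ _ xi) H3_ee // eqxx (H3_iota_e _ _ xi) !ord3_neq.
rewrite rZ (H3_e_iota _ _ xi) !ord3_neq scalerA -scalerBl half_half.
by rewrite -scalerA two_half.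
Qed.

Lemma Dder_e2 n i x : x \in spart C i -> Dder n x (e (n + 2%:R)) = - (2%:R^-1 *: io n x).
Proof.
move=> xi; rewrite (DderE _ _ xi) H3_ee // (H3_iota_e _ _ xi) !ord3_neq.
rewrite rZ (H3_e_iota _ _ xi) !ord3_neq r0 sub0r.
by rewrite scalerN two_half.
Qed.

Lemma Dder_i0 n i j x y : x \in spart C i -> y \in spart C j ->
  Dder n x (io n y) = (2%:R * b x y) *: (e (n + 2%:R) - e (n + 1)).
Proof.
move=> xi yj; rewrite (DderE _ _ xi) (H3_e_iota _ _ yj) ord3_neq rZ.
rewrite (H3_iota_same k_char n xi yj) rZ rD !H3_ee // eqxx ord3_neq addr0.
rewrite scalerBr two_half scalerBr scalerDr [2%:R *: _]scaler_nat mulr2n.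
by rewrite [X in X - _]addrC opprD addrA addrK.
Qed.

Let mhh i j x y : x \in spart C i -> y \in spart C j ->
  mul (hbar x) (hbar y) \in spart C (i (+) j).
Proof.
by move=> xi yj; case: (hurwitz_alg C) => _ _; apply; apply: hbar_mem.
Qed.

Lemma Dder_i1 n i j x y : x \in spart C i -> y \in spart C j ->
  Dder n x (io (n + 1) y) = - io (n + 2%:R) (mul (hbar x) (hbar y)).
Proof.
move=> xi yj; rewrite (DderE _ _ xi) (H3_e_iota _ _ yj) eqxx r0 sub0r.
rewrite (H3_iota_next k_char n xi yj).
by rewrite (H3_e_iota _ _ (mhh xi yj)) ord3_neq scalerN two_half.
Qed.

Lemma H3_iota_prev n i j x y : x \in spart C i -> y \in spart C j ->
  amul (io n x) (io (n + 2%:R) y) =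
  (-1) ^+ (i * j) *: io (n + 1) (mul (hbar y) (hbar x)).
Proof.
move=> xi yj; rewrite (H3_mulC (H3_iota_mem _ yj) (H3_iota_mem n xi)).
have := H3_iota_next k_char (n + 2%:R) yj xi.
by rewrite !ord3D mulnC => ->.
Qed.

Lemma Dder_i2 n i j x y : x \in spart C i -> y \in spart C j ->
  Dder n x (io (n + 2%:R) y) =
  (-1) ^+ (i * j) *: io (n + 1) (mul (hbar y) (hbar x)).
Proof.
move=> xi yj; rewrite (DderE _ _ xi) (H3_e_iota _ _ yj) ord3_neq rZ.
rewrite (H3_iota_prev n xi yj) rZ (H3_e_iota _ _ (mhh yj xi)) eqxx.
by rewrite scaler0 subr0 two_half.
Qed.

Lemma supercomm_apply (V : superspace k) i j (f g : 'End(V)) z :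
  end_homog i f -> end_homog j g ->
  supercomm f g z = f (g z) - (-1) ^+ (i * j) *: g (f z).
Proof.
by move=> fi gj; rewrite (supercommE fi gj) sub_lfunE scale_lfunE !comp_lfunE.
Qed.

(** F and G are functions with known values standing for f and g. *)
Lemma supercomm_fun (V : superspace k) i j (f g : 'End(V)) (F G : V -> V) z :
  end_homog i f -> end_homog j g -> F =1 f -> G =1 g ->
  supercomm f g z = F (G z) - (-1) ^+ (i * j) *: G (F z).
Proof. by move=> fi gj FE GE; rewrite (supercomm_apply _ fi gj) !FE !GE. Qed.

Let bC i j x y : x \in spart C i -> y \in spart C j ->
  b y x = (-1) ^+ (i * j) * b x y.
Proof. by case: (hurwitz_form C) => _ _ + _ _ xi yj; rewrite mulnC; apply. Qed.

(** D_n(x) and the multiplication by iota_n(x), given next, have the same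
    values up to signs: they differ in the signs at e_(n+2), iota_n and
    iota_(n+1).  This is why their commutators agree up to sign. *)
Let peirce_der n (i : bool) (x : C) (F : J -> J) : Prop :=
  linear F /\ (F (e n) = 0) /\ (F (e (n + 1)) = 2%:R^-1 *: io n x) /\
   (F (e (n + 2%:R)) = - (2%:R^-1 *: io n x)) /\
   (forall j y, y \in spart C j ->
      F (io n y) = (2%:R * b x y) *: (e (n + 2%:R) - e (n + 1))) /\
   (forall j y, y \in spart C j ->
      F (io (n + 1) y) = - io (n + 2%:R) (mul (hbar x) (hbar y))) /\
   (forall j y, y \in spart C j -> F (io (n + 2%:R) y) =
      (-1) ^+ (i * j) *: io (n + 1) (mul (hbar y) (hbar x))).

Let peirce_mul n (i : bool) (x : C) (P : J -> J) : Prop :=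
  linear P /\ (P (e n) = 0) /\ (P (e (n + 1)) = 2%:R^-1 *: io n x) /\
   (P (e (n + 2%:R)) = 2%:R^-1 *: io n x) /\
   (forall j y, y \in spart C j ->
      P (io n y) = (2%:R * b x y) *: (e (n + 1) + e (n + 2%:R))) /\
   (forall j y, y \in spart C j ->
      P (io (n + 1) y) = io (n + 2%:R) (mul (hbar x) (hbar y))) /\
   (forall j y, y \in spart C j -> P (io (n + 2%:R) y) =
      (-1) ^+ (i * j) *: io (n + 1) (mul (hbar y) (hbar x))).

(** The computations of commutators only use these values, so they are carried
    out with a function F known by them. *)
Lemma peirce_derP n i x : x \in spart C i ->
  exists F, F =1 Dder n x /\ peirce_der n i x F.
Proof.
move=> xi; exists (Dder n x); split=> //.
do !split; first exact: linear_hom.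
- exact: Dder_e0 xi.
- exact: Dder_e1 xi.
- exact: Dder_e2 xi.
- by move=> j y yj; apply: Dder_i0 xi yj.
- by move=> j y yj; apply: Dder_i1 xi yj.
- by move=> j y yj; apply: Dder_i2 xi yj.
Qed.

Lemma peirce_mulP n i x : x \in spart C i ->
  exists P, P =1 L (io n x) /\ peirce_mul n i x P.
Proof.
move=> xi; exists (amul (io n x : J)); split=> [z|]; first by rewrite lE.
do !split; first exact: H3_linr.
- by rewrite (H3_iota_e _ _ xi) eqxx.
- by rewrite (H3_iota_e _ _ xi) ord3_neq.
- by rewrite (H3_iota_e _ _ xi) ord3_neq.
- by move=> j y yj; apply: H3_iota_same xi yj.
- by move=> j y yj; apply: H3_iota_next xi yj.
- by move=> j y yj; apply: H3_iota_prev xi yj.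
Qed.

(* From here on only the multiplication table of J is used. *)
Opaque H3_e H3_iota.

(** Compared on each Peirce component.  On the e_m both sides vanish because b
    is supersymmetric; on iota_m(C) the composites of the two derivations are
    already the opposites of the composites of the two multiplications. *)
Lemma Dder_comm_same n i j x y : x \in spart C i -> y \in spart C j ->
  supercomm (Dder n x) (Dder n y) = - supercomm (L (io n x)) (L (io n y)).
Proof.
move=> xi yj.
have [F [FE [Fl [F0 [F1 [F2 [Fi0 [Fi1 Fi2]]]]]]]] := peirce_derP n xi.
have [G [GE [Gl [G0 [G1 [G2 [Gi0 [Gi1 Gi2]]]]]]]] := peirce_derP n yj.
have [P [PE [Pl [P0 [P1 [P2 [Pi0 [Pi1 Pi2]]]]]]]] := peirce_mulP n xi.
have [Q [QE [Ql [Q0 [Q1 [Q2 [Qi0 [Qi1 Qi2]]]]]]]] := peirce_mulP n yj.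
have E z : F (G z) - (-1) ^+ (i * j) *: G (F z) =
    - (P (Q z) - (-1) ^+ (i * j) *: Q (P z)) ->
    supercomm (Dder n x) (Dder n y) z = (- supercomm (L (io n x)) (L (io n y))) z.
  rewrite opp_lfunE (supercomm_fun z (Dder_homog n xi) (Dder_homog n yj) FE GE).
  by rewrite (supercomm_fun z (L_iota_homog n xi) (L_iota_homog n yj) PE QE).
have s2 : (-1) ^+ (i * j) * 2^-1 * (2 * ((-1) ^+ (i * j) * b x y)) =
       2^-1 * (2 * b x y) :> k.
  transitivity (((-1) ^+ (i * j)) ^+ 2 * (2^-1 * (2 * b x y)) : k); first by ring.
  by rewrite sqrr_sign mul1r.
apply: H3_end_ext => [m|m l z zl]; apply: E; move: m; apply: (@ord3_ind n).
- by rewrite F0 G0 P0 Q0 (linear_zero Fl) (linear_zero Gl) (linear_zero Pl)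
    (linear_zero Ql) scaler0 subrr oppr0.
- rewrite F1 G1 P1 Q1 (linear_scale _ _ Fl) (linear_scale _ _ Gl).
  rewrite (linear_scale _ _ Pl) (linear_scale _ _ Ql).
  rewrite (Fi0 _ _ yj) (Gi0 _ _ xi) (Pi0 _ _ yj) (Qi0 _ _ xi) (bC xi yj).
  by rewrite !scalerA s2 !subrr oppr0.
- rewrite F2 G2 P2 Q2 !(linear_opp _ Fl, linear_opp _ Gl).
  rewrite (linear_scale _ _ Fl) (linear_scale _ _ Gl).
  rewrite (linear_scale _ _ Pl) (linear_scale _ _ Ql).
  rewrite (Fi0 _ _ yj) (Gi0 _ _ xi) (Pi0 _ _ yj) (Qi0 _ _ xi) (bC xi yj).
  by rewrite scalerN !scalerA s2 !subrr oppr0.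
- rewrite (Fi0 _ _ zl) (Gi0 _ _ zl) (Pi0 _ _ zl) (Qi0 _ _ zl).
  rewrite (linear_scale _ _ Fl) (linear_scale _ _ Gl) (linear_sub _ _ Fl) (linear_sub _ _ Gl).
  rewrite (linear_scale _ _ Pl) (linear_scale _ _ Ql) (linear_add Pl) (linear_add Ql).
  by rewrite F1 F2 G1 G2 P1 P2 Q1 Q2 -!opprD !scalerN -opprD.
- rewrite (Fi1 _ _ zl) (Gi1 _ _ zl) (Pi1 _ _ zl) (Qi1 _ _ zl).
  rewrite (linear_opp _ Fl) (linear_opp _ Gl).
  rewrite (Fi2 _ _ (mhh yj zl)) (Gi2 _ _ (mhh xi zl)).
  by rewrite (Pi2 _ _ (mhh yj zl)) (Qi2 _ _ (mhh xi zl)) scalerN -opprD.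
- rewrite (Fi2 _ _ zl) (Gi2 _ _ zl) (Pi2 _ _ zl) (Qi2 _ _ zl).
  rewrite (linear_scale _ _ Fl) (linear_scale _ _ Gl).
  rewrite (linear_scale _ _ Pl) (linear_scale _ _ Ql).
  rewrite (Fi1 _ _ (mhh zl yj)) (Gi1 _ _ (mhh zl xi)).
  by rewrite (Pi1 _ _ (mhh zl yj)) (Qi1 _ _ (mhh zl xi)) !scalerN -opprD.
Qed.

(** The trilinear form b(x, y . z) of the para-Hurwitz product is cyclic. *)
Lemma para_form_cycle i j l x y z : x \in spart C i -> y \in spart C j ->
  z \in spart C l ->
  b y (mul (hbar z) (hbar x)) =
  (-1) ^+ (i * j + i * l) * b x (mul (hbar y) (hbar z)).
Proof.
move=> xi yj zl; have [ml mr mg] := hurwitz_alg C.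
have [hx hz] := (hbar_mem xi, hbar_mem zl).
rewrite (bC (mhh zl xi) yj) (cb_adjl hz hx yj) hbarK (cb_hbarl xi (mg _ _ _ _ zl yj)).
have bZ c w : b x (c *: w) = c * b x w.
  by apply: (linear_scale (W := k^o)); case: (hurwitz_form C) => -[].
rewrite (hbar_mul zl yj) bZ !mulrA -!exprD; congr (_ * _).
rewrite -signr_odd -[RHS]signr_odd; move: (i) (j) (l) => i' j' l'.
by case: i' j' l' => -[] [].
Qed.

(** Compared on each Peirce component.  All but iota_(n+2)(C) only need
    the multiplication table; there both sides are combinations of the idempotents whose coefficients
    agree by the cyclic symmetry of the trilinear form. *)
Lemma Dder_comm_next n i j x y : x \in spart C i -> y \in spart C j ->
  supercomm (Dder n x) (Dder (n + 1) y) =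
  supercomm (L (io n x)) (L (io (n + 1) y)).
Proof.
move=> xi yj.
have [F [FE [Fl [F0 [F1 [F2 [Fi0 [Fi1 Fi2]]]]]]]] := peirce_derP n xi.
have [G [GE H]] := peirce_derP (n + 1) yj.
have [P [PE [Pl [P0 [P1 [P2 [Pi0 [Pi1 Pi2]]]]]]]] := peirce_mulP n xi.
have [Q [QE H']] := peirce_mulP (n + 1) yj.
rewrite /peirce_der !ord3D in H; rewrite /peirce_mul !ord3D in H'.
case: H => [Gl [G1 [G2 [G0 [Gi1 [Gi2 Gi0]]]]]].
case: H' => [Ql [Q1 [Q2 [Q0 [Qi1 [Qi2 Qi0]]]]]].
have E z : F (G z) - (-1) ^+ (i * j) *: G (F z) =
    P (Q z) - (-1) ^+ (i * j) *: Q (P z) ->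
    supercomm (Dder n x) (Dder (n + 1) y) z = supercomm (L (io n x)) (L (io (n + 1) y)) z.
  rewrite (supercomm_fun z (Dder_homog n xi) (Dder_homog _ yj) FE GE).
  by rewrite (supercomm_fun z (L_iota_homog n xi) (L_iota_homog _ yj) PE QE).
apply: H3_end_ext => [m|m l z zl]; apply: E; move: m; apply: (@ord3_ind n).
- rewrite F0 G0 P0 Q0 (linear_opp _ Fl) (linear_scale _ _ Fl) (linear_scale _ _ Pl).
  rewrite (Fi1 _ _ yj) (Pi1 _ _ yj) (linear_zero Gl) (linear_zero Ql).
  by rewrite scalerN opprK.
- rewrite F1 G1 P1 Q1 (linear_zero Fl) (linear_zero Pl) (linear_scale _ _ Gl).
  by rewrite (linear_scale _ _ Ql) (Gi0 _ _ xi) (Qi0 _ _ xi).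
- rewrite F2 G2 P2 Q2 (linear_scale _ _ Fl) (linear_scale _ _ Pl) (linear_opp _ Gl).
  rewrite (linear_scale _ _ Gl) (linear_scale _ _ Ql) (Fi1 _ _ yj) (Pi1 _ _ yj).
  rewrite (Gi0 _ _ xi) (Qi0 _ _ xi) [(j * i)%N]mulnC.
  set I := io _ _; have -> : (-1) ^+ (i * j) *: (2%:R^-1 *: ((-1) ^+ (i * j) *: I)) = 2%:R^-1 *: I.
    by rewrite !scalerA mulrAC -expr2 sqrr_sign mul1r.
  rewrite scalerN scalerN; set T := _ *: I.
  have -> : (-1) ^+ (i * j) *: (2%:R^-1 *: ((-1) ^+ (i * j) *: I)) = T.
    by rewrite !scalerA mulrAC -expr2 sqrr_sign mul1r.
  by rewrite opprK addNr subrr.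
- rewrite (Gi0 _ _ zl) (Qi0 _ _ zl) (Fi0 _ _ zl) (Pi0 _ _ zl).
  rewrite (linear_scale _ _ Fl) (linear_scale _ _ Pl) (Fi2 _ _ (mhh zl yj)).
  rewrite (Pi2 _ _ (mhh zl yj)) (linear_scale _ _ Gl) (linear_scale _ _ Ql).
  by rewrite (linear_sub _ _ Gl) (linear_add Ql) G1 G2 Q1 Q2 subr0 add0r.
- rewrite (Gi1 _ _ zl) (Qi1 _ _ zl) (Fi1 _ _ zl) (Pi1 _ _ zl).
  rewrite (linear_scale _ _ Fl) (linear_scale _ _ Pl) (linear_opp _ Gl).
  rewrite (linear_sub _ _ Fl) (linear_add Pl) F0 F2 P0 P2 sub0r opprK addr0.
  by rewrite (Gi2 _ _ (mhh xi zl)) (Qi2 _ _ (mhh xi zl)) opprK.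
- rewrite (Gi2 _ _ zl) (Qi2 _ _ zl) (Fi2 _ _ zl) (Pi2 _ _ zl).
  rewrite (linear_opp _ Fl) (linear_scale _ _ Gl) (linear_scale _ _ Ql).
  rewrite (Fi0 _ _ (mhh yj zl)) (Pi0 _ _ (mhh yj zl)).
  rewrite (Gi1 _ _ (mhh zl xi)) (Qi1 _ _ (mhh zl xi)) (para_form_cycle xi yj zl) !scalerA.
  set B := b x _.
  have -> : (-1) ^+ (i * j) * (-1) ^+ (i * l) * (2 * ((-1) ^+ (i * j + i * l) * B)) = 2 * B :> k.
    transitivity (((-1) ^+ (i * j + i * l)) ^+ 2 * (2 * B) : k).
      by rewrite exprD; ring.
    by rewrite sqrr_sign mul1r.
  rewrite -scalerN -!scalerBr; congr (_ *: _).
  by rewrite -opprD [X in - X = _]addrC addrA subrK opprB opprD addrA addrK.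
Qed.

Let peirce_e n (F : J -> J) : Prop :=
  linear F /\ (F (e n) = e n) /\ (F (e (n + 1)) = 0) /\
   (F (e (n + 2%:R)) = 0) /\
   (forall j y, y \in spart C j -> F (io n y) = 0) /\
   (forall j y, y \in spart C j ->
      F (io (n + 1) y) = 2%:R^-1 *: io (n + 1) y) /\
   (forall j y, y \in spart C j -> F (io (n + 2%:R) y) =
      2%:R^-1 *: io (n + 2%:R) y).

Lemma peirce_eP n : exists P, P =1 L (e n) /\ peirce_e n P.
Proof.
exists (amul (e n : J)); split=> [z|]; first by rewrite lE.
do !split; first exact: H3_linr.
- by rewrite H3_ee // eqxx.
- by rewrite H3_ee // ord3_neq.
- by rewrite H3_ee // ord3_neq.
- by move=> j y yj; rewrite (H3_e_iota _ _ yj) eqxx.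
- by move=> j y yj; rewrite (H3_e_iota _ _ yj) ord3_neq.
- by move=> j y yj; rewrite (H3_e_iota _ _ yj) ord3_neq.
Qed.

Lemma supercomm_e_iota0 n i x : x \in spart C i ->
  supercomm (L (e n)) (L (io n x)) = 0.
Proof.
move=> xi.
have [P [PE [Pl [P0 [P1 [P2 [Pi0 [Pi1 Pi2]]]]]]]] := peirce_mulP n xi.
have [F [FE [Fl [F0 [F1 [F2 [Fi0 [Fi1 Fi2]]]]]]]] := peirce_eP n.
have E z : F (P z) = P (F z) -> supercomm (L (e n)) (L (io n x)) z = (0 : 'End(J)) z.
  move=> H; rewrite (supercomm_fun z (L_e_homog n) (L_iota_homog n xi) FE PE).
  by rewrite scale1r H subrr zero_lfunE.
apply: H3_end_ext => [m|m l z zl]; apply: E; move: m; apply: (@ord3_ind n).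
- by rewrite P0 F0 P0 (linear_zero Fl).
- by rewrite P1 F1 (linear_zero Pl) (linear_scale _ _ Fl) (Fi0 _ _ xi) scaler0.
- by rewrite P2 F2 (linear_zero Pl) (linear_scale _ _ Fl) (Fi0 _ _ xi) scaler0.
- rewrite (Fi0 _ _ zl) (Pi0 _ _ zl) (linear_zero Pl) (linear_scale _ _ Fl).
  by rewrite (linear_add Fl) F1 F2 addr0 scaler0.
- rewrite (Fi1 _ _ zl) (Pi1 _ _ zl) (linear_scale _ _ Pl) (Fi2 _ _ (mhh xi zl)).
  by rewrite (Pi1 _ _ zl).
- rewrite (Fi2 _ _ zl) (Pi2 _ _ zl) (linear_scale _ _ Pl) (linear_scale _ _ Fl).
  by rewrite (Fi1 _ _ (mhh zl xi)) (Pi2 _ _ zl) !scalerA mulrC.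
Qed.

Lemma supercomm_e_iota1 n i x : x \in spart C i ->
  supercomm (L (e (n + 1))) (L (io n x)) = - (2%:R^-1 *: Dder n x).
Proof.
move=> xi; rewrite (supercommC (L_iota_homog n xi) (L_e_homog _)) muln0 scale1r.
by rewrite /Dder scalerA mulVf ?scale1r.
Qed.

Lemma H3_sum_e n : L (e n) + L (e (n + 1)) + L (e (n + 2%:R)) = \1%VF.
Proof.
apply: H3_end_ext => [m|m l z zl]; rewrite id_lfunE !add_lfunE !lE;
  move: m; apply: (@ord3_ind n);
  rewrite ?H3_ee // ?(H3_e_iota _ _ zl) !ord3_neq ?eqxx ?addr0 ?add0r //.
all: by rewrite -scalerDr -mulr2n -scaler_nat scalerA mulVf // scale1r.
Qed.

(** The sum of the three L_(e_m) is the identity, which commutes with all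
    operators; as L_(e_n) commutes with L_(iota_n x), this commutator is the
    opposite of the previous one. *)
Lemma supercomm_e_iota2 n i x : x \in spart C i ->
  supercomm (L (e (n + 2%:R))) (L (io n x)) = 2%:R^-1 *: Dder n x.
Proof.
move=> xi.
have h1 : end_homog (V := J) false \1%VF by move=> j z; rewrite id_lfunE.
have : supercomm \1%VF (L (io n x)) = 0.
  by rewrite (supercommE h1 (L_iota_homog n xi)) scale1r comp_lfun1l comp_lfun1r subrr.
rewrite -(H3_sum_e n) !(linear_add (supercomm_linl _)).
rewrite (supercomm_e_iota0 _ xi) (supercomm_e_iota1 _ xi) add0r addrC => /eqP.
by rewrite subr_eq0 => /eqP.
Qed.

Lemma supercomm_e_e m n : supercomm (L (e m)) (L (e n)) = 0.
Proof.
apply: H3_end_ext => [l|l i x xi];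
  rewrite (supercomm_fun (F := amul (e m : J)) (G := amul (e n : J)) _ (L_e_homog m) (L_e_homog n)) //;
  rewrite scale1r zero_lfunE.
  rewrite !H3_ee //; case: (eqVneq n l) => [->|nl]; case: (eqVneq m l) => [->|ml];
  by rewrite ?r0 ?H3_ee // ?eqxx ?(negPf ml) ?(negPf nl) ?subrr.
rewrite !(H3_e_iota _ _ xi); case: (eqVneq n l) => [->|nl]; case: (eqVneq m l) => [->|ml];
by rewrite ?r0 ?rZ ?(H3_e_iota _ _ xi) ?eqxx ?(negPf ml) ?(negPf nl) ?scaler0 ?subrr.
Qed.

End AlbertOps.

(** * Quaternion algebras *)

Section Quaternion.
Variables (k : fieldType) (Q : quaternion_algebra k).
Hypothesis k_char : 2%N \notin [pchar k].
Local Notation one := (qone Q).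
Local Notation mul := (@qmul k Q).
Local Notation b := (@qpolar k Q).
Local Notation q := (@qnorm k Q).
Implicit Types (x y z t a : Q).

Let two0 := two_neq0 k_char.
Let bl y : scalar (b^~ y) := @qpolar_linearl k Q y.
Let br x : scalar (b x) := @qpolar_linearr k Q x.
Let bDl x y z : b (x + y) z = b x z + b y z.
Proof. exact: (linear_add (W := k^o) (bl z)). Qed.
Let bDr x y z : b z (x + y) = b z x + b z y.
Proof. exact: (linear_add (W := k^o) (br z)). Qed.
Let bZl (c : k) x z : b (c *: x) z = c * b x z.
Proof. exact: (linear_scale (W := k^o) c x (bl z)). Qed.
Let bZr (c : k) x z : b z (c *: x) = c * b z x.
Proof. exact: (linear_scale (W := k^o) c x (br z)). Qed.
Let bNl x z : b (- x) z = - b x z.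
Proof. exact: (linear_opp (W := k^o) x (bl z)). Qed.
Let bNr x z : b z (- x) = - b z x.
Proof. exact: (linear_opp (W := k^o) x (br z)). Qed.
Let b0l z : b 0 z = 0. Proof. exact: (linear_zero (W := k^o) (bl z)). Qed.
Lemma qpolarC x y : b x y = b y x.
Proof. by rewrite /qpolar /polar [y + x]addrC [LHS]addrAC. Qed.

Lemma qpolar_diag x : b x x = 2%:R * q x.
Proof.
by rewrite /qpolar /polar -mulr2n -scaler_nat qnormZ; ring.
Qed.

Lemma qnormD x y : q (x + y) = q x + q y + b x y.
Proof. by rewrite /qpolar /polar; ring. Qed.

Let mDl x y z : mul (x + y) z = mul x z + mul y z.
Proof. exact: (linear_add (qmul_linearl z)). Qed.
Let mDr x y z : mul z (x + y) = mul z x + mul z y.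
Proof. exact: (linear_add (qmul_linearr z)). Qed.
Let mZl (c : k) x z : mul (c *: x) z = c *: mul x z.
Proof. exact: (linear_scale c x (qmul_linearl z)). Qed.
Let mZr (c : k) x z : mul z (c *: x) = c *: mul z x.
Proof. exact: (linear_scale c x (qmul_linearr z)). Qed.

Lemma qone_neq0 : one != 0.
Proof.
apply/eqP => one0; have : \dim {:Q} = 0%N.
  rewrite (_ : fullv = 0%VS) ?dimv0 //; apply/eqP; rewrite -subv0.
  apply/subvP => x _; rewrite memv0 -(qmul1x x) one0.
  by rewrite (linear_zero (qmul_linearl x)).
by rewrite qdim.
Qed.

(** Linearization of the multiplicativity of the norm in both arguments. *)
Lemma qpolar_mull x y z : b (mul x y) (mul x z) = q x * b y z.
Proof.
have := qnormM x (y + z); rewrite mDr !qnormD !qnormM => H.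
by apply: (addrI (q x * q y + q x * q z)); rewrite H; ring.
Qed.

Lemma qpolar_mulr x y z : b (mul y x) (mul z x) = b y z * q x.
Proof.
have := qnormM (y + z) x; rewrite mDl !qnormD !qnormM => H.
by apply: (addrI (q y * q x + q z * q x)); rewrite H; ring.
Qed.

Lemma qpolar_mul x y z t :
  b (mul x y) (mul z t) + b (mul z y) (mul x t) = b x z * b y t.
Proof.
have := qpolar_mull (x + z) y t; rewrite !mDl !bDl !bDr !qpolar_mull qnormD => H.
have -> : b x z * b y t =
    (q x + q z + b x z) * b y t - (q x * b y t + q z * b y t) by ring.
by rewrite -H; ring.
Qed.

(** Otherwise b(y,1) would vanish for all y, as (q(1) - 1) b(1,y) = 0. *)
Lemma qnorm1 : q one = 1.
Proof.
apply/eqP; rewrite -subr_eq0; apply: contraT => n1.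
case/eqP: qone_neq0; apply: (@qpolar_nondeg k Q) => y.
have /eqP := qpolar_mull one one y; rewrite !qmul1x.
rewrite -subr_eq0 -{1}[b _ _]mul1r -mulrBl mulf_eq0 -opprB oppr_eq0 (negPf n1).
by move=> /eqP.
Qed.

Lemma qpolar1 : b one one = 2%:R.
Proof. by rewrite qpolar_diag qnorm1 mulr1. Qed.

Lemma qpolarI x y : (forall t, b x t = b y t) -> x = y.
Proof.
move=> H; apply/eqP; rewrite -subr_eq0; apply/eqP.
by apply: (@qpolar_nondeg k Q) => t; rewrite -/(b _ _) bDl bNl H subrr.
Qed.

Lemma qmul_adjl a y t : b a one = 0 -> b (mul a y) t = - b y (mul a t).
Proof.
move=> a1; have := qpolar_mul a y one t; rewrite a1 mul0r !qmul1x => /eqP.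
by rewrite addr_eq0 => /eqP.
Qed.

Lemma qmul_adjr a y t : b a one = 0 -> b (mul y a) t = - b y (mul t a).
Proof.
move=> a1; have := qpolar_mul y a t one; rewrite a1 mulr0 !qmulx1 => /eqP.
by rewrite addr_eq0 [b (mul t a) y]qpolarC => /eqP.
Qed.

(** Left multiplication by a trace zero element is skew for b, and it multiplies
    b by q(a); this gives an associativity relation. *)
Lemma qmul_sqrl a y : b a one = 0 -> mul a (mul a y) = - q a *: y.
Proof.
move=> a1; apply: qpolarI => t.
by rewrite qmul_adjl // qpolar_mull bZl mulNr.
Qed.

Lemma qmul_sqrr a y : b a one = 0 -> mul (mul y a) a = - q a *: y.
Proof.
move=> a1; apply: qpolarI => t.
by rewrite qmul_adjr // qpolar_mulr bZl mulrC mulNr.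
Qed.

Lemma qmul_sqr a : b a one = 0 -> mul a a = - q a *: one.
Proof. by move=> a1; have := qmul_sqrl one a1; rewrite qmulx1. Qed.

(** Squares of trace zero elements are scalars; apply this to a + a'. *)
Lemma qmul_anticomm a a' : b a one = 0 -> b a' one = 0 -> b a a' = 0 ->
  mul a' a = - mul a a'.
Proof.
move=> a1 a'1 aa'; apply/eqP; rewrite -addr_eq0; apply/eqP.
have : b (a + a') one = 0 by rewrite bDl a1 a'1 addr0.
move=> /qmul_sqr; rewrite qnormD aa' addr0 mDl !mDr opprD scalerDl.
rewrite -(qmul_sqr a1) -(qmul_sqr a'1) => H.
apply: (addrI (mul a a)); apply: (addIr (mul a' a')); rewrite addr0 -H.
by rewrite [mul a' a + mul a a']addrC !addrA.
Qed.

Definition orth_family (s : seq Q) : Prop :=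
  (forall i j, (i < size s)%N -> (j < size s)%N -> i != j -> b s`_i s`_j = 0) /\
  (forall i, (i < size s)%N -> q s`_i != 0).

Definition oproj (s : seq Q) x : Q :=
  x - \sum_(i < size s) (b x s`_i / b s`_i s`_i) *: s`_i.

Let diag0 x : q x != 0 -> b x x != 0.
Proof. by move=> qx; rewrite qpolar_diag mulf_neq0. Qed.

Lemma oprojP s x y : orth_family s -> y \in s -> b (oproj s x) y = 0.
Proof.
move=> [so sn] /(nthP 0)[j js <-].
rewrite bDl bNl (linear_bigsum (W := k^o) _ _ _ (bl _)) (bigD1 (Ordinal js)) //=.
rewrite bZl divfK ?diag0 ?sn // big1 => [|i ij]; first by rewrite addr0 subrr.
by rewrite bZl (so _ _ (ltn_ord i) js ij) mulr0.
Qed.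

Lemma oproj_polar s x y : (forall z, z \in s -> b x z = 0) ->
  b x (oproj s y) = b x y.
Proof.
move=> xs; rewrite bDr bNr (linear_bigsum (W := k^o) _ _ _ (br _)) big1 ?subr0 //.
by move=> i _; rewrite bZr xs ?mulr0 // mem_nth.
Qed.

(** The Gram-Schmidt process: if the vectors obtained are isotropic, some sum
    of two of them is not, because the form is nondegenerate. *)
Lemma orth_family_extend s : orth_family s -> (size s < 4)%N ->
  exists2 x, (forall y, y \in s -> b x y = 0) & q x != 0.
Proof.
move=> so s4.
have [x xs] : exists x, x \notin <<s>>%VS.
  have /subvPn[x _ xs] : ~~ (fullv <= <<s>>)%VS; last by exists x.
  apply/negP => /dimvS; rewrite qdim => /leq_trans/(_ (dim_span s)).
  by rewrite leqNgt s4.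
pose x0 := oproj s x.
have x00 : x0 != 0.
  apply: contra xs; rewrite subr_eq0 => /eqP ->.
  by apply: memv_suml => i _; rewrite memvZ // memv_span // mem_nth.
have x0s y : y \in s -> b x0 y = 0 by apply: oprojP.
have [i bi] : exists i : 'I_(\dim {:Q}), b x0 (vbasis {:Q})`_i != 0.
  apply/existsP; apply: contraR x00 => /existsPn H; apply/eqP.
  apply: (@qpolar_nondeg k Q) => y; rewrite -/(b _ _) (coord_vbasis (memvf y)).
  rewrite (linear_bigsum (W := k^o) _ _ _ (br _)) big1 // => i _.
  by rewrite bZr; have := H i; rewrite negbK => /eqP ->; rewrite mulr0.
pose y := oproj s (vbasis {:Q})`_i.
have ys z : z \in s -> b y z = 0 by apply: oprojP.
have xy : b x0 y != 0 by rewrite oproj_polar.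
have [qx|qx] := eqVneq (q x0) 0; last by exists x0.
have [qy|qy] := eqVneq (q y) 0; last by exists y.
exists (x0 + y) => [z zs|]; first by rewrite bDl x0s // ys // addr0.
by rewrite qnormD qx qy !add0r.
Qed.

Definition quaternion_basis (u v : Q) (A B : k) : Prop :=
  [/\ A != 0, B != 0, [/\ b u one = 0, b v one = 0 & b u v = 0] &
      q u = - A /\ q v = - B].

(** An orthogonal family of non isotropic elements 1, u, v; the product u v
    completes it to an orthogonal basis.  The four dimensional algebra thus
    has the usual presentation by u^2 = A, v^2 = B and uv = -vu, and identities
    between quaternions become polynomial identities in coordinates. *)
Lemma exists_quaternion_basis : exists u v A B, quaternion_basis u v A B.
Proof.
have o1 : orth_family [:: one].
  split=> [[|i] [|j] //|[|i] //= _]; by rewrite qnorm1 oner_eq0.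
have [u u1 qu] := orth_family_extend o1 isT.
have ou : b u one = 0 by apply: u1; rewrite mem_head.
have o2 : orth_family [:: one; u].
  split=> [[|[|i]] [|[|j]] //= _ _ _|[|[|i]] //= _]; rewrite ?qnorm1 ?oner_eq0 //.
  by rewrite qpolarC.
have [v v1 qv] := orth_family_extend o2 isT.
exists u, v, (- q u), (- q v); rewrite /quaternion_basis !oppr_eq0 !opprK; split=> //.
split=> //; first by apply: v1; rewrite mem_head.
by rewrite qpolarC; apply: v1; rewrite !inE eqxx orbT.
Qed.

Definition qim x : Q := x - (2%:R^-1 * b x one) *: one.

Section Coordinates.
Variables (u v : Q) (A B : k).
Hypothesis uvP : quaternion_basis u v A B.
Local Notation w := (mul u v).

Definition qcomb (c0 c1 c2 c3 : k) : Q :=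
  c0 *: one + c1 *: u + c2 *: v + c3 *: w.

Let A0 : A != 0. Proof. by case: uvP. Qed.
Let B0 : B != 0. Proof. by case: uvP. Qed.
Let u1 : b u one = 0. Proof. by case: uvP => _ _ []. Qed.
Let v1 : b v one = 0. Proof. by case: uvP => _ _ []. Qed.
Let uv0 : b u v = 0. Proof. by case: uvP => _ _ []. Qed.
Let qu : q u = - A. Proof. by case: uvP => _ _ _ []. Qed.
Let qv : q v = - B. Proof. by case: uvP => _ _ _ []. Qed.
Let w1 : b w one = 0.
Proof. by rewrite qmul_adjl // qmulx1 qpolarC uv0 oppr0. Qed.
Let wu : b w u = 0.
Proof. by rewrite -{2}(qmulx1 u) qpolar_mull v1 mulr0. Qed.
Let wv : b w v = 0.
Proof. by rewrite -{2}(qmul1x v) qpolar_mulr u1 mul0r. Qed.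
Let qw : q w = A * B. Proof. by rewrite qnormM qu qv mulrNN. Qed.

Let uu : mul u u = A *: one. Proof. by rewrite qmul_sqr // qu opprK. Qed.
Let vv : mul v v = B *: one. Proof. by rewrite qmul_sqr // qv opprK. Qed.
Let vu : mul v u = - w. Proof. by rewrite qmul_anticomm. Qed.
Let uw : mul u w = A *: v. Proof. by rewrite qmul_sqrl // qu opprK. Qed.
Let wv' : mul w v = B *: u. Proof. by rewrite qmul_sqrr // qv opprK. Qed.
Let vw : mul v w = - (B *: u). Proof. by rewrite -wv' qmul_anticomm. Qed.
Let wu' : mul w u = - (A *: v).
Proof. by rewrite -uw qmul_anticomm // qpolarC. Qed.
Let ww : mul w w = - (A * B) *: one. Proof. by rewrite qmul_sqr // qw. Qed.

Lemma qcomb_surj x : exists c0 c1 c2 c3, x = qcomb c0 c1 c2 c3.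
Proof.
pose s := [:: one; u; v; w].
have fs : free s.
  apply/(freeP (X := [tuple one; u; v; w])) => c sc i.
  have [qn bd] : q s`_i != 0 /\ forall j : 'I_4, j != i -> b s`_j s`_i = 0.
    split.
      case: i => [[|[|[|[|?]]]] ?] //=; rewrite ?qnorm1 ?oner_eq0 ?qu ?qv ?qw ?mulf_neq0 ?oppr_eq0 //.
    move=> j; case: i j => [[|[|[|[|?]]]] ?] [[|[|[|[|?]]]] ?] //= _;
    by rewrite // qpolarC.
  have := congr1 (b^~ s`_i) sc; rewrite /= b0l (linear_bigsum (W := k^o) _ _ _ (bl _)).
  rewrite (bigD1 i) //= bZl big1 => [|j ji]; last by rewrite bZl bd // mulr0.
  rewrite addr0 => /eqP; rewrite mulf_eq0 => /orP[/eqP //|].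
  by rewrite (negPf (diag0 qn)).
have : x \in <<s>>%VS.
  suff -> : <<s>>%VS = fullv by rewrite memvf.
  by apply/eqP; rewrite eqEdim subvf qdim (eqP fs).
move=> /(coord_span (X := [tuple one; u; v; w])) ->.
set f := coord _; exists (f 0 x), (f 1 x), (f 2%:R x), (f 3%:R x).
rewrite /qcomb !big_ord_recl big_ord0 /= addr0 !addrA.
by congr (_ *: _ + _ *: _ + _ *: _ + _ *: _); congr (f _ x); apply: val_inj.
Qed.

Let comb_simp := (bDl, bDr, bZl, bZr, bNl, bNr).

Section Values.
Variables x0 x1 x2 x3 y0 y1 y2 y3 : k.
Local Notation X := (qcomb x0 x1 x2 x3).
Local Notation Y := (qcomb y0 y1 y2 y3).

Lemma qcomb_mul : mul X Y = qcomb
  (x0 * y0 + A * x1 * y1 + B * x2 * y2 - A * B * x3 * y3)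
  (x0 * y1 + x1 * y0 - B * x2 * y3 + B * x3 * y2)
  (x0 * y2 + x2 * y0 + A * x1 * y3 - A * x3 * y1)
  (x0 * y3 + x3 * y0 + x1 * y2 - x2 * y1).
Proof.
rewrite /qcomb !mDl !mZl !mDr !mZr !qmul1x !qmulx1 uu vv vu uw wv' vw wu' ww.
by apply: qpolarI => t; rewrite !comb_simp; ring.
Qed.

Lemma qcomb_polar : b X Y =
  2%:R * (x0 * y0 - A * x1 * y1 - B * x2 * y2 + A * B * x3 * y3).
Proof.
rewrite /qcomb !comb_simp (qpolarC one u) (qpolarC one v) (qpolarC one w).
rewrite (qpolarC v u) (qpolarC u w) (qpolarC v w) !qpolar_diag qnorm1 qu qv qw.
rewrite uv0 u1 v1 w1 wu wv.
ring.
Qed.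

Lemma qcombD : X + Y = qcomb (x0 + y0) (x1 + y1) (x2 + y2) (x3 + y3).
Proof. by apply: qpolarI => t; rewrite !comb_simp; ring. Qed.

Lemma qcombZ (c : k) : c *: X = qcomb (c * x0) (c * x1) (c * x2) (c * x3).
Proof. by apply: qpolarI => t; rewrite !comb_simp; ring. Qed.

Lemma qcombN : - X = qcomb (- x0) (- x1) (- x2) (- x3).
Proof. by apply: qpolarI => t; rewrite !comb_simp; ring. Qed.

Lemma qcomb_polar1 : b X one = 2%:R * x0.
Proof. by rewrite /qcomb !comb_simp qpolar1 u1 v1 w1; ring. Qed.

Lemma qcomb_bar : qbar X = qcomb x0 (- x1) (- x2) (- x3).
Proof.
rewrite /qbar qcomb_polar1.
by apply: qpolarI => t; rewrite !comb_simp; ring.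
Qed.

Lemma qcomb_im : qim X = qcomb 0 x1 x2 x3.
Proof.
rewrite /qim qcomb_polar1 mulrA mulVf ?two0 // mul1r.
by apply: qpolarI => t; rewrite !comb_simp; ring.
Qed.

End Values.

End Coordinates.

Lemma Q0P x : reflect (b x one = 0) (x \in Q0 Q).
Proof.
rewrite memv_ker linfunE; last by move=> c y z; rewrite bl.
exact: eqP.
Qed.

Lemma qim_linear : linear qim.
Proof. by move=> c x y; apply: qpolarI => t; rewrite /qim !(bDl, bDr, bZl, bZr, bNl, bNr); ring. Qed.

Lemma qim_mem x : qim x \in Q0 Q.
Proof. by apply/Q0P; rewrite /qim bDl bNl bZl qpolar1; field; exact: two0. Qed.

Lemma qim_id a : a \in Q0 Q -> qim a = a.
Proof. by move=> /Q0P a1; rewrite /qim a1 mulr0 scale0r subr0. Qed.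

Lemma qimE x : x = (2%:R^-1 * b x one) *: one + qim x.
Proof. by rewrite /qim addrC subrK. Qed.

Lemma qim_one : qim one = 0.
Proof. by rewrite /qim qpolar1 mulVf // scale1r subrr. Qed.

Lemma qmulA x y z : mul x (mul y z) = mul (mul x y) z.
Proof.
have [u [v [A [B uvP]]]] := exists_quaternion_basis.
have [x0 [x1 [x2 [x3 ->]]]] := qcomb_surj uvP x; have [y0 [y1 [y2 [y3 ->]]]] := qcomb_surj uvP y.
have [z0 [z1 [z2 [z3 ->]]]] := qcomb_surj uvP z; rewrite !(qcomb_mul uvP) /=.
by congr (qcomb _ _ _ _ _ _); ring.
Qed.

Lemma qbar_mul x y : qbar (mul x y) = mul (qbar y) (qbar x).
Proof.
have [u [v [A [B uvP]]]] := exists_quaternion_basis.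
have [x0 [x1 [x2 [x3 ->]]]] := qcomb_surj uvP x; have [y0 [y1 [y2 [y3 ->]]]] := qcomb_surj uvP y.
rewrite !(qcomb_mul uvP, qcomb_bar uvP) /=.
by congr (qcomb _ _ _ _ _ _); ring.
Qed.

Lemma qbarK x : qbar (qbar x) = x.
Proof.
rewrite /qbar bDl bZl bNl qpolar1.
by apply: qpolarI => t; rewrite !(bDl, bZl, bNl); ring.
Qed.

Lemma qbar_Q0 a : a \in Q0 Q -> qbar a = - a.
Proof. by move=> /Q0P a1; rewrite /qbar a1 scale0r sub0r. Qed.

Lemma qbar_linear : linear (@qbar k Q).
Proof. by move=> c x y; apply: qpolarI => t; rewrite /qbar !(bDl, bDr, bZl, bZr, bNl, bNr); ring. Qed.

Lemma qbar_polar1 x : b (qbar x) one = b x one.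
Proof. by rewrite /qbar bDl bZl bNl qpolar1; ring. Qed.

Lemma qim_bar x : qim (qbar x) = - qim x.
Proof.
rewrite {1}/qim qbar_polar1 /qim /qbar.
apply: qpolarI => t; rewrite !(bDl, bDr, bZl, bZr, bNl, bNr); field; exact: two0.
Qed.

Lemma qpolar_qim x y : b x y = b (qim x) (qim y) + 2%:R^-1 * (b x one * b y one).
Proof.
rewrite /qim !(bDl, bDr, bZl, bZr, bNl, bNr) qpolar1 (qpolarC one y).
field; exact: two0.
Qed.

Lemma qpolar_mul1 x y : b (mul x y) one =
  2%:R^-1 * (b x one * b y one) - b (qim x) (qim y).
Proof.
have [u [v [A [B uvP]]]] := exists_quaternion_basis.
have [x0 [x1 [x2 [x3 ->]]]] := qcomb_surj uvP x; have [y0 [y1 [y2 [y3 ->]]]] := qcomb_surj uvP y.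
rewrite (qcomb_mul uvP) !(qcomb_im uvP) !(qcomb_polar1 uvP) (qcomb_polar uvP).
field; exact: two0.
Qed.

Lemma qim_mul x y : qim (mul x y) = 2%:R^-1 *: (tcommQ (qim x) (qim y)
  + b x one *: qim y + b y one *: qim x).
Proof.
have [u [v [A [B uvP]]]] := exists_quaternion_basis.
have [x0 [x1 [x2 [x3 ->]]]] := qcomb_surj uvP x; have [y0 [y1 [y2 [y3 ->]]]] := qcomb_surj uvP y.
rewrite (qcomb_mul uvP) !(qcomb_im uvP) !(qcomb_polar1 uvP) /tcommQ.
rewrite !(qcomb_mul uvP) !(qcombZ, qcombN, qcombD).
by congr (qcomb _ _ _ _ _ _); field; exact: two0.
Qed.

Lemma tcommQ_mem x y : tcommQ x y \in Q0 Q.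
Proof.
apply/Q0P; rewrite /tcommQ bDl bNl !qpolar_mul1 [b (qim y) _]qpolarC; ring.
Qed.

(** With the basis e_i = 1, u, v, uv, the map is f |-> 1/4 sum_i f(e_i) e_i^-1,
    built on the separability idempotent of Q.  It is a bimodule map that sends
    L_x to x, which makes derivations of Q inner, and it kills the right
    multiplications by trace zero elements. *)
Lemma exists_qtrace : exists lam : 'End(Q) -> Q,
  [/\ linear lam,
      forall a c, a \in Q0 Q -> c \in Q0 Q -> lam (qleft a - qright c) = a,
      forall (f g : 'End(Q)) x, (forall y, g y = f (mul x y)) ->
        lam g = mul (lam f) x,
      forall (f g : 'End(Q)) x, (forall y, g y = mul x (f y)) ->
        lam g = mul x (lam f) &
      forall (f : 'End(Q)) x, (forall y, f y = mul x y) -> lam f = x].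
Proof.
have [u [v [A [B uvP]]]] := exists_quaternion_basis.
have [A0 B0 _ _] := uvP.
pose w := mul u v.
pose lam (f : 'End(Q)) := 2%:R^-1 ^+ 2 *: (f one + A^-1 *: mul (f u) u
  + B^-1 *: mul (f v) v - (A * B)^-1 *: mul (f w) w).
have lin : linear lam.
  move=> c f g; rewrite /lam !add_lfunE !scale_lfunE !mDl !mZl.
  by apply: qpolarI => t; rewrite !(bDl, bZl, bNl); ring.
have uE : u = qcomb u v 0 1 0 0.
  by rewrite /qcomb !scale0r !addr0 add0r scale1r.
have vE : v = qcomb u v 0 0 1 0.
  by rewrite /qcomb !scale0r !addr0 !add0r scale1r.
have wE : w = qcomb u v 0 0 0 1.
  by rewrite /qcomb !scale0r !add0r scale1r.
have mr x : (mul x u = mul x (qcomb u v 0 1 0 0)) *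
    (mul x v = mul x (qcomb u v 0 0 1 0)) * (mul x w = mul x (qcomb u v 0 0 0 1)).
  by rewrite -uE -vE -wE.
have ml x : (mul u x = mul (qcomb u v 0 1 0 0) x) *
    (mul v x = mul (qcomb u v 0 0 1 0) x) * (mul w x = mul (qcomb u v 0 0 0 1) x).
  by rewrite -uE -vE -wE.
have norm := (qcomb_mul uvP, qcombZ, qcombN, qcombD).
have lamE (f : 'End(Q)) F0 F1 F2 F3 : f one = F0 -> f u = F1 -> f v = F2 -> f w = F3 ->
  lam f = 2%:R^-1 ^+ 2 *: (F0 + A^-1 *: mul F1 (qcomb u v 0 1 0 0)
  + B^-1 *: mul F2 (qcomb u v 0 0 1 0) - (A * B)^-1 *: mul F3 (qcomb u v 0 0 0 1)).
  by move=> <- <- <- <-; rewrite -uE -vE -wE.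
exists lam; split => //.
- move=> a c a0 c0; rewrite -(qim_id a0) -(qim_id c0) {a0 c0}.
  have [a0 [a1 [a2 [a3 ->]]]] := qcomb_surj uvP a.
  have [c0 [c1 [c2 [c3 ->]]]] := qcomb_surj uvP c.
  rewrite !(qcomb_im uvP); set a' := qcomb _ _ _ _ _ _; set c' := qcomb _ _ _ _ _ _.
  have fE x : (qleft a' - qright c') x = mul a' x - mul x c'.
    by rewrite sub_lfunE !linfunE //; [exact: qmul_linearl|exact: qmul_linearr].
  rewrite (lamE _ _ _ _ _ (fE _) (fE _) (fE _) (fE _)) qmulx1 qmul1x !mr !ml.
  rewrite /a' /c' !norm.
  by congr (qcomb _ _ _ _ _ _); field; rewrite ?A0 ?B0 ?two0.
- move=> f g x gE.
  have [x0 [x1 [x2 [x3 xE]]]] := qcomb_surj uvP x.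
  have [F0 fo] : exists F, f one = F by eexists.
  have [F1 fu] : exists F, f u = F by eexists.
  have [F2 fv] : exists F, f v = F by eexists.
  have [F3 fw] : exists F, f w = F by eexists.
  have fq c0 c1 c2 c3 : f (qcomb u v c0 c1 c2 c3) = c0 *: F0 + c1 *: F1 + c2 *: F2 + c3 *: F3.
    by rewrite /qcomb !linearD !linearZ /= fo fu fv fw.
  rewrite (lamE _ _ _ _ _ fo fu fv fw).
  have g1 : g one = f x by rewrite gE qmulx1.
  rewrite (lamE _ _ _ _ _ g1 (gE _) (gE _) (gE _)) !mr xE !(qcomb_mul uvP) !fq.
  move: F0 F1 F2 F3 {fo fu fv fw fq} => F0 F1 F2 F3.
  have [a0 [a1 [a2 [a3 ->]]]] := qcomb_surj uvP F0.
  have [b0 [b1 [b2 [b3 ->]]]] := qcomb_surj uvP F1.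
  have [c0 [c1 [c2 [c3 ->]]]] := qcomb_surj uvP F2.
  have [d0 [d1 [d2 [d3 ->]]]] := qcomb_surj uvP F3.
  rewrite !norm.
  by congr (qcomb _ _ _ _ _ _); field; rewrite ?A0 ?B0 ?two0.
- move=> f g x gE; rewrite /lam !gE -!scaleNr !mZr !mDr !mZr !qmulA //.
- move=> f x fE; rewrite (lamE _ _ _ _ _ (fE _) (fE _) (fE _) (fE _)) qmulx1 !mr.
  have [x0 [x1 [x2 [x3 ->]]]] := qcomb_surj uvP x.
  rewrite !norm.
  by congr (qcomb _ _ _ _ _ _); field; rewrite ?A0 ?B0 ?two0.
Qed.

End Quaternion.

(** * Triality for quaternions *)

Section TriQuaternion.
Variables (k : fieldType) (Q : quaternion_algebra k).
Hypothesis k_char : 2%N \notin [pchar k].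
Local Notation one := (qone Q).
Local Notation mul := (@qmul k Q).
Local Notation b := (@qpolar k Q).
Implicit Types (x y z t a : Q).

Let two0 := two_neq0 k_char.
Let ml y : linear (mul^~ y) := @qmul_linearl k Q y.
Let mr x : linear (mul x) := @qmul_linearr k Q x.

Lemma qleftE a x : qleft a x = mul a x.
Proof. by rewrite linfunE //; apply: mr. Qed.
Lemma qrightE a x : qright a x = mul x a.
Proof. by rewrite linfunE //; apply: ml. Qed.

Lemma qleft_linear : linear (@qleft k Q).
Proof.
by move=> c x y; apply/lfunP => z; rewrite add_lfunE scale_lfunE !qleftE ml.
Qed.
Lemma qright_linear : linear (@qright k Q).
Proof.
by move=> c x y; apply/lfunP => z; rewrite add_lfunE scale_lfunE !qrightE mr.
Qed.

Lemma even_part_mem (V : vectType k) (x : V) :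
  x \in spart (even_superspace V) false.
Proof. exact: memvf. Qed.

Lemma even_part_odd (V : vectType k) (x : V) :
  x \in spart (even_superspace V) true -> x = 0.
Proof. by move=> x0; apply/eqP; rewrite -memv0. Qed.

Lemma even_end_homog (V : vectType k) (f : 'End(V)) :
  end_homog (V := even_superspace V) false f.
Proof.
case=> x; last by move=> _; apply: even_part_mem.
by move=> /even_part_odd ->; rewrite linear0 mem0v.
Qed.

Lemma even_end_odd (V : vectType k) (f : 'End(V)) :
  end_homog (V := even_superspace V) true f -> f = 0.
Proof.
move=> H; apply/lfunP => x; rewrite zero_lfunE.
by apply: even_part_odd; apply: (H false); apply: even_part_mem.
Qed.

Lemma Qbar_alg : superalgebra_axiom (Qbar Q).
Proof.
split=> [y|x|i j x y] /=.
- by move=> c u v; rewrite /= ml (@qbar_linear k Q).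
- by move=> c u v; rewrite /= mr (@qbar_linear k Q).
case: i => [/even_part_odd ->|_].
  by rewrite (linear_zero (ml y)) (linear_zero (@qbar_linear k Q)) mem0v.
case: j => [/even_part_odd ->|_]; last exact: even_part_mem.
by rewrite (linear_zero (mr x)) (linear_zero (@qbar_linear k Q)) mem0v.
Qed.

Lemma Qbar_form : quadratic_superform_axiom (@cq k (Qbar Q)) (@cb k (Qbar Q)).
Proof.
have bl y : scalar (b^~ y) := @qpolar_linearl k Q y.
have br x : scalar (b x) := @qpolar_linearr k Q x.
have b0l y : b 0 y = 0 := linear_zero (W := k^o) (bl y).
have b0r x : b x 0 = 0 := linear_zero (W := k^o) (br x).
split=> //=.
- by move=> x y _ /even_part_odd ->; rewrite b0r.
- move=> i j x y; case: i => [/even_part_odd ->|_]; first by rewrite b0l b0r mulr0.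
  case: j => [/even_part_odd ->|_]; first by rewrite b0l b0r mulr0.
  by rewrite mul1r qpolarC.
by move=> c x _; apply: qnormZ.
Qed.

(** The elements denoted by K_m(a) above. *)
Definition qtri (m : 'I_3) (a : Q) : {ffun 'I_3 -> 'End(Qbar Q)} :=
  [ffun n => if n == m + 1 then - qright a
             else if n == m + 2%:R then qleft a else 0].

Lemma qtri0 m a : qtri m a m = 0.
Proof. by rewrite ffunE !ord3_neq. Qed.
Lemma qtri1 m a : qtri m a (m + 1) = - qright a.
Proof. by rewrite ffunE eqxx. Qed.
Lemma qtri2 m a : qtri m a (m + 2%:R) = qleft a.
Proof. by rewrite ffunE ord3_neq eqxx. Qed.

(** L_a and R_a are skew for b when a has trace zero, and the triality relation
    is the associativity of Q, up to conjugation. *)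
Lemma qtri_triple a :
  [/\ qtri 0 a = triple 0 (- qright a) (qleft a),
      qtri 1 a = triple (qleft a) 0 (- qright a) &
      qtri 2%:R a = triple (- qright a) (qleft a) 0].
Proof. by split; apply/ffunP => -[[|[|[|?]]] ?]; rewrite !ffunE. Qed.

Lemma iter_theta_qtri (n m : 'I_3) a : iter n (@theta k (Qbar Q)) (qtri m a) = qtri (m + n) a.
Proof.
have T m' : theta (qtri m' a) = qtri (m' + 1) a.
  by apply/ffunP => n'; rewrite !ffunE; case: m' n' => [[|[|[|?]]] ?] [[|[|[|?]]] ?]; rewrite /= ?ffunE.
have -> : m + n = iter n (fun m' => m' + 1) m.
  case: n => [[|[|[|//]]] ?] /=.
  - by rewrite -[RHS]addr0; congr (_ + _); apply: val_inj.
  - by congr (_ + _); apply: val_inj.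
  - by rewrite -addrA; congr (_ + _); apply: val_inj.
by elim: (n : nat) => //= l ->.
Qed.

Lemma qtri_tri m a : a \in Q0 Q -> tri (S := Qbar Q) false (qtri m a).
Proof.
move=> a0; have a1 := Q0P _ a0.
have skl x y : b (mul a x) y + b x (mul a y) = 0.
  by rewrite qmul_adjl // addNr.
have skr x y : b (mul x a) y + b x (mul y a) = 0.
  by rewrite qmul_adjr // addNr.
have bN x y : (b (- x) y = - b x y) * (b x (- y) = - b x y).
  split; first exact: (linear_opp (W := k^o) x (@qpolar_linearl k Q y)).
  exact: (linear_opp (W := k^o) y (@qpolar_linearr k Q x)).
have b0l y : b 0 y = 0 := linear_zero (W := k^o) (@qpolar_linearl k Q y).
have b0r x : b x 0 = 0 := linear_zero (W := k^o) (@qpolar_linearr k Q x).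
have mN x y : (mul (- x) y = - mul x y) * (mul x (- y) = - mul x y).
  by split; [exact: (linear_opp x (ml y))|exact: (linear_opp y (mr x))].
have barN x : qbar (- x) = - qbar x := linear_opp x (@qbar_linear k Q).
split=> [n|j l x y _ _].
  split; first exact: even_end_homog.
  move=> j l x y _ _; rewrite mul0n mul1r /=; move: n; apply: (@ord3_ind m).
  - by rewrite qtri0 !zero_lfunE b0l b0r addr0.
  - rewrite qtri1 !opp_lfunE !qrightE !bN -opprD skr oppr0 //.
  - by rewrite qtri2 !qleftE skl.
rewrite mul0n scale1r /=; have [E0 E1 E2] := qtri_triple a.
case: m => [[|[|[|//]]] ?].
- rewrite (_ : Ordinal _ = 0) ?E0; last exact: val_inj.
  rewrite !ffunE /= zero_lfunE opp_lfunE qrightE qleftE mN barN (qmulA k_char).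
  exact: esym (addNr _).
- rewrite (_ : Ordinal _ = 1) ?E1; last exact: val_inj.
  rewrite !ffunE /= zero_lfunE opp_lfunE qrightE qleftE mN barN.
  rewrite (linear_zero (ml y)) (linear_zero (@qbar_linear k Q)) add0r (qmulA k_char).
  by rewrite [in RHS](qbar_mul k_char) (qbar_Q0 a0) mN opprK.
- rewrite (_ : Ordinal _ = 2%:R) ?E2; last exact: val_inj.
  rewrite !ffunE /= zero_lfunE opp_lfunE qrightE qleftE.
  rewrite (linear_zero (mr x)) (linear_zero (@qbar_linear k Q)) addr0 -(qmulA k_char).
  by rewrite [in RHS](qbar_mul k_char) (qbar_Q0 a0) mN.
Qed.

Lemma tri_Qbar_odd d : tri (S := Qbar Q) true d -> d = 0.
Proof.
move=> [ho _]; apply/ffunP => n; rewrite ffunE; apply: even_end_odd.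
by case: (ho n).
Qed.

Lemma qtri_sumE (a : 'I_3 -> Q) n :
  (\sum_m qtri m (a m)) n = qleft (a (n + 1)) - qright (a (n + 2%:R)).
Proof.
rewrite (ord3_sum n) !ffunE /= !ord3D !ord3_neq !eqxx add0r //.
Qed.

(** Local triality for quaternions.  Conjugating d_0 by the involution gives a
    map E with E(xy) = d_1(x)y + x d_2(y).  Putting x = 1 or y = 1 expresses
    d_2 and d_1 by E, p = d_1(1) and r = d_2(1), and then E - L_(p+r) is a
    derivation of Q.  It is inner: applying [exists_qtrace] to the relation
    D o L_x = L_(D x) + L_x o D shows that D x = [lam D, x].  Now d_0, d_1 and
    d_2 are explicit. *)
Lemma tri_Qbar_even d : tri (S := Qbar Q) false d ->
  exists2 a : 'I_3 -> Q, forall m, a m \in Q0 Q & d = \sum_m qtri m (a m).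
Proof.
move=> [osp_d tri_d].
have mD x y z : (mul (x + y) z = mul x z + mul y z) * (mul z (x + y) = mul z x + mul z y).
  by split; [exact: (linear_add (ml z))|exact: (linear_add (mr z))].
have mN x y : (mul (- x) y = - mul x y) * (mul x (- y) = - mul x y).
  by split; [exact: (linear_opp x (ml y))|exact: (linear_opp y (mr x))].
have barN x : qbar (- x) = - qbar x := linear_opp x (@qbar_linear k Q).
have barD x y : qbar (x + y) = qbar x + qbar y := linear_add (@qbar_linear k Q) x y.
have d1 n : d n one \in Q0 Q.
  apply/Q0P; case: (osp_d n) => _ /(_ false false one one (memvf _) (memvf _)) /=.
  rewrite mul1r [X in _ + X]qpolarC -mulr2n -mulr_natl => /eqP.
  by rewrite mulf_eq0 (negPf two0) => /eqP.
(* E is the conjugate of d_0, and dl the derivation E - L_(p + r). *)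
pose p : Q := d 1 one; pose r : Q := d 2%:R one.
pose E x : Q := qbar (d 0 (qbar x)).
have Emul x y : E (mul x y) = mul (d 1 x) y + mul x (d 2%:R y).
  have := tri_d false false x y (memvf _) (memvf _).
  by rewrite mul0n scale1r /E => /= ->; rewrite -barD qbarK.
have d2E y : d 2%:R y = E y - mul p y.
  by have := Emul one y; rewrite !qmul1x => ->; rewrite addrC addKr.
have d1E x : d 1 x = E x - mul x r.
  by have := Emul x one; rewrite !qmulx1 => ->; rewrite addrK.
pose dl x : Q := E x - mul (p + r) x.
have El : linear E.
  move=> c x y; rewrite /E (@qbar_linear k Q) linearP; exact: qbar_linear.
have dll : linear dl by apply: linear_subf => //; apply: mr.
have bD x y t : b (x + y) t = b x t + b y t.
  exact: (linear_add (W := k^o) (@qpolar_linearl k Q t)).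
have bN x t : b (- x) t = - b x t.
  exact: (linear_opp (W := k^o) x (@qpolar_linearl k Q t)).
have dlM x y : dl (mul x y) = mul (dl x) y + mul x (dl y).
  rewrite /dl Emul d1E d2E !(mD, mN) !(qmulA k_char).
  by apply: (@qpolarI k Q) => t; rewrite !(bD, bN); ring.
have [lam [laml _ lamr lamM lam1]] := exists_qtrace Q k_char.
pose D : 'End(Q) := linfun dl.
have DE x : D x = dl x by apply: linfunE.
pose m : Q := qim (lam D).
have dlE x : dl x = mul m x - mul x m.
  have H1 : lam (D \o qleft x)%VF = mul (lam D) x.
    by apply: lamr => y; rewrite comp_lfunE qleftE.
  have H2 : lam (D \o qleft x)%VF = dl x + mul x (lam D).
    have -> : (D \o qleft x)%VF = qleft (dl x) + (qleft x \o D)%VF.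
      by apply/lfunP => y; rewrite add_lfunE !comp_lfunE !qleftE !DE dlM.
    rewrite (linear_add laml) (lam1 _ (dl x)); last by move=> y; rewrite qleftE.
    by congr (_ + _); apply: lamM => y; rewrite comp_lfunE qleftE.
  have -> : dl x = mul (lam D) x - mul x (lam D) by rewrite -H1 H2 addrK.
  rewrite [lam D in LHS](qimE (lam D)) -/m; set c := (_ * _ : k).
  rewrite !mD (linear_scale _ _ (ml _)) (linear_scale _ _ (mr _)) qmul1x qmulx1.
  by rewrite opprD addrACA subrr add0r.
have m0 : m \in Q0 Q by apply: qim_mem.
have [p0 r0] : p \in Q0 Q /\ r \in Q0 Q by rewrite !d1.
have pr0 : p + r \in Q0 Q by apply: memvD.
have EE x : E x = mul (p + r + m) x - mul x m.
  have -> : E x = dl x + mul (p + r) x by rewrite /dl subrK.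
  by rewrite dlE [mul (p + r + m) x]mD addrAC [mul m x + _]addrC.
(* From d_1 = L_(p+r+m) - R_(r+m) and d_2 = L_(r+m) - R_m. *)
exists (fun n : 'I_3 => [:: r + m; m; p + r + m]`_n).
  case=> [[|[|[|//]]] ?] /=; [exact: memvD r0 m0|exact: m0|].
  exact: memvD pr0 m0.
apply/ffunP => n; rewrite qtri_sumE; apply/lfunP => x.
rewrite sub_lfunE qleftE qrightE; case: n => [[|[|[|//]]] n3] /=.
- rewrite (_ : Ordinal n3 = 0); last exact: val_inj.
  have -> : d 0 x = qbar (E (qbar x)) by rewrite /E !qbarK.
  rewrite EE barD barN !(qbar_mul k_char) qbarK (qbar_Q0 m0) (qbar_Q0 (memvD pr0 m0)).
  by rewrite !mN opprK addrC.
- rewrite (_ : Ordinal n3 = 1); last exact: val_inj.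
  by rewrite d1E EE -addrA -opprD [mul x (r + m)]mD [mul x m + _]addrC.
- rewrite (_ : Ordinal n3 = 2%:R); last exact: val_inj.
  rewrite d2E EE !mD.
  by apply: (@qpolarI k Q) => t; rewrite !(bD, bN); ring.
Qed.

(** In each position at least one of two elements with different m vanishes, or
    one is a left and the other a right multiplication. *)
Lemma qtri_comm m l a a' n : supercomm (qtri m a n) (qtri l a' n) =
  (if m == l then qtri m (tcommQ a a') else 0) n.
Proof.
rewrite (supercommE (even_end_homog _) (even_end_homog _)) scale1r.
have mB x y z : (mul (x - y) z = mul x z - mul y z) * (mul z (x - y) = mul z x - mul z y).
  by split; [exact: (linear_sub x y (ml z))|exact: (linear_sub x y (mr z))].
apply/lfunP => x; rewrite sub_lfunE !comp_lfunE.
have mN y z : (mul (- y) z = - mul y z) * (mul y (- z) = - mul y z).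
  by split; [exact: (linear_opp y (ml z))|exact: (linear_opp z (mr y))].
move: l; apply: (@ord3_ind m); rewrite ?eqxx ?ord3_neq;
  move: n; apply: (@ord3_ind m).
- by rewrite !qtri0 !zero_lfunE subrr.
- rewrite !qtri1 !opp_lfunE !qrightE !mN !opprK mB opprB !(qmulA k_char) //.
- by rewrite !qtri2 !qleftE mB !(qmulA k_char).
- by rewrite qtri0 !zero_lfunE linear0 ffunE zero_lfunE subrr.
- by rewrite qtri0 !zero_lfunE linear0 ffunE zero_lfunE subrr.
- rewrite qtri2 -ord3_11 qtri1 !opp_lfunE !qleftE !qrightE ffunE zero_lfunE.
  by rewrite mN (qmulA k_char) subrr.
- by rewrite qtri0 !zero_lfunE linear0 ffunE zero_lfunE subrr.
- rewrite qtri1 -ord3_22 qtri2 !opp_lfunE !qleftE !qrightE ffunE zero_lfunE.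
  by rewrite mN (qmulA k_char) subrr.
- by rewrite (qtri0 (m + 2%:R)) !zero_lfunE linear0 ffunE zero_lfunE subrr.
Qed.

Lemma qpolar_sigma x y z : b x z *: y - b y z *: x =
  mul z (qim (mul (qbar x) y)) - mul (qim (mul x (qbar y))) z.
Proof.
have [u [v [A [B uvP]]]] := exists_quaternion_basis Q k_char.
have [x0 [x1 [x2 [x3 ->]]]] := qcomb_surj k_char uvP x.
have [y0 [y1 [y2 [y3 ->]]]] := qcomb_surj k_char uvP y.
have [z0 [z1 [z2 [z3 ->]]]] := qcomb_surj k_char uvP z.
rewrite !(qcomb_bar uvP) !(qcomb_mul uvP) !(qcomb_im k_char uvP) !(qcomb_polar uvP).
rewrite !(qcomb_mul uvP) !(qcombZ, qcombN, qcombD).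
by congr (qcomb _ _ _ _ _ _); ring.
Qed.

(** In positions 1 and 2 this is the decomposition of pbar q and p qbar into
    scalar and trace zero parts; in position 0 it is [qpolar_sigma]. *)
Lemma ttri_Qbar x y : ttri (S := Qbar Q) x y =
  - qtri 1 (qim (mul x (qbar y))) - qtri 2%:R (qim (mul (qbar x) y)).
Proof.
have SA := Qbar_alg; have SB := Qbar_form.
have [_ E1 _] := qtri_triple (qim (mul x (qbar y))).
have [_ _ E2] := qtri_triple (qim (mul (qbar x) y)).
have yx : mul y (qbar x) = qbar (mul x (qbar y)) by rewrite (qbar_mul k_char) qbarK.
have pxy : b (mul x (qbar y)) one = b x y.
  rewrite (qpolar_mul1 k_char) qbar_polar1 (qim_bar k_char) (qpolar_qim k_char x y).
  by rewrite [b _ (- _)](linear_opp (W := k^o) _ (@qpolar_linearr k Q _)) opprK addrC.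
have pxy' : b (mul (qbar x) y) one = b x y.
  rewrite (qpolar_mul1 k_char) qbar_polar1 (qim_bar k_char) (qpolar_qim k_char x y).
  by rewrite [b (- _) _](linear_opp (W := k^o) _ (@qpolar_linearl k Q _)) opprK addrC.
have rE z z' : rmulS (A := Qbar Q) z z' = qbar (mul z' z).
  by rewrite (rmulSE SA (even_part_mem z) (even_part_mem z')) scale1r.
have lE z z' : lmulS (A := Qbar Q) z z' = qbar (mul z z') by rewrite (lmulSE SA).
apply/ffunP => n; apply/lfunP => z; rewrite E1 E2 !ffunE.
case: n => [[|[|[|//]]] n3] /=.
- rewrite (sigmaE SB (even_part_mem x) (even_part_mem y) (even_part_mem z)).
  rewrite expr0 !mul1r opprK add_lfunE opp_lfunE qleftE qrightE [RHS]addrC.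
  exact: (qpolar_sigma x y z).
- rewrite oppr0 sub0r sub_lfunE scale_lfunE id_lfunE comp_lfunE rE lE opp_lfunE qleftE.
  rewrite (qbar_mul k_char) qbarK (qmulA k_char).
  have -> : mul (mul (qbar x) y) z =
      (2%:R^-1 * b x y) *: z + mul (qim (mul (qbar x) y)) z.
    rewrite {1}[mul (qbar x) y]qimE pxy' (linear_add (ml z)).
    by rewrite (linear_scale _ _ (ml z)) qmul1x.
  by rewrite opprD; exact: addNKr.
- rewrite subr0 opprK sub_lfunE scale_lfunE id_lfunE comp_lfunE rE lE qrightE.
  rewrite (qbar_mul k_char) qbarK -(qmulA k_char) yx.
  have -> : qbar (mul x (qbar y)) =
      (2%:R^-1 * b x y) *: one - qim (mul x (qbar y)).
    rewrite [LHS]qimE qbar_polar1 pxy (qim_bar k_char) //.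
  rewrite (linear_sub _ _ (mr z)) (linear_scale _ _ (mr z)) qmulx1.
  by rewrite opprB addrC; exact: subrK.
Qed.

End TriQuaternion.

(** * The bracket of T(Q,H) *)

Section TBracket.
Variables (k : fieldType) (Q : quaternion_algebra k) (H : superalgebra k).
Hypothesis HA : superalgebra_axiom H.

Let ml y : linear ((@amul k H)^~ y). Proof. by case: HA. Qed.
Let mr x : linear (@amul k H x). Proof. by case: HA. Qed.
Let bl y : scalar ((@qpolar k Q)^~ y) := @qpolar_linearl k Q y.
Let br x : scalar (@qpolar k Q x) := @qpolar_linearr k Q x.

Lemma tcommQ_linl (y : Q) : linear (fun x => tcommQ x y).
Proof.
by apply: linear_subf; [apply: qmul_linearl|apply: qmul_linearr].
Qed.
Lemma tcommQ_linr (x : Q) : linear (fun y => tcommQ x y).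
Proof.
by apply: linear_subf; [apply: qmul_linearr|apply: qmul_linearl].
Qed.

Lemma tbr_addl (u u' v : tspace Q H) : tbr (u + u') v = tbr u v + tbr u' v.
Proof.
rewrite /tbr /tact; congr (_, _).
- rewrite [RHS]addrACA -opprD; congr (_ - _).
    rewrite [RHS]addrACA; congr (_ + _).
      by rewrite [u + u']/= -(linear_add (tlift_linear _)).
    rewrite -tlift_addf; apply: eq_tlift => a x.
    by rewrite -(linear_add (@tens_linr _ _ _ _)) add_lfunE.
  by rewrite -(linear_add (hlift_linear _)).
rewrite [RHS]addrACA -opprD -scalerDr -(linear_add (supercomm_linl _)).
by congr (_ - _ *: _); rewrite -(linear_add (tlift_linear _)).
Qed.

Lemma tbr_addr (u v v' : tspace Q H) : tbr u (v + v') = tbr u v + tbr u v'.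
Proof.
rewrite /tbr /tact; congr (_, _).
- rewrite [RHS]addrACA -opprD; congr (_ - _).
    rewrite [RHS]addrACA; congr (_ + _).
      rewrite -tlift_addf; apply: eq_tlift => a x.
      by rewrite -(linear_add (tlift_linear _)).
    by rewrite -(linear_add (tlift_linear _)).
  rewrite -hlift_addf; apply: eq_hlift => i a j x.
  rewrite -(linear_add (end_ext_linear _)) // => l.
  by apply: linear_scaler => c f g; rewrite add_lfunE scale_lfunE tens_linr.
rewrite [RHS]addrACA -opprD -scalerDr -(linear_add (supercomm_linr _)).
congr (_ - _ *: _); rewrite -tlift_addf; apply: eq_tlift => a x.
by rewrite -(linear_add (tlift_linear _)).
Qed.

Lemma tbr_pure i j (a b : Q) x y d e : x \in spart H i -> y \in spart H j ->
  end_homog i d -> end_homog j e ->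
  tbr (tens a x, d) (tens b y, e) =
  (tens (tcommQ a b) (amul x y) + tens b (d y) - (-1) ^+ (i * j) *: tens a (e x),
   supercomm d e - (2%:R * qpolar a b) *: supercomm (lmulS x) (lmulS y)).
Proof.
move=> xi yj di ej; rewrite /tbr /tact /=; congr (_ + _ - _, _ - _).
- rewrite tlift_tens.
  + rewrite tlift_tens // => [w|c].
      exact: (linear_compose (tens_linl _) (@tcommQ_linr _)).
    exact: (linear_compose (@tens_linr _ _ _ _) (mr _)).
  + move=> w c u v; apply: tlift_linf => b' y'.
    by rewrite tcommQ_linl tens_linl.
  + move=> w c u v; apply: tlift_linf => b' y'.
    by rewrite ml tens_linr.
- rewrite tlift_tens // => [w|c]; first exact: (tens_linl (d w)).
  exact: (linear_compose (@tens_linr _ _ _ _) (@linear_hom _ _ _ d)).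
- rewrite (hlift_tens (i := false) (j := i)) //; last exact: memvf.
  + rewrite (end_extE (i := j)) // => l.
    by rewrite zero_lfunE tens0r scaler0.
  + move=> l m w; apply: linear_fun_sum => p; apply: linear_scaler.
    exact: (tens_linl _).
  + move=> l c m; apply: linear_fun_sum => p; apply: linear_scaler.
    exact: (linear_compose (@tens_linr _ _ _ _) (@linear_hom _ _ _ _)).
- rewrite tlift_tens.
  + rewrite tlift_tens; first by rewrite scalerA.
      by move=> w; apply: scalar_linear_scale.
    move=> c; apply: linear_scaler; apply: linear_compose (lmulS_linear HA).
    exact: supercomm_linr.
  + move=> w c u v; apply: tlift_linf => b' y'.
    by rewrite bl scalerDl scalerA.
  + move=> w c u v; apply: tlift_linf => b' y'.
    by rewrite (lmulS_linear HA) supercomm_linl scalerDr !scalerA mulrC.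
Qed.

(** Antisymmetry for homogeneous pairs, when the algebra is supercommutative. *)
Lemma tbr_pureC i j (a b : Q) x y d e : x \in spart H i -> y \in spart H j ->
  end_homog i d -> end_homog j e -> amul y x = (-1) ^+ (i * j) *: amul x y ->
  tbr (tens b y, e) (tens a x, d) =
  - ((-1) ^+ (i * j) *: tbr (tens a x, d) (tens b y, e)).
Proof.
move=> xi yj di ej yx; rewrite (tbr_pure _ _ xi yj di ej) (tbr_pure _ _ yj xi ej di).
have pE c (X : tensor Q H) (f : 'End(H)) :
  - (c *: ((X, f) : tspace Q H)) = (- (c *: X), - (c *: f)) by [].
rewrite [(j * i)%N]mulnC pE; congr (_, _).
  rewrite yx (linear_scale _ _ (@tens_linr _ _ _ _)).
  have -> : tcommQ b a = - tcommQ a b by rewrite opprB.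
  rewrite (linear_opp _ (tens_linl _)) scalerN scalerBr scalerDr scalerA -expr2 sqrr_sign scale1r.
  by rewrite !opprD opprK addrAC.
have Lx := lmulS_homog HA xi; have Ly := lmulS_homog HA yj.
have -> : qpolar b a = qpolar a b by rewrite /qpolar /polar [b + a]addrC [LHS]addrAC.
rewrite (supercommC di ej) (supercommC Lx Ly) scalerBr opprB scalerN opprK addrC.
by congr (_ - _); rewrite !scalerA mulrC.
Qed.

End TBracket.

(** * The subsuperalgebra g(S1,S) *)

Section ScalarAlgebra.
Variables (k : fieldType).
Hypothesis k_char : 2%N \notin [pchar k].
Let two0 := two_neq0 k_char.

Lemma S1_alg : superalgebra_axiom (S1 k).
Proof.
split=> [y|x|i j x y] /=.
- by move=> c u v; change ((c * u + v) * y = c * (u * y) + v * y :> k); ring.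
- by move=> c u v; change (x * (c * u + v) = c * (x * u) + x * v :> k); ring.
case: i => [/even_part_odd ->|_]; first by rewrite mul0r mem0v.
by case: j => [/even_part_odd ->|_]; [rewrite mulr0 mem0v|apply: even_part_mem].
Qed.

Lemma S1_form : quadratic_superform_axiom (@cq k (S1 k)) (@cb k (S1 k)).
Proof.
split=> /=.
- split=> y c u v.
    by change (2%:R * ((c * u + v) * y) = c * (2%:R * (u * y)) + 2%:R * (v * y) :> k); ring.
  by change (2%:R * (y * (c * u + v)) = c * (2%:R * (y * u)) + 2%:R * (y * v) :> k); ring.
- by move=> x y _ /even_part_odd ->; rewrite !mulr0.
- move=> i j x y; case: i => [/even_part_odd ->|_]; first by rewrite !(mul0r, mulr0).
  case: j => [/even_part_odd ->|_]; first by rewrite !(mul0r, mulr0).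
  by rewrite mul1r [x * y]mulrC.
- by move=> c x _; rewrite exprMn.
by move=> x y _ _; rewrite /polar; ring.
Qed.

(** A skew endomorphism of a line is 0, and an odd one is 0 because the
    line is even. *)
Lemma tri_S1 i (d : {ffun 'I_3 -> 'End(S1 k)}) : tri i d -> d = 0.
Proof.
case: i => -[ho _]; apply/ffunP => n; rewrite ffunE.
  by apply: even_end_odd; case: (ho n).
case: (ho n) => _ /(_ false false (1 : k^o) (1 : k^o) (memvf _) (memvf _)) /=.
rewrite !mulr1 !mul1r -mulrDr => /eqP; rewrite mulf_eq0 (negPf two0) /=.
rewrite -mulr2n -mulr_natl mulf_eq0 (negPf two0) => /eqP d1.
apply/lfunP => x; rewrite zero_lfunE.
have -> : d n x = (x : k) *: d n (1 : k^o).
  by rewrite -linearZ; congr (d n _); apply/esym/mulr1.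
by rewrite [d n _]d1; apply: scaler0.
Qed.

Lemma ttri_S1 : ttri (S := S1 k) (1 : k^o) (1 : k^o) = 0.
Proof.
have SA := S1_alg; have SB := S1_form.
have o (x : k^o) : x \in spart (S1 k) false := memvf x.
have E (x : k^o) : (lmulS (A := S1 k) (1 : k^o) x = x) * (rmulS (A := S1 k) (1 : k^o) x = x).
  rewrite (lmulSE SA) (rmulSE SA (o _) (o _)) scale1r /=.
  by split; [exact: mul1r|exact: mulr1].
apply/ffunP => n; apply/lfunP => x; rewrite !ffunE zero_lfunE.
case: n => [[|[|[|//]]] ?] /=.
- rewrite (sigmaE SB (o _) (o _) (o _)); exact: subrr.
- rewrite sub_lfunE scale_lfunE id_lfunE comp_lfunE !E !mulr1 mulVf // scale1r.
  exact: subrr.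
- rewrite sub_lfunE scale_lfunE id_lfunE comp_lfunE !E !mulr1 mulVf // scale1r.
  exact: subrr.
Qed.

End ScalarAlgebra.

Section Extension.
Variables (k : fieldType) (k_char : 2%N \notin [pchar k])
  (C : hurwitz_superalgebra k)
  (Phi : 'Hom(lie_g (S1 k) (para_hurwitz C), der (H3 C)))
  (Phi_iso : lie_iso Phi)
  (Phi_tri : forall (i : bool) (d : {ffun 'I_3 -> 'End(para_hurwitz C)}),
     tri i d -> is_Dtri d (Phi (gtri' (S1 k) d)))
  (Phi_iota : forall (n : 'I_3) (a : C),
     Phi (giota (S := S1 k) (S' := para_hurwitz C) n
            (tens (1 : k^o) (a : para_hurwitz C))) = Dder n a).

Local Notation S := (para_hurwitz C).

Let two0 := two_neq0 k_char.
Let SA := para_alg C.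
Let SB := para_form C.
Let A1 := S1_alg k.
Let B1 := S1_form k.
Let o1 (x : k^o) : x \in spart (S1 k) false := memvf x.

Lemma gpart0 (T : normed_superalgebra k) i :
  superalgebra_axiom T -> quadratic_superform_axiom (@cq k T) (@cb k T) ->
  gpart i (0 : gspace T S).
Proof.
by move=> TA TB; split=> [||n]; [exact: tri0|exact: tri0|rewrite ffunE mem0v].
Qed.

Lemma gpart_lmem (T : normed_superalgebra k) i (u : lie_g T S) :
  superalgebra_axiom T -> quadratic_superform_axiom (@cq k T) (@cb k T) ->
  gpart i u -> lmem u.
Proof.
move=> TA TB ui; case: i ui => ui.
  by exists 0, u; rewrite add0r; split=> //; apply: gpart0.
by exists u, 0; rewrite addr0; split=> //; apply: gpart0.
Qed.

Let Phi_br i j (u v : lie_g (S1 k) S) : gpart i u -> gpart j v ->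
  Phi (gbr u v) = supercomm (Phi u) (Phi v).
Proof.
move=> ui vj; case: Phi_iso => _ _ _ H.
by apply: H; [apply: gpart_lmem ui|apply: gpart_lmem vj].
Qed.

Let ptri i d : tri i d -> gpart i (gtri' (S' := S) (S1 k) d).
Proof. exact: gpart_tri' A1 B1 _ _. Qed.

Let piota i n (x : C) : x \in spart C i ->
  gpart i (giota (S := S1 k) (S' := S) n (tens (1 : k^o) (x : S))).
Proof. by move=> xi; apply: (gpart_iota A1 B1 SA SB); rewrite ?o1. Qed.

Lemma Phi_tri_der i (d : {ffun 'I_3 -> 'End(S)}) : tri i d -> der_part i (Phi (gtri' (S1 k) d)).
Proof. by move=> di; case: Phi_iso => H _ _ _; apply: (H i); apply: ptri. Qed.

Lemma Phi_tri_homog i (d : {ffun 'I_3 -> 'End(S)}) : tri i d -> end_homog i (Phi (gtri' (S1 k) d)).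
Proof. by move=> /Phi_tri_der[]. Qed.

Lemma Phi_tri_comm i j (d d' : {ffun 'I_3 -> 'End(S)}) : tri i d -> tri j d' ->
  Phi (gtri' (S1 k) [ffun n => supercomm (d n) (d' n)]) =
  supercomm (Phi (gtri' (S1 k) d)) (Phi (gtri' (S1 k) d')).
Proof.
move=> di dj; rewrite -(Phi_br (ptri di) (ptri dj)).
by rewrite (gbr_tri'_tri' A1 B1 di dj).
Qed.

Lemma Phi_tri_Dder i j (d : {ffun 'I_3 -> 'End(S)}) n (x : C) : tri i d -> x \in spart C j ->
  Dder n (d n x) = supercomm (Phi (gtri' (S1 k) d)) (Dder n x).
Proof.
move=> di xj; rewrite -!Phi_iota -(Phi_br (ptri di) (piota n xj)).
by rewrite (gbr_tri'_iota A1 B1 SA SB n di (o1 _) xj).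
Qed.

(** In S1 the product of 1 by 1 is 1, so this is the image under Phi of the
    bracket of iota_n(1 (x) x) and iota_(n+1)(1 (x) y). *)
Lemma Dder_next i j n (x y : C) : x \in spart C i -> y \in spart C j ->
  Dder (n + 2%:R) (amul (x : S) y) = supercomm (Dder n x) (Dder (n + 1) y).
Proof.
move=> xi yj; rewrite -!Phi_iota -(Phi_br (piota n xi) (piota (n + 1) yj)).
rewrite (gbr_iota_next A1 B1 SA SB n (o1 _) (o1 _) xi yj) /=.
by congr (Phi (giota _ (tens _ _))); rewrite [RHS]mulr1.
Qed.

(** The factor 1/2 is the inverse of b(1,1) in the bracket of iota_n(1 (x) x)
    and iota_n(1 (x) y), whose component in tri(S1) vanishes. *)
Lemma Phi_ttri i j (n : 'I_3) (x y : C) : x \in spart C i -> y \in spart C j ->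
  Phi (gtri' (S1 k) (iter n (@theta k S) (ttri (x : S) y))) =
  2%:R^-1 *: supercomm (Dder n x) (Dder n y).
Proof.
move=> xi yj; rewrite -!Phi_iota -(Phi_br (piota n xi) (piota n yj)).
rewrite (gbr_iota_same A1 B1 SA SB n (o1 _) (o1 _) xi yj) (ttri_S1 k_char).
rewrite (linear_zero (@iter_theta_linear k (S1 k) n)) scaler0 (linear_zero (@gtri_linear _ _ _)) add0r.
rewrite (linear_scale _ _ (@gtri'_linear _ _ _)) linearZ /= !mulr1 scalerA mulVf //.
by rewrite scale1r.
Qed.

End Extension.

(** * Contractions and Peirce coordinates *)

Section Contraction.
Variables (k : fieldType) (V W : vectType k).

Definition contract (f : V -> k) : tensor V W -> W :=
  tlift (fun v w => f v *: w).

Lemma contract_tens f v w : scalar f -> contract f (tens v w) = f v *: w.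
Proof.
move=> fl; rewrite /contract tlift_tens // => [w'|v'].
  exact: scalar_linear_scale.
exact: linear_scaler (@linear_id _ _).
Qed.

Lemma contract_inj (X Y : tensor V W) :
  (forall f, scalar f -> contract f X = contract f Y) -> X = Y.
Proof.
have cE i j : forall Z : tensor V W,
    Z i j = coord (vbasis {:W}) j (contract (coord (vbasis {:V}) i) Z).
  apply: tensor_ind => [Z Z' HZ HZ'|v w].
    by rewrite mxE HZ HZ' -linearD /contract -(linear_add (tlift_linear _)).
  by rewrite contract_tens ?linearZ ?mxE // => c x y; rewrite linearP.
move=> XY; apply/matrixP => i j; rewrite !cE; congr (coord _ _ _); apply: XY.
by move=> c x y; rewrite linearP.
Qed.

Lemma scalar_expand (U : lmodType k) (f : U -> k) : scalar f ->
  (forall x y, f (x + y) = f x + f y) * (forall c x, f (c *: x) = c * f x) *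
  (forall x, f (- x) = - f x).
Proof.
move=> fl; split; first split; move=> *.
- exact: (linear_add (W := k^o) fl).
- exact: (linear_scale (W := k^o) _ _ fl).
- exact: (linear_opp (W := k^o) _ fl).
Qed.

(** Reduces an identity between sums of pure tensors to an identity in k, by
    evaluating an arbitrary pair of linear forms on both sides. *)
Lemma tensor_eqP (X Y : tensor V W) :
  (forall (f : V -> k) (g : W -> k) (F : tensor V W -> k),
     scalar f -> scalar g -> scalar F -> (forall x y, F (tens x y) = f x * g y) ->
     F X = F Y) -> X = Y.
Proof.
move=> H; apply/matrixP => r c.
apply: (H (coord (vbasis {:V}) r) (coord (vbasis {:W}) c) (fun X => X r c)).
- by move=> a x y; rewrite linearP.
- by move=> a x y; rewrite linearP.
- by move=> a x y; rewrite !mxE.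
- by move=> x y; rewrite !mxE.
Qed.

End Contraction.

Section PeirceCoordinates.
Variables (k : fieldType) (C : hurwitz_superalgebra k).
Hypothesis k_char : 2%N \notin [pchar k].
Local Notation J := (H3 C).

Lemma peirce_inj (c c' : 'I_3 -> k) (x x' : 'I_3 -> C) :
  \sum_n c n *: H3_e C n + \sum_n H3_iota n (x n) =
  \sum_n c' n *: H3_e C n + \sum_n H3_iota n (x' n) ->
  forall n, c n = c' n /\ x n = x' n.
Proof.
have two0 := two_neq0 k_char.
have vD (u v : J) : vsval (u + v) = vsval u + vsval v by exact: linearD.
have vZ d (u : J) : vsval (d *: u) = d *: vsval u by exact: linearZ.
have vS (F : 'I_3 -> J) n : vsval (\sum_m F m) = vsval (F n) + vsval (F (n + 1)) + vsval (F (n + 2%:R)).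
  by rewrite (ord3_sum n) !vD.
have hl := @hbar_linear k C.
have E (d : 'I_3 -> k) (y : 'I_3 -> C) n (z := vsval (\sum_n d n *: H3_e C n + \sum_n H3_iota n (y n))) :
    z (n, n) = d n *: hone C /\ z (n + 2%:R, n + 1) = 2%:R *: y n.
  rewrite /z vD !(vS _ n) !vZ !val_H3_e !(val_H3_iota) !ord3D.
  by split; rewrite !ffunE /= !xpair_eqE !ord3_neq !eqxx /= ?(scaler0, addr0, add0r).
move=> H n; have [E1 E2] := E c x n; have [E1' E2'] := E c' x' n.
rewrite H E1' in E1; rewrite H E2' in E2; split.
  apply/esym/eqP; rewrite -subr_eq0; have /eqP := E1; rewrite -subr_eq0 -scalerBl scaler_eq0.
  by rewrite (negPf (hone_neq0 C)) orbF.
by apply/esym/(scalerI two0).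
Qed.

End PeirceCoordinates.

(** * The extension and its compatibility with the brackets *)

Section Morphism.
Variables (k : fieldType) (k_char : 2%N \notin [pchar k])
  (Q : quaternion_algebra k) (C : hurwitz_superalgebra k).

Local Notation S := (para_hurwitz C).
Local Notation J := (H3 C).
Local Notation e := (H3_e C).
Local Notation io := (@H3_iota k C).
Local Notation L := (@lmulS k J).
Local Notation b := (@qpolar k Q).
Local Notation one := (qone Q).
Local Notation G1 := (gspace (S1 k) S).
Local Notation G := (gspace (Qbar Q) S).

Variables (Phi : G1 -> 'End(J)) (lam : 'End(Q) -> Q).
Hypotheses (Phi_linear : linear Phi) (lam_linear : linear lam).
Hypothesis lamE :
  forall a c, a \in Q0 Q -> c \in Q0 Q -> lam (qleft a - qright c) = a.

Let two0 := two_neq0 k_char.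
Let SA := para_alg C.
Let SB := para_form C.
Let QA := Qbar_alg Q.
Let QB := Qbar_form Q.
Let oQ (x : Q) : x \in spart (Qbar Q) false := memvf x.

(** The retraction of g(Qbar,S) onto g(S1,S) that takes the trace part
    b(q,1)/2 of the first tensor factor. *)
Definition gproj (u : G) : G1 :=
  gtri' (S1 k) u.1.2 + \sum_n giota (S := S1 k) n
    (tlift (fun (q : Q) (x : C) => tens (2%:R^-1 * b q one : k^o) (x : S)) (u.2 n)).

Definition Phi3_fun (u : G) : tspace Q J :=
  (\sum_m tens (lam (u.1.1 (m + 2%:R))) (e m)
   - 2%:R^-1 *: \sum_n tlift (fun (q : Q) (x : C) => tens (qim q) (io n x)) (u.2 n),
   Phi (gproj u)).

Lemma gproj_linear : linear gproj.
Proof.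
move=> c u v; rewrite /gproj scalerDr addrACA -(@gtri'_linear _ _ _ c) scaler_sumr -big_split.
congr (gtri' _ _ + _); apply: eq_bigr => n _.
by rewrite /= -giota_linear -tlift_linear !ffunE.
Qed.

Lemma Phi3_fun_linear : linear Phi3_fun.
Proof.
move=> c u v; rewrite /Phi3_fun gproj_linear Phi_linear; congr (_, _).
rewrite /= scalerBr addrACA -opprD; congr (_ - _).
  rewrite scaler_sumr -big_split; apply: eq_bigr => m _ /=; rewrite !ffunE lam_linear; exact: tens_linl.
rewrite scalerA [c * _]mulrC -scalerA -scalerDr [c *: \sum_(i : 'I_3) _]scaler_sumr -big_split.
congr (_ *: _); apply: eq_bigr => n _ /=; rewrite !ffunE; exact: tlift_linear.
Qed.

Let pk_lin : linear (fun q : Q => 2%:R^-1 * b q one : k^o).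
Proof.
move=> c x y; have bE : b (c *: x + y) one = c * b x one + b y one.
  exact: (@qpolar_linearl k Q one).
rewrite bE; change (2%:R^-1 * (c * b x one + b y one) =
  c * (2%:R^-1 * b x one) + 2%:R^-1 * b y one :> k); ring.
Qed.

Lemma Phi3_qtri m a : a \in Q0 Q ->
  Phi3_fun (gtri S (qtri m a)) = (tens a (e m), 0).
Proof.
move=> a0; rewrite /Phi3_fun.
have -> : gproj (gtri S (qtri m a)) = 0.
  rewrite /gproj [gtri' _ _]/= -/(0 : G1) add0r big1 // => n _.
  by rewrite ffunE (linear_zero (tlift_linear _)) (linear_zero (giota_linear _)).
rewrite (linear_zero Phi_linear); congr (_, _).
rewrite [X in _ - _ *: X]big1 => [|n _]; last by rewrite ffunE; apply: (linear_zero (tlift_linear _)).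
rewrite scaler0 subr0 (ord3_sum m) /= !ord3D qtri2 qtri0 qtri1.
have -> : qleft a = qleft a - qright 0 by rewrite (linear_zero (@qright_linear k Q)) subr0.
have -> : - qright a = qleft 0 - qright a by rewrite (linear_zero (@qleft_linear k Q)) sub0r.
by rewrite !lamE ?mem0v // (linear_zero lam_linear) !tens0l !addr0.
Qed.

Lemma Phi3_tri' d : Phi3_fun (gtri' (Qbar Q) d) = (0, Phi (gtri' (S1 k) d)).
Proof.
rewrite /Phi3_fun /gproj /=; congr (_, Phi _).
  rewrite !big1 ?scaler0 ?subr0 // => n _.
    by rewrite ffunE; apply: (linear_zero (tlift_linear _)).
  by rewrite ffunE (linear_zero lam_linear) tens0l.
rewrite big1 ?addr0 // => n _.
by rewrite ffunE (linear_zero (tlift_linear _)) (linear_zero (giota_linear _)).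
Qed.

Lemma gproj_iota n q x : gproj (giota n (tens (q : Qbar Q) x)) =
  (2%:R^-1 * b q one) *: giota (S := S1 k) (S' := S) n (tens (1 : k^o) x).
Proof.
rewrite /gproj [gtri' _ _]/= -/(0 : G1) add0r (bigD1 n) //= big1 => [|m mn].
  rewrite addr0 !ffunE eqxx tlift_tens.
  - rewrite -(linear_scale _ _ (giota_linear _)) -(linear_scale _ _ (tens_linl _)).
    by have -> : (2%:R^-1 * b q one) *: (1 : k^o) = 2%:R^-1 * b q one by exact: mulr1.
  - by move=> w; apply: (linear_compose (tens_linl _) pk_lin).
  - by move=> v; apply: tens_linr.
by rewrite !ffunE (negPf mn) (linear_zero (tlift_linear _)) (linear_zero (giota_linear _)).
Qed.

Hypothesis Phi_iota : forall n (x : C),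
  Phi (giota (S := S1 k) (S' := S) n (tens (1 : k^o) (x : S))) = Dder n x.

Lemma Phi3_iota n q (x : C) : Phi3_fun (giota n (tens (q : Qbar Q) (x : S))) =
  (tens (- 2%:R^-1 *: qim q) (io n x), (2%:R^-1 * b q one) *: Dder n x).
Proof.
rewrite /Phi3_fun gproj_iota (linear_scale _ _ Phi_linear) Phi_iota; congr (_, _).
rewrite big1 => [|m _]; last by rewrite ffunE (linear_zero lam_linear) tens0l.
rewrite sub0r (bigD1 n) //= big1 => [|m mn]; last first.
  by rewrite ffunE (negPf mn); apply: (linear_zero (tlift_linear _)).
rewrite addr0 !ffunE eqxx tlift_tens.
- by rewrite (linear_scale _ _ (tens_linl _)) scaleNr.
- by move=> w; apply: (linear_compose (tens_linl _) (@qim_linear k Q)).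
by move=> v; apply: (linear_compose (@tens_linr _ _ _ _) (@H3_iota_linear k C n)).
Qed.

Hypotheses
  (Phi_Dtri : forall i (d : {ffun 'I_3 -> 'End(S)}),
     tri i d -> is_Dtri d (Phi (gtri' (S1 k) d)))
  (Phi_homog : forall i (d : {ffun 'I_3 -> 'End(S)}),
     tri i d -> end_homog i (Phi (gtri' (S1 k) d)))
  (Phi_comm : forall i j (d d' : {ffun 'I_3 -> 'End(S)}), tri i d -> tri j d' ->
     Phi (gtri' (S1 k) [ffun n => supercomm (d n) (d' n)]) =
     supercomm (Phi (gtri' (S1 k) d)) (Phi (gtri' (S1 k) d')))
  (Phi_Dder : forall i j (d : {ffun 'I_3 -> 'End(S)}) n (x : C),
     tri i d -> x \in spart C j ->
     Dder n (d n x) = supercomm (Phi (gtri' (S1 k) d)) (Dder n x))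
  (Dder_prod : forall i j n (x y : C), x \in spart C i -> y \in spart C j ->
     Dder (n + 2%:R) (amul (x : S) y) = supercomm (Dder n x) (Dder (n + 1) y))
  (Phi_theta : forall i j (n : 'I_3) (x y : C),
     x \in spart C i -> y \in spart C j ->
     Phi (gtri' (S1 k) (iter n (@theta k S) (ttri (x : S) y))) =
     2%:R^-1 *: supercomm (Dder n x) (Dder n y)).

Local Notation Phi3 := Phi3_fun.
Let JA : superalgebra_axiom J := H3_alg C.

Let compat (u v : G) := Phi3 (gbr u v) = tbr (Phi3 u) (Phi3 v).

Let b0l z : b 0 z = 0. Proof. exact: (linear_zero (W := k^o) (@qpolar_linearl k Q z)). Qed.
Let b0r z : b z 0 = 0. Proof. exact: (linear_zero (W := k^o) (@qpolar_linearr k Q z)). Qed.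
Let bZl c y z : b (c *: y) z = c * b y z.
Proof. exact: (linear_scale (W := k^o) _ _ (@qpolar_linearl k Q z)). Qed.
Let bZr c y z : b y (c *: z) = c * b y z.
Proof. exact: (linear_scale (W := k^o) _ _ (@qpolar_linearr k Q y)). Qed.
Let bNl y z : b (- y) z = - b y z.
Proof. exact: (linear_opp (W := k^o) _ (@qpolar_linearl k Q z)). Qed.
Let h0 i : end_homog i (0 : 'End(J)) := end_homog0 i.
Let j0 i : (0 : J) \in spart J i := mem0v _.
Let sc0l (f : 'End(J)) : supercomm 0 f = 0.
Proof. exact: (linear_zero (supercomm_linl _)). Qed.
Let Phi30 : Phi3 0 = 0. Proof. exact: linear_zero Phi3_fun_linear. Qed.

Let pair0 : ((0 : tensor Q J), (0 : 'End(J))) = 0 :> tspace Q J. Proof. by []. Qed.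

(** Puts the value of the extension at an element of tri(S) in the form to
    which the formula for brackets of pure tensors applies. *)
Let tens_00 (f : 'End(J)) : ((0 : tensor Q J), f) = (tens (0 : Q) (0 : J), f) :> tspace Q J.
Proof. by rewrite tens0l. Qed.

Lemma compat_qtri_qtri m l a a' : a \in Q0 Q -> a' \in Q0 Q ->
  compat (gtri S (qtri m a)) (gtri S (qtri l a')).
Proof.
move=> a0 a'0; rewrite /compat !Phi3_qtri //.
rewrite (gbr_tri_tri SA SB (qtri_tri k_char m a0) (qtri_tri k_char l a'0)).
rewrite (tbr_pure JA _ _ (H3_e_even C m) (H3_e_even C l) (h0 false) (h0 false)).
rewrite (_ : [ffun n => _] = if m == l then qtri m (tcommQ a a') else 0); last first.
  by apply/ffunP => n; rewrite ffunE (qtri_comm k_char).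
rewrite !zero_lfunE !tens0r scaler0 subr0 addr0 (supercomm_e_e C k_char) scaler0 sc0l subr0.
rewrite (H3_ee C k_char); case: eqP => [->|_]; first by rewrite Phi3_qtri // tcommQ_mem.
by rewrite tens0r pair0 -/(0 : G) Phi30.
Qed.

Lemma compat_qtri_tri' m a i d : a \in Q0 Q -> tri i d ->
  compat (gtri S (qtri m a)) (gtri' (Qbar Q) d).
Proof.
move=> a0 di; rewrite /compat Phi3_qtri // Phi3_tri' tens_00.
rewrite (gbr_tri_tri' QA QB SA SB (qtri_tri k_char m a0) di).
rewrite (tbr_pure JA _ _ (H3_e_even C m) (j0 i) (h0 false) (Phi_homog di)).
rewrite (Phi_Dtri di).1 (linear_zero (@H3_linr k C _)) !tens0r tens0l scaler0 subr0 addr0.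
by rewrite b0r mulr0 scale0r sc0l subr0 pair0.
Qed.

Lemma compat_tri'_tri' i j d d' : tri i d -> tri j d' ->
  compat (gtri' (Qbar Q) d) (gtri' (Qbar Q) d').
Proof.
move=> di dj; rewrite /compat !Phi3_tri' !tens_00.
rewrite (gbr_tri'_tri' QA QB di dj) Phi3_tri' (Phi_comm di dj).
rewrite (tbr_pure JA _ _ (j0 i) (j0 j) (Phi_homog di) (Phi_homog dj)).
rewrite (linear_zero (@H3_linr k C _)) tens0r !tens0l scaler0 subr0 addr0.
by rewrite b0r mulr0 scale0r subr0.
Qed.

Lemma compat_tri'_iota i j d n q x : tri i d -> x \in spart C j ->
  compat (gtri' (Qbar Q) d) (giota n (tens (q : Qbar Q) (x : S))).
Proof.
move=> di xj; rewrite /compat Phi3_tri' tens_00 Phi3_iota.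
rewrite (gbr_tri'_iota QA QB SA SB n di (oQ q) xj) Phi3_iota.
rewrite (tbr_pure JA _ _ (j0 i) (H3_iota_mem n xj) (Phi_homog di)
  (end_homog_scale _ (Dder_homog n xj))).
rewrite (Phi_Dtri di).2 (linear_zero (H3_linl _)) tens0r add0r tens0l scaler0 subr0.
rewrite b0l mulr0 scale0r subr0 (Phi_Dder _ di xj).
congr (_, _); exact: esym (linear_scale _ _ (supercomm_linr _)).
Qed.

(** The position of n relative to m selects 0, L_a or -R_a in K_m(a), and
    correspondingly D_n(x) sends e_m to 0 or to half of iota_n(x) up to sign.
    The trace zero part of a q or q a accounts for the component in Q0 (x) J,
    and its trace for the multiple of D_n(x). *)
Lemma compat_qtri_iota m a i n q x : a \in Q0 Q -> x \in spart C i ->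
  compat (gtri S (qtri m a)) (giota n (tens (q : Qbar Q) (x : S))).
Proof.
move=> a0 xi; rewrite /compat Phi3_qtri // Phi3_iota.
have a1 : b a one = 0 by apply/Q0P.
rewrite (gbr_tri_iota QA QB SA SB n (qtri_tri k_char m a0) (oQ q) xi) Phi3_iota.
rewrite (tbr_pure JA _ _ (H3_e_even C m) (H3_iota_mem n xi) (h0 false)
  (end_homog_scale _ (Dder_homog n xi))).
rewrite zero_lfunE tens0r addr0 expr0 scale1r sc0l sub0r bZr.
rewrite scale_lfunE (H3_e_iota _ _ xi); move: m; apply: (@ord3_ind n).
- rewrite eqxx qtri0 zero_lfunE (Dder_e0 k_char _ xi) (supercomm_e_iota0 k_char _ xi).
  rewrite b0l (linear_zero (@qim_linear k Q)) !scaler0 !tens0r tens0l oppr0 mulr0.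
  by rewrite scale0r addr0 oppr0.
- have -> : qtri (n + 1) a n = qleft a by rewrite -{2}(ord3_12 n) qtri2.
  rewrite ord3_neq qleftE (Dder_e1 k_char _ xi).
  rewrite (supercomm_e_iota1 k_char _ xi) (qim_mul k_char) (qpolar_mul1 k_char) a1.
  rewrite (qim_id a0) scale0r addr0 mul0r mulr0 sub0r.
  congr (_, _).
    rewrite scalerA -!tensZ (linear_scale _ _ (@tcommQ_linr k Q a)).
    rewrite -(linear_sub _ _ (tens_linl _)); congr (tens _ _).
    move: (tcommQ _ _) => T; rewrite !scalerDr !scalerA -scaleNr; congr (_ *: _ + _ *: _); field; exact: two0.
  rewrite scalerN opprK [RHS]scalerA; apply: (congr1 (fun c => c *: Dder n x)); field; exact: two0.
- have -> : qtri (n + 2%:R) a n = - qright a by rewrite -{2}(ord3_21 n) qtri1.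
  rewrite ord3_neq opp_lfunE qrightE (Dder_e2 k_char _ xi).
  rewrite (supercomm_e_iota2 k_char _ xi) (linear_opp _ (@qim_linear k Q)).
  rewrite bNl (qim_mul k_char) (qpolar_mul1 k_char) a1.
  rewrite (qim_id a0) scale0r addr0 mulr0 mulr0 sub0r opprK.
  have -> : tcommQ (qim q) a = - tcommQ a (qim q) by rewrite opprB.
  congr (_, _).
    rewrite !scalerN [- 2%:R^-1 *: (2%:R^-1 *: _)]scaleNr opprK.
    rewrite (linear_opp _ (@tens_linr _ _ _ _)) opprK scalerA -!tensZ.
    rewrite (linear_scale _ _ (@tcommQ_linr k Q a)) -(linear_add (tens_linl _)).
    congr (tens _ _); move: (tcommQ _ _) => T.
    rewrite !scalerDr !scalerN !scalerA -!scaleNr; congr (_ *: _ + _ *: _); field; exact: two0.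
  rewrite -scaleNr [RHS]scalerA [b (qim q) a]qpolarC.
  apply: (congr1 (fun c => c *: Dder n x)); field; exact: two0.
Qed.

(** All products of J and End(J) that occur are named, so that what remains to
    be compared are linear combinations of fixed tensors and operators. *)
Let tbr_val i j (p q : Q) (x y z z1 z2 : J) (d d' f g : 'End(J)) :
  x \in spart J i -> y \in spart J j -> end_homog i d -> end_homog j d' ->
  amul x y = z -> d y = z1 -> d' x = z2 -> supercomm d d' = f ->
  supercomm (L x) (L y) = g ->
  tbr (tens p x, d) (tens q y, d') =
  (tens (tcommQ p q) z + tens q z1 - (-1) ^+ (i * j) *: tens p z2,
   f - (2%:R * b p q) *: g).
Proof. by move=> xi yj di dj <- <- <- <- <-; apply: tbr_pure. Qed.

Let supercommZ c c' (f g : 'End(J)) :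
  supercomm (c *: f) (c' *: g) = (c * c') *: supercomm f g.
Proof.
rewrite (linear_scale _ _ (supercomm_linl _)) (linear_scale _ _ (supercomm_linr _)).
by rewrite scalerA.
Qed.

(** Both terms come from a single identity for the products p qbar and pbar q:
    their trace is b(p,q), and their trace zero parts are the commutator of
    im p and im q up to multiples of im p and im q, which is what the action
    of D_n(x) and D_n(y) contributes. *)
Lemma tbr_iota_same n i j p q (x y : C) : x \in spart C i -> y \in spart C j ->
  tbr (Phi3 (giota n (tens (p : Qbar Q) (x : S)))) (Phi3 (giota n (tens (q : Qbar Q) (y : S)))) =
  (cb x y *: (- tens (qim (qmul p (qbar q))) (e (n + 1))
     - tens (qim (qmul (qbar p) q)) (e (n + 2%:R))),
   (2%:R^-1 * b p q) *: supercomm (Dder n x) (Dder n y)).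
Proof.
move=> xi yj; rewrite !Phi3_iota.
have hx := end_homog_scale (2%:R^-1 * b p one) (Dder_homog n xi).
have hy := end_homog_scale (2%:R^-1 * b q one) (Dder_homog n yj).
have yx : cb y x = (-1) ^+ (i * j) * cb x y :> k.
  by rewrite mulnC; case: (hurwitz_form C) => _ _ bC _ _; apply: bC.
have v1 : ((2%:R^-1 * b p one) *: Dder n x) (io n y) = (b p one * cb x y) *: (e (n + 2%:R) - e (n + 1)).
  rewrite scale_lfunE (Dder_i0 k_char _ xi yj) scalerA; congr (_ *: _).
  by field; exact: two0.
have v2 : ((2%:R^-1 * b q one) *: Dder n y) (io n x) =
    ((-1) ^+ (i * j) * (b q one * cb x y)) *: (e (n + 2%:R) - e (n + 1)).
  rewrite scale_lfunE (Dder_i0 k_char _ yj xi) yx scalerA; congr (_ *: _).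
  by field; exact: two0.
have sc : supercomm (L (io n x)) (L (io n y)) = - supercomm (Dder n x) (Dder n y).
  by rewrite (Dder_comm_same k_char n xi yj) opprK.
rewrite (tbr_val _ _ (H3_iota_mem n xi) (H3_iota_mem n yj) hx hy
  (H3_iota_same k_char n xi yj) v1 v2 (supercommZ _ _ _ _) sc).
move: (supercomm _ _) => D; congr (_, _); last first.
  rewrite bZl bZr scalerN opprK -scalerDl (qpolar_qim k_char p q).
  by congr (_ *: _); field; exact: two0.
have -> : qim (qmul p (qbar q)) = 2%:R^-1 *: (- tcommQ (qim p) (qim q) - b p one *: qim q + b q one *: qim p).
  rewrite (qim_mul k_char) (qbar_polar1) (qim_bar k_char) scalerN.
  by rewrite (linear_opp _ (@tcommQ_linr k Q _)).
have -> : qim (qmul (qbar p) q) = 2%:R^-1 *: (- tcommQ (qim p) (qim q) + b p one *: qim q - b q one *: qim p).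
  rewrite (qim_mul k_char) (qbar_polar1) (qim_bar k_char) scalerN.
  by rewrite (linear_opp _ (@tcommQ_linl k Q _)).
rewrite (linear_scale _ _ (@tcommQ_linr k Q _)) (linear_scale _ _ (@tcommQ_linl k Q _)).
rewrite [tens (_ *: qim p) _](linear_scale _ _ (@tens_linr _ _ _ _)).
rewrite [(-1) ^+ _ *: (_ *: _)]scalerA mulrA -expr2 sqrr_sign mul1r.
set T := tcommQ _ _; set e1 := H3_e C (n + 1); set e2 := H3_e C (n + 2%:R).
apply: tensor_eqP => f g F /scalar_expand fE /scalar_expand gE /scalar_expand FE Ft.
rewrite !(FE, Ft) !(fE, gE).
field; exact: two0.
Qed.

Lemma compat_iota_same n i j p q x y : x \in spart C i -> y \in spart C j ->
  compat (giota n (tens (p : Qbar Q) (x : S))) (giota n (tens (q : Qbar Q) (y : S))).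
Proof.
move=> xi yj; rewrite /compat (tbr_iota_same _ _ _ xi yj).
rewrite (gbr_iota_same QA QB SA SB n (oQ p) (oQ q) xi yj).
rewrite (linear_add Phi3_fun_linear).
have fl : linear (fun d => Phi3 (gtri S d)).
  exact: linear_compose Phi3_fun_linear (@gtri_linear _ _ _).
have fl' : linear (fun d => Phi3 (gtri' (Qbar Q) d)).
  exact: linear_compose Phi3_fun_linear (@gtri'_linear _ _ _).
have th := @iter_theta_linear k (Qbar Q) n.
rewrite (ttri_Qbar k_char) (linear_sub _ _ th) (linear_opp _ th) !iter_theta_qtri ![_ + n]addrC.
rewrite [Phi3 (gtri _ _)](linear_scale _ _ fl) [Phi3 (gtri' _ _)](linear_scale _ _ fl').
rewrite [Phi3 (gtri _ _)](linear_sub _ _ fl) [Phi3 (gtri _ (- _))](linear_opp _ fl).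
rewrite Phi3_tri' (Phi_theta _ xi yj) !Phi3_qtri ?qim_mem //.
congr (_, _); rewrite /=.
  by rewrite scaler0 addr0.
by rewrite oppr0 addr0 scaler0 add0r scalerA mulrC.
Qed.

(** The trace and the trace zero part of the conjugate of p q give the two
    components. *)
Lemma compat_iota_next n i j p q x y : x \in spart C i -> y \in spart C j ->
  compat (giota n (tens (p : Qbar Q) (x : S))) (giota (n + 1) (tens (q : Qbar Q) (y : S))).
Proof.
move=> xi yj; rewrite /compat (gbr_iota_next QA QB SA SB n (oQ p) (oQ q) xi yj) !Phi3_iota.
have -> : amul (p : Qbar Q) q = qbar (qmul p q) by [].
have hx := end_homog_scale (2%:R^-1 * b p one) (Dder_homog n xi).
have hy := end_homog_scale (2%:R^-1 * b q one) (Dder_homog (n + 1) yj).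
set z := H3_iota (n + 2%:R) (amul (x : S) y).
have v1 : ((2%:R^-1 * b p one) *: Dder n x) (io (n + 1) y) = - ((2%:R^-1 * b p one) *: z).
  by rewrite scale_lfunE (Dder_i1 k_char _ xi yj) scalerN.
have v2 : ((2%:R^-1 * b q one) *: Dder (n + 1) y) (io n x) =
    (-1) ^+ (i * j) *: ((2%:R^-1 * b q one) *: z).
  have := Dder_i2 k_char (n + 1) yj xi; rewrite !ord3D => H.
  by rewrite scale_lfunE H !scalerA mulrC [(j * i)%N]mulnC.
have sc : supercomm (L (io n x)) (L (io (n + 1) y)) = Dder (n + 2%:R) (amul (x : S) y).
  by rewrite (Dder_prod _ xi yj) (Dder_comm_next k_char n xi yj).
have sc' : supercomm ((2%:R^-1 * b p one) *: Dder n x) ((2%:R^-1 * b q one) *: Dder (n + 1) y)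
    = (2%:R^-1 * b p one * (2%:R^-1 * b q one)) *: Dder (n + 2%:R) (amul (x : S) y).
  by rewrite supercommZ (Dder_prod _ xi yj).
rewrite (tbr_val _ _ (H3_iota_mem n xi) (H3_iota_mem _ yj) hx hy
  (H3_iota_next k_char n xi yj) v1 v2 sc' sc) -/z.
move: (Dder _ _) => D; rewrite bZl bZr; congr (_, _); last first.
  rewrite -scalerBl; congr (_ *: _).
  rewrite qbar_polar1 (qpolar_mul1 k_char).
  by field; exact: two0.
rewrite (qim_bar k_char) (qim_mul k_char).
rewrite (linear_scale _ _ (@tcommQ_linr k Q _)) (linear_scale _ _ (@tcommQ_linl k Q _)).
move: z {v1 v2} => z; set T := tcommQ _ _.
rewrite [tens (_ *: qim p) ((-1) ^+ _ *: _)](linear_scale _ _ (@tens_linr _ _ _ _)).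
rewrite [(-1) ^+ _ *: (_ *: _)]scalerA -expr2 sqrr_sign scale1r.
apply: tensor_eqP => f g F /scalar_expand fE /scalar_expand gE /scalar_expand FE Ft.
rewrite !(FE, Ft) !(fE, gE).
field; exact: two0.
Qed.

(** Both brackets can be computed on these elements, and they generate the
    homogeneous parts of g(Qbar,S) additively ([gpart_gen_ind]). *)
Inductive gen : bool -> G -> Prop :=
| gen_qtri m a of a \in Q0 Q : gen false (gtri S (qtri m a))
| gen_tri' i (d : {ffun 'I_3 -> 'End(S)}) of tri i d : gen i (gtri' (Qbar Q) d)
| gen_iota i n (q : Qbar Q) (x : S) of x \in spart S i :
    gen i (giota n (tens q x)).

Lemma gen_gpart i u : gen i u -> gpart i u.
Proof.
case=> {i u} [m a a0|i d di|i n q x xi].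
- exact (gpart_tri SA SB (qtri_tri k_char m a0)).
- exact (gpart_tri' QA QB di).
- exact (gpart_iota QA QB SA SB n (oQ q) xi).
Qed.

Lemma gpart_gen_ind i (P : G -> Prop) :
  (forall u v, P u -> P v -> P (u + v)) -> (forall u, gen i u -> P u) ->
  forall u, gpart i u -> P u.
Proof.
move=> PD Pg u [d0 d1 X2].
have P0 : P 0.
  have <- : giota 0 (tens (0 : Qbar Q) (0 : S)) = 0 :> G.
    by rewrite tens0l (linear_zero (giota_linear _)).
  by apply/Pg/gen_iota/mem0v.
rewrite (gspace_decomp u); apply: (PD); first apply: (PD).
- case: i d0 Pg {d1 X2} => [/tri_Qbar_odd ->|/(tri_Qbar_even k_char)[a a0 ->]] Pg //.
  rewrite (linear_bigsum _ _ _ (@gtri_linear _ _ _)); apply: big_ind => // m _.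
  by apply: Pg; apply: gen_qtri.
- exact: Pg (gen_tri' d1).
apply: big_ind => // n _; move: (u.2 n) (X2 n).
apply: tens_part_ind => [X Y PX PY|j x y xj yj].
  by rewrite (linear_add (giota_linear n)); apply: PD.
case: j xj yj => [/even_part_odd -> _|_]; last first.
  by rewrite addbF => yi; apply/Pg/gen_iota.
by rewrite tens0l (linear_zero (giota_linear n)).
Qed.

Lemma gen_pure i u : gen i u -> exists a x d,
  [/\ x \in spart J i, end_homog i d & Phi3 u = (tens a x, d)].
Proof.
case=> {i u} [m a a0|i d di|i n q x xi].
- by exists a, (e m), 0; split; [exact: H3_e_even|exact: h0|exact: Phi3_qtri].
- exists 0, 0, (Phi (gtri' (S1 k) d)); split; [exact: j0|exact: Phi_homog|].
  by rewrite Phi3_tri' tens_00.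
exists (- 2%:R^-1 *: qim q), (io n x), ((2%:R^-1 * b q one) *: Dder n x).
split; [exact: H3_iota_mem|exact: end_homog_scale (Dder_homog n xi)|].
exact: Phi3_iota.
Qed.

(** Both brackets are antisymmetric on these pairs. *)
Lemma compatC i j u v : gen i u -> gen j v ->
  gbr_diag u v = 0 -> gbr_diag v u = 0 -> compat u v -> compat v u.
Proof.
move=> ui vj uv vu H; rewrite /compat (gbrC_off_diag (gen_gpart ui) (gen_gpart vj) uv vu).
rewrite (linear_opp _ Phi3_fun_linear) (linear_scale _ _ Phi3_fun_linear) H.
have [a [x [d [xi di ->]]]] := gen_pure ui.
have [a' [y [d' [yj dj ->]]]] := gen_pure vj.
by rewrite (tbr_pureC JA a a' xi yj di dj (H3_mulC xi yj)).
Qed.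

Lemma compat_gen i j u v : gen i u -> gen j v -> compat u v.
Proof.
move=> ui vj; case: (ui) => {i u ui} [m a a0|i d di|i n q x xi];
  case: (vj) => {j v vj} [l a' a'0|j d' dj|j r q' y yj].
- exact: compat_qtri_qtri.
- exact: compat_qtri_tri' dj.
- exact: compat_qtri_iota yj.
- apply: (compatC (gen_qtri l a'0) (gen_tri' di)); last exact: compat_qtri_tri' di.
    by apply: gbr_diag_eq0; [right|left|left]; rewrite ?ffunE.
  by apply: gbr_diag_eq0; [left|right|left]; rewrite ?ffunE.
- exact: compat_tri'_tri' di dj.
- exact: compat_tri'_iota di yj.
- apply: (compatC (gen_qtri l a'0) (gen_iota n q xi)); last exact: compat_qtri_iota xi.
    by apply: gbr_diag_eq0; [right|left|left; rewrite ffunE].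
  by apply: gbr_diag_eq0; [left|right|right; rewrite ffunE].
- apply: (compatC (gen_tri' dj) (gen_iota n q xi)); last exact: compat_tri'_iota dj xi.
    by apply: gbr_diag_eq0; [left|right|left; rewrite ffunE].
  by apply: gbr_diag_eq0; [right|left|right; rewrite ffunE].
have dg l l' X Y : l != l' -> gbr_diag (giota l X : G) (giota l' Y) = 0.
  move=> ll'; apply: gbr_diag_eq0; [by left|by left|move=> t].
  rewrite !giotaE; case: eqP => [->|_]; last by left.
  by rewrite (negPf ll'); right.
move: r; apply: (@ord3_ind n).
- exact: compat_iota_same xi yj.
- exact: compat_iota_next xi yj.
have := compat_iota_next (n + 2%:R) q' q yj xi; rewrite ord3_21.
by apply: (compatC (gen_iota _ q' yj) (gen_iota n q xi)); apply: dg; rewrite ord3_neq.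
Qed.

Let compatDl u u' v : compat u v -> compat u' v -> compat (u + u') v.
Proof.
have DP := linear_add Phi3_fun_linear; rewrite /compat => H H'.
rewrite (gbr_addl u u' v) (DP (gbr u v) (gbr u' v)) (DP u u').
exact: etrans (congr2 +%R H H') (esym (tbr_addl (Phi3 u) (Phi3 u') (Phi3 v))).
Qed.

Let compatDr u v v' : compat u v -> compat u v' -> compat u (v + v').
Proof.
have DP := linear_add Phi3_fun_linear; rewrite /compat => H H'.
rewrite (gbr_addr u v v') (DP (gbr u v) (gbr u v')) (DP v v').
exact: etrans (congr2 +%R H H') (esym (tbr_addr (Phi3 u) (Phi3 v) (Phi3 v'))).
Qed.

Lemma compat_gpart i j u v : gpart i u -> gpart j v -> compat u v.
Proof.
move=> ui vj; move: u ui.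
apply: gpart_gen_ind => [u u' Hu Hu'|u ug]; first exact: compatDl.
move: v vj; apply: gpart_gen_ind => [v v' Hv Hv'|v vg]; first exact: compatDr.
exact: compat_gen ug vg.
Qed.

Lemma compat_lmem (u v : lie_g (Qbar Q) S) : lmem u -> lmem v -> compat u v.
Proof.
move=> [u0 [u1 [u0e u1o ->]]] [v0 [v1 [v0e v1o ->]]].
apply: compatDl; apply: compatDr.
- exact (compat_gpart u0e v0e).
- exact (compat_gpart u0e v1o).
- exact (compat_gpart u1o v0e).
- exact (compat_gpart u1o v1o).
Qed.

(** * Bijectivity of the extension *)

Hypotheses
  (Phi_part : forall i (u : G1), gpart i u -> der_part i (Phi u))
  (Phi_onto : forall i D, der_part i D -> exists2 u : G1, gpart i u & Phi u = D)
  (Phi_inj : forall u v : lie_g (S1 k) S, lmem u -> lmem v -> Phi u = Phi v -> u = v).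

Lemma der_part_lin (H : superalgebra k) i c (d d' : 'End(H)) :
  superalgebra_axiom H -> der_part i d -> der_part i d' -> der_part i (c *: d + d').
Proof.
move=> [ml mr _] [dh dm] [dh' dm']; split.
  by apply: end_homog_add => //; apply: end_homog_scale.
move=> j l x y xj yl; rewrite !add_lfunE !scale_lfunE (dm _ _ _ _ xj yl) (dm' _ _ _ _ xj yl).
rewrite ml mr !scalerDr !scalerA -!addrA; congr (_ + _).
rewrite addrCA; congr (_ + _); by rewrite mulrC.
Qed.

Lemma der_part0 (H : superalgebra k) i : superalgebra_axiom H -> der_part i (0 : 'End(H)).
Proof.
move=> [ml mr _]; split=> [|j l x y _ _]; first exact: end_homog0.
by rewrite !zero_lfunE (linear_zero (ml _)) (linear_zero (mr _)) scaler0 addr0.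
Qed.

Lemma tri_add (T : normed_superalgebra k) i (d d' : {ffun 'I_3 -> 'End(T)}) :
  superalgebra_axiom T -> quadratic_superform_axiom (@cq k T) (@cb k T) ->
  tri i d -> tri i d' -> tri i (d + d').
Proof.
move=> [ml mr _] [[bl br] _ _ _ _] [ho dm] [ho' dm']; split=> [n|j l x y xj yl].
  rewrite ffunE; have [h s] := ho n; have [h' s'] := ho' n.
  split=> [|j l x y xj yl]; first exact: end_homog_add.
  rewrite !add_lfunE (linear_add (W := k^o) (bl y)) (linear_add (W := k^o) (br x)).
  by rewrite mulrDr addrACA (s _ _ _ _ xj yl) (s' _ _ _ _ xj yl) addr0.
rewrite !ffunE !add_lfunE (dm _ _ _ _ xj yl) (dm' _ _ _ _ xj yl).
by rewrite (linear_add (ml y)) (linear_add (mr x)) scalerDr addrACA.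
Qed.

Lemma gpart_add (T : normed_superalgebra k) i (u v : gspace T S) :
  superalgebra_axiom T -> quadratic_superform_axiom (@cq k T) (@cb k T) ->
  gpart i u -> gpart i v -> gpart i (u + v).
Proof.
move=> TA TB [u0 u1 u2] [v0 v1 v2]; split; [exact: tri_add|exact: tri_add|].
by move=> n; rewrite ffunE memvD.
Qed.

Lemma Phi3_part i (u : G) : gpart i u -> tpart i (Phi3 u).
Proof.
have DP := linear_add Phi3_fun_linear.
move: u; apply: gpart_gen_ind => [u v [u1 u2] [v1 v2]|u].
  rewrite (DP u v); split; first exact: memvD.
  have := der_part_lin 1 JA u2 v2; rewrite scale1r; exact.
case=> {i u} [m a a0|i d di|i n q x xi].
- rewrite Phi3_qtri //; split; [exact (tens_mem a0 (H3_e_even C m))|exact (der_part0 _ JA)].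
- rewrite Phi3_tri'; split; first exact: mem0v.
  exact (Phi_part (gpart_tri' (S1_alg k) (S1_form k) di)).
rewrite Phi3_iota; split.
  apply: (tens_mem _ (H3_iota_mem n xi)); apply: memvZ; exact: qim_mem.
rewrite /= -[_ *: _]addr0; apply: (der_part_lin _ JA _ (der_part0 _ JA)).
rewrite -Phi_iota; apply: Phi_part.
exact (gpart_iota (S1_alg k) (S1_form k) SA SB n (memvf (1 : k^o)) xi).
Qed.

(** On q = c1 the trace zero part vanishes and b(q,1)/2 = c, so that [gproj] is
    a left inverse of the inclusion and the component in Q0 (x) J is 0. *)
Lemma Phi3_gincl (u : G1) : u.1.1 = 0 -> Phi3 (gincl Q u) = (0, Phi u).
Proof.
have DP := linear_add Phi3_fun_linear.
move=> u0; rewrite [in RHS](gspace_decomp u) u0 [gtri _ 0]/= -/(0 : G1) add0r.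
rewrite (linear_add Phi_linear) (linear_bigsum _ _ _ Phi_linear).
rewrite /gincl (DP (gtri' _ _)) Phi3_tri' (linear_bigsum _ _ _ Phi3_fun_linear).
have E n X : Phi3 (giota (S := Qbar Q) n
    (tlift (fun (c : k^o) (x : S) => tens ((c : k) *: one) x) X)) =
      (0, Phi (giota (S := S1 k) (S' := S) n X)).
  move: X; apply: tensor_ind => [X Y HX HY|c x].
    rewrite (linear_add (tlift_linear _)) !(linear_add (giota_linear n)) DP HX HY.
    by rewrite (linear_add Phi_linear); congr (_, _); rewrite addr0.
  rewrite tlift_tens; first last.
  - by move=> v; apply: tens_linr.
  - move=> w; apply: (linear_compose (tens_linl w)) => a x' y'.
    by rewrite -[a *: x' + y']/(a * x' + y' : k) scalerDl scalerA.
  rewrite Phi3_iota (linear_scale _ _ (@qim_linear k Q)) (qim_one Q k_char) !scaler0 tens0l.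
  have -> : tens (c : k^o) x = (c : k) *: tens (1 : k^o) x.
    by rewrite -(linear_scale _ _ (tens_linl _)); congr (tens _ _); apply/esym/mulr1.
  rewrite (linear_scale _ _ (giota_linear n)) (linear_scale _ _ Phi_linear) Phi_iota.
  rewrite bZl qpolar1; congr (_, _ *: _); field; exact: two0.
under eq_bigr => n _ do rewrite E.
have ql : linear (fun D : 'End(J) => ((0, D) : tspace Q J)).
  by move=> c D D'; congr (_, _); rewrite /= scaler0 addr0.
by rewrite -(linear_bigsum _ _ _ ql) -(linear_add ql).
Qed.

Lemma gincl_part i (u : G1) : gpart i u -> gpart i (gincl Q u).
Proof.
move=> [_ u1 u2]; apply: gpart_add => //; first exact (gpart_tri' QA QB u1).
apply: big_ind => [|x y|n _]; first exact (gpart0 C i QA QB).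
  exact: gpart_add.
split=> [||m]; [exact: tri0|exact: tri0|rewrite giotaE].
case: eqP => _; last exact: mem0v.
move: (u.2 n) (u2 n); apply: tens_part_ind => [X Y HX HY|j c x cj xj].
  by rewrite (linear_add (tlift_linear _)) memvD.
rewrite tlift_tens; first last.
- by move=> v; apply: tens_linr.
- move=> w; apply: (linear_compose (tens_linl w)) => a x' y'.
  by rewrite -[a *: x' + y']/(a * x' + y' : k) scalerDl scalerA.
case: j cj xj => [/even_part_odd ->|_] xj; first by rewrite scale0r tens0l mem0v.
by rewrite -[i]addbF; apply: tens_part_mem; [exact: oQ|rewrite addbF in xj].
Qed.

(** The preimages of a (x) e_n and a (x) iota_n(x) are K_n(a) and
    -2 iota_n(a (x) x), and der J is reached from g(S1,S). *)
Lemma Phi3_onto i (w : tspace Q J) : tpart i w -> exists2 u : G, gpart i u & Phi3 u = w.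
Proof.
have DP := linear_add Phi3_fun_linear.
pose R w := exists2 u : G, gpart i u & Phi3 u = w.
have RD w1 w2 : R w1 -> R w2 -> R (w1 + w2).
  move=> [u1 p1 <-] [u2 p2 <-]; exists (u1 + u2); last exact: DP.
  exact: gpart_add.
have R0 : R 0 by exists 0; [exact (gpart0 C i QA QB)|exact: Phi30].
move=> [w1 w2]; have -> : w = (w.1, 0) + (0, w.2).
  by case: w {w1 w2} => X D; congr (_, _); rewrite /= ?addr0 ?add0r.
apply: (RD); last first.
  have [u up <-] := Phi_onto w2; exists (gincl Q u); first exact: gincl_part.
  by apply: Phi3_gincl; case: up => /(tri_S1 k_char).
move: (w.1) w1; apply: tensv_ind => [X Y RX RY|a y a0 yi].
  have -> : ((X + Y, 0) : tspace Q J) = (X, 0) + (Y, 0) by congr (_, _); rewrite /= addr0.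
  exact: (RD).
have tl : linear (fun z : J => ((tens a z, 0) : tspace Q J)).
  by move=> c z z'; rewrite tens_linr; congr (_, _); rewrite /= scaler0 addr0.
rewrite (H3_decomp k_char yi) (linear_bigsum _ _ _ tl); apply: big_ind => // n _.
move/H3_partP: yi => yi; rewrite (linear_add tl); apply: (RD).
  have oddc : i -> cb (vsval y (n, n)) (hone C) = 0.
    by move=> it; apply: (cb_diff (yi (n, n)) (hone_even C)); rewrite it.
  have [ci|ci] := boolP i; first by rewrite oddc // mulr0 scale0r tens0r.
  rewrite -tensZ; have c0 : (2%:R^-1 * cb (vsval y (n, n)) (hone C)) *: a \in Q0 Q by apply: memvZ.
  exists (gtri S (qtri n ((2%:R^-1 * cb (vsval y (n, n)) (hone C)) *: a))).
    rewrite (negPf ci); exact (gpart_tri SA SB (qtri_tri k_char n c0)).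
  exact: Phi3_qtri.
have xi : 2%:R^-1 *: vsval y (n + 2%:R, n + 1) \in spart C i by apply: memvZ.
exists (giota n (tens (- 2%:R *: a : Qbar Q) (2%:R^-1 *: vsval y (n + 2%:R, n + 1) : S))).
  exact (gpart_iota QA QB SA SB n (oQ _) xi).
rewrite Phi3_iota (linear_scale _ _ (@qim_linear k Q)) (qim_id a0) scalerA.
have a1 : b a one = 0 by apply/Q0P.
rewrite bZl a1 !mulr0 scale0r mulrNN mulVf // scale1r //.
Qed.

Lemma contract_Phi3 f (u : G) : scalar f -> contract f (Phi3 u).1 =
  \sum_m f (lam (u.1.1 (m + 2%:R))) *: e m +
  \sum_n io n (- 2%:R^-1 *: tlift (fun (q : Q) (x : C) => f (qim q) *: x) (u.2 n)).
Proof.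
move=> fl; have cl : linear (@contract k Q J f) := tlift_linear _.
rewrite /Phi3 [(_, _).1]/= (linear_sub _ _ cl) (linear_scale _ _ cl).
rewrite !(linear_bigsum _ _ _ cl) -scaleNr scaler_sumr; congr (_ + _).
  by apply: eq_bigr => m _; rewrite contract_tens.
apply: eq_bigr => n _; rewrite (tlift_comp _ _ cl) (linear_scale _ _ (@H3_iota_linear k C n)).
rewrite (tlift_comp _ _ (@H3_iota_linear k C n)); congr (_ *: _); apply: eq_tlift => q x.
by rewrite contract_tens // (linear_scale _ _ (@H3_iota_linear k C n)).
Qed.

Lemma contract_gproj (u : G) n : contract (fun c : k^o => c : k) ((gproj u).2 n) =
  tlift (fun (q : Q) (x : C) => (2%:R^-1 * b q one) *: x) (u.2 n).
Proof.
have -> : (gproj u).2 n = tlift (fun (q : Q) (x : C) => tens (2%:R^-1 * b q one : k^o) (x : S)) (u.2 n).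
  rewrite /gproj (ord3_sum n) /= !ffunE !ord3_neq eqxx !addr0 add0r //.
have cl : linear (@contract k k^o S (fun c => c)) := tlift_linear _.
by rewrite (tlift_comp _ _ cl); apply: eq_tlift => q x; rewrite contract_tens.
Qed.

Lemma gproj_part i (u : G) : gpart i u -> gpart i (gproj u).
Proof.
move=> [_ u1 u2]; apply: gpart_add => //; [exact: S1_alg|exact: S1_form|exact (gpart_tri' (S1_alg k) (S1_form k) u1)|].
apply: big_ind => [|x y|n _]; first exact (gpart0 C i (S1_alg k) (S1_form k)).
  by apply: gpart_add => //; [exact: S1_alg|exact: S1_form].
split=> [||m]; [apply: tri0; [exact: S1_alg|exact: S1_form]|exact: tri0|rewrite giotaE].
case: eqP => _; last exact: mem0v.
move: (u.2 n) (u2 n); apply: tens_part_ind => [X Y HX HY|j q x qj xj].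
  by rewrite (linear_add (tlift_linear _)) memvD.
rewrite tlift_tens; first last.
- by move=> v; apply: tens_linr.
- by move=> w; apply: (linear_compose (tens_linl w) pk_lin).
case: j qj xj => [/even_part_odd ->|_] xj.
  by rewrite (linear_zero pk_lin) tens0l mem0v.
by rewrite -[i]addbF; apply: tens_part_mem; [exact: memvf|rewrite addbF in xj].
Qed.

Lemma gproj_lmem (u : lie_g (Qbar Q) S) : lmem u -> lmem (gproj u : lie_g (S1 k) S).
Proof.
move=> [u0 [u1 [p0 p1 ->]]]; exists (gproj u0), (gproj u1).
by rewrite (linear_add gproj_linear); split=> //; apply: gproj_part.
Qed.

(** Position m + 2 of the sum of the K_n(a_n) is L_(a_m) - R_(a_(m+1)), from
    which lam extracts a_m. *)
Lemma tri_Qbar_lam (u : lie_g (Qbar Q) S) : lmem u ->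
  u.1.1 = \sum_m qtri m (lam (u.1.1 (m + 2%:R))).
Proof.
move=> [u0 [u1 [[p0 _ _] [/(tri_Qbar_odd) p1 _ _] ->]]].
have -> : (u0 + u1).1.1 = u0.1.1 by rewrite [LHS]/= p1 addr0.
have [a a0 ->] := tri_Qbar_even k_char p0.
by apply: eq_bigr => m _; rewrite qtri_sumE !ord3D lamE.
Qed.

(** The contractions of a tensor over Q with a linear form f split, as
    q = (b(q,1)/2) 1 + im q, into a part known from [gproj] and a part known
    from the component in Q0 (x) J. *)
Lemma Phi3_inj (u v : lie_g (Qbar Q) S) : lmem u -> lmem v -> Phi3 u = Phi3 v -> u = v.
Proof.
move=> um vm uv.
have gE : gproj u = gproj v.
  by apply: Phi_inj; [exact: gproj_lmem|exact: gproj_lmem|exact: (congr1 snd uv)].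
have cE f n : scalar f ->
    f (lam (u.1.1 (n + 2%:R))) = f (lam (v.1.1 (n + 2%:R))) /\
    tlift (fun (q : Q) (x : C) => f (qim q) *: x) (u.2 n) =
    tlift (fun (q : Q) (x : C) => f (qim q) *: x) (v.2 n).
  move=> fl; have := congr1 (fun w => contract f w.1) uv.
  rewrite !contract_Phi3 // => /(peirce_inj k_char) /(_ n)[-> H]; split=> //.
  by move: H; rewrite !scaleNr => /oppr_inj/scalerI; apply; rewrite invr_eq0.
rewrite (gspace_decomp u) (gspace_decomp v); congr (gtri _ _ + gtri' _ _ + _).
- rewrite (tri_Qbar_lam um) (tri_Qbar_lam vm); apply: eq_bigr => m _; congr (qtri m _).
  by apply: (@qpolarI k Q) => t; have [] := cE (b^~ t) m (@qpolar_linearl k Q t).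
- have G2 (w : G) : (gproj w).1.2 = w.1.2.
    rewrite /gproj !big_ord_recl big_ord0 /= !addr0 //.
  by rewrite -(G2 u) -(G2 v) gE.
apply: eq_bigr => n _; congr (giota n _); apply: contract_inj => f fl.
have fE (X : tensor Q S) : contract f X =
    f one *: tlift (fun (q : Q) (x : C) => (2%:R^-1 * b q one) *: x) X
    + tlift (fun (q : Q) (x : C) => f (qim q) *: x) X.
  apply: tlift_linf => q x; rewrite scalerA -scalerDl; congr (_ *: _).
  rewrite {1}[q]qimE (linear_add (W := k^o) fl) (linear_scale (W := k^o) _ _ fl).
  congr (_ + _); exact: mulrC.
rewrite !fE -!contract_gproj gE; congr (_ + _); by have [] := cE f n fl.
Qed.

End Morphism.

(** * The isomorphism *)

(* The images of the elements of the kernels of the projections of tri(Qbar)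
   are a (x) e_i with coefficient 1: since
   [(0,-R_a,L_a), (0,-R_b,L_b)] = (0,-R_[a,b],L_[a,b]) and
   [a (x) e_0, b (x) e_0] = [a,b] (x) e_0, no homomorphism can have the
   coefficient 1/2. *)
Theorem theorem3p8 (k : fieldType) (k_char : 2%N \notin [pchar k])
  (Q : quaternion_algebra k) (C : hurwitz_superalgebra k)
  (Phi : 'Hom(lie_g (S1 k) (para_hurwitz C), der (H3 C)))
  (Phi_iso : lie_iso Phi)
  (Phi_tri : forall (i : bool) (d : {ffun 'I_3 -> 'End(para_hurwitz C)}),
     tri i d -> is_Dtri d (Phi (gtri' (S1 k) d)))
  (Phi_iota : forall (n : 'I_3) (a : C),
     Phi (giota (S := S1 k) (S' := para_hurwitz C) n
            (tens (1 : k^o) (a : para_hurwitz C))) = Dder n a) :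
  exists Phi3 : 'Hom(lie_g (Qbar Q) (para_hurwitz C), lie_T Q (H3 C)),
    [/\ lie_iso Phi3,
        forall u : lie_g (S1 k) (para_hurwitz C), lmem u ->
          Phi3 (gincl Q u) = (0, Phi u),
        forall a : Q, a \in Q0 Q ->
          [/\ Phi3 (gtri (S := Qbar Q) (para_hurwitz C)
                      (triple 0 (- qright a) (qleft a)))
                = (tens a (H3_e C 0), 0),
              Phi3 (gtri (S := Qbar Q) (para_hurwitz C)
                      (triple (qleft a) 0 (- qright a)))
                = (tens a (H3_e C 1), 0) &
              Phi3 (gtri (S := Qbar Q) (para_hurwitz C)
                      (triple (- qright a) (qleft a) 0))
                = (tens a (H3_e C 2%:R), 0)] &
        forall (n : 'I_3) (a : Q) (x : C), a \in Q0 Q ->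
          Phi3 (giota (S := Qbar Q) (S' := para_hurwitz C) n
                  (tens a (x : para_hurwitz C)))
            = (- 2%:R^-1 *: tens a (H3_iota n x), 0)].
Proof.
have [Phi_part Phi_onto Phi_inj _] := Phi_iso.
have Phi_linear := linear_hom Phi.
have [lam [lam_linear lamE _ _ _]] := exists_qtrace Q k_char.
have F_linear := Phi3_fun_linear Phi_linear lam_linear.
pose Phi3 : 'Hom(lie_g (Qbar Q) (para_hurwitz C), lie_T Q (H3 C)) :=
  linfun (Phi3_fun Phi lam).
have FE u : Phi3 u = Phi3_fun Phi lam u by exact: linfunE.
have Fqtri := Phi3_qtri Phi_linear lam_linear lamE.
exists Phi3; split.
- split=> [i u ui|i w wi|u v um vm|u v um vm].
  + rewrite FE; exact (Phi3_part k_char Phi_linear lam_linear lamE Phi_iota Phi_part ui).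
  + have [u ui uw] := Phi3_onto k_char Phi_linear lam_linear lamE Phi_iota Phi_onto wi.
    by exists u => //; rewrite FE.
  + rewrite !FE; exact (Phi3_inj k_char lamE Phi_inj um vm).
  + rewrite !FE.
    exact (compat_lmem k_char Phi_linear lam_linear lamE Phi_iota Phi_tri
      (@Phi_tri_homog k C Phi Phi_iso) (@Phi_tri_comm k C Phi Phi_iso)
      (@Phi_tri_Dder k C Phi Phi_iso Phi_iota) (@Dder_next k C Phi Phi_iso Phi_iota)
      (@Phi_ttri k k_char C Phi Phi_iso Phi_iota) um vm).
- move=> u [u0 [u1 [[p0 _ _] [p1 _ _] uE]]]; rewrite FE.
  apply: (Phi3_gincl k_char Phi_linear lam_linear Phi_iota).
  by rewrite uE [LHS]/= (tri_S1 k_char p0) (tri_S1 k_char p1) addr0.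
- move=> a a0; have [<- <- <-] := qtri_triple a.
  by split; rewrite FE; apply: Fqtri.
move=> n a x a0; rewrite FE (Phi3_iota Phi_linear lam_linear Phi_iota) (qim_id a0).
have a1 : qpolar a (qone Q) = 0 by apply/Q0P.
by rewrite a1 mulr0 scale0r (linear_scale _ _ (tens_linl _)).
Qed.
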